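(* Consider the Gaussian doubly dirty multiple access channel with partial (estimated) side information at the transmitters, with noise variance $N>0$, side-information estimation distortions $E_1,E_2\ge 0$, and equal power constraints $P_1=P_2=P>0$ (the exactly balanced case), as defined in the context. Then every pair of nonnegative rates $(R_1,R_2)$ satisfying $$R_1+R_2\le \mathrm{u.c.e.}\left\{\left[\frac12\log_2\left(\frac12+\frac{P}{E_1+E_2+N}\right)\right]^+\right\}$$ is achievable, where $\mathrm{u.c.e.}$ denotes the upper convex envelope with respect to $P$.
   Context: Channel model (Gaussian doubly dirty MAC with partial side information at the transmitters). Over $n$ uses the real-valued channel output is $$\mathbf Y=\mathbf X_1+\mathbf X_2+\mathbf S_1+\mathbf S_2+\mathbf Z,$$ where all quantities are vectors in $\mathbb R^n$; $\mathbf Z$ has i.i.d. $\mathcal N(0,N)$ components; $\mathbf X_i$ is the input of user $i$, subject to the average power constraint $\frac1n\mathbb E\|\mathbf X_i\|^2\le P_i$; and $\mathbf S_i$ is the interference (side information) associated with user $i$, of arbitrary strength. Encoder $i$ does not know $\mathbf S_i$ exactly; it knows, non-causally (the entire block before transmission), only an estimated version $\tilde{\mathbf S}_i$. The pairs of components $(S_i,\tilde S_i)$ are i.i.d. over time and satisfy $\mathbb E[(S_i-\tilde S_i)^2]=E_i$, $i=1,2$. The pairs $(\mathbf S_1,\tilde{\mathbf S}_1)$, $(\mathbf S_2,\tilde{\mathbf S}_2)$, the noise $\mathbf Z$ and the messages are mutually independent. The decoder knows neither $\mathbf S_i$ nor $\tilde{\mathbf S}_i$. User $i$ has a message $W_i$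 uniform on a set of size $\lceil 2^{nR_i}\rceil$ ($W_1,W_2$ independent). Encoder $i$ maps $(W_i,\tilde{\mathbf S}_i)$ to $\mathbf X_i$, and the decoder estimates $(W_1,W_2)$ from $\mathbf Y$. Encoders may use random dither signals, independent of everything else, where the dither of encoder $i$ is known to encoder $i$ and to the decoder. A rate pair $(R_1,R_2)$ is achievable if it belongs to the closure of the set of rate pairs for which there is a sequence of such codes with error probability tending to $0$ as $n\to\infty$. Notation: $[x]^+=\max(x,0)$. The upper convex envelope of a function $f(P)$ on $P\ge 0$ (with $N,E_1,E_2$ held fixed) is the smallest concave function on $[0,\infty)$ that is everywhere at least $f$; in the claim it is evaluated at the given $P$. *)

(* Defs.v *)
From HB Require Import structures.
From mathcomp Require Import all_boot all_order all_algebra.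
From mathcomp Require Import all_classical all_reals all_analysis.
From mathcomp Require Import ring lra.

Set Implicit Arguments.
Unset Strict Implicit.
Unset Printing Implicit Defensive.

Import Order.TTheory GRing.Theory Num.Theory.
Import numFieldNormedType.Exports.

Local Open Scope classical_set_scope.
Local Open Scope ring_scope.

Section iid.
Context d (T : measurableType d) (R : realType).

Definition tcons n (x : T * n.-tuple T) : n.+1.-tuple T := [tuple of x.1 :: x.2].

Lemma measurable_tcons n : measurable_fun [set: T * n.-tuple T] (@tcons n).
Proof. exact: measurable_cons. Qed.

HB.instance Definition _ n :=
  isMeasurableFun.Build _ _ _ _ (@tcons n) (@measurable_tcons n).

(* The law of n independent samples of Q: the n-fold product measure Q^n,
   carried by n.-tuple T through (x, t) |-> x :: t. *)
Fixpoint iid_law (Q : probability T R) n : probability (n.-tuple T) R :=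
  if n is m.+1 then distribution (Q \x iid_law Q m)%E (@tcons m)
  else dirac [tuple].

End iid.

(* Sanity check: under iid_law Q n the coordinates are independent of law Q. *)
Lemma iid_law_rect d (T : measurableType d) (R : realType)
    (Q : probability T R) n (A : 'I_n -> set T) :
  (forall i, measurable (A i)) ->
  iid_law Q n [set t | forall i, A i (tnth t i)] = (\prod_(i < n) Q (A i))%E.
Proof.
elim: n A => [|n IH] A mA /=.
  by rewrite big_ord0 /dirac indicE mem_set//= => -[].
rewrite big_ord_recl /distribution /pushforward.
rewrite -IH; last by move=> i; exact: mA.
rewrite -product_measure1E//; last first.
  rewrite (_ : [set _ | _] = \bigcap_(i in [set: 'I_n])
      ((fun t : n.-tuple T => tnth t i) @^-1` A (lift ord0 i))); last first.
    apply/seteqP; split => t /= Ht i; first by move=> _; exact: Ht.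
    exact: Ht.
  apply: fin_bigcap_measurable => // i _ /=.
  by rewrite -[X in measurable X]setTI; exact: measurable_tnth.
congr (product_measure1 _ _ _); apply/seteqP; split => -[x t] /=.
  move=> H; split; first by have := H ord0.
  by move=> i; have := H (lift ord0 i); rewrite /tcons tnthS.
move=> [Hx Ht] i; case: (unliftP ord0 i) => [j ->|->//].
by rewrite /tcons tnthS; exact: Ht.
Qed.

Section gaussian.
Variable R : realType.

Definition toR : measurableTypeR R -> R := idfun.

Lemma measurable_toR : measurable_fun setT toR.
Proof. exact: measurable_id. Qed.

HB.instance Definition _ := isMeasurableFun.Build _ _ _ _ toR measurable_toR.

(* The Gaussian law of mean m and variance v. normal_prob takes a standard
   deviation, and lives on measurableTypeR R, which has the same sets and
   measurable sets as R but another display: hence the pushforward by the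
   identity. *)
Definition gaussian (m v : R) : probability R R :=
  distribution (normal_prob m (Num.sqrt v)) toR.

End gaussian.

Section channel.
Variable R : realType.

Definition num_messages (n : nat) (r : R) : nat :=
  `|Num.ceil (2 `^ (n%:R * r))|%N.

Definition sqnorm n (x : n.-tuple R) : R := \sum_(i < n) tnth x i ^+ 2.

(* A pair (s, s~) of an interference sample and of its estimate is an element of
   R * R, and a block of them an element of n.-tuple (R * R). *)
Definition interference n (s : n.-tuple (R * R)) : n.-tuple R :=
  [tuple (tnth s i).1 | i < n].
Definition estimate n (s : n.-tuple (R * R)) : n.-tuple R :=
  [tuple (tnth s i).2 | i < n].

(* Dithers live in arbitrary probability spaces; that of user i is an input of
   encoder i and of the decoder only. *)
Record code (n M1 M2 : nat) := Code {
  dither1_display : measure_display ;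
  dither2_display : measure_display ;
  dither1 : measurableType dither1_display ;
  dither2 : measurableType dither2_display ;
  dither1_law : probability dither1 R ;
  dither2_law : probability dither2 R ;
  enc1 : 'I_M1 -> n.-tuple R * dither1 -> n.-tuple R ;
  enc2 : 'I_M2 -> n.-tuple R * dither2 -> n.-tuple R ;
  dec : n.-tuple R * (dither1 * dither2) -> 'I_M1 * 'I_M2 ;
  measurable_enc1 : forall w, measurable_fun setT (enc1 w) ;
  measurable_enc2 : forall w, measurable_fun setT (enc2 w) ;
  measurable_dec : forall w, measurable (dec @^-1` [set w]) }.

(* Q1 and Q2 are the laws of the pairs (S_1, S~_1) and (S_2, S~_2); N is the
   noise variance. *)
Variables (N : R) (Q1 Q2 : probability (R * R)%type R).

Definition noise_law n : probability (n.-tuple R) R :=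
  iid_law (gaussian 0 N) n.

Section one_code.
Variables (n M1 M2 : nat) (c : code n M1 M2).

Definition output (x1 x2 : n.-tuple R) (s1 s2 : n.-tuple (R * R))
    (z : n.-tuple R) : n.-tuple R :=
  [tuple tnth x1 i + tnth x2 i + tnth (interference s1) i
         + tnth (interference s2) i + tnth z i | i < n].

Definition error_event (w1 : 'I_M1) (w2 : 'I_M2) :
    set (n.-tuple (R * R) * n.-tuple (R * R) * n.-tuple R
         * (dither1 c * dither2 c)) :=
  [set q | let: (s1, s2, z, (u1, u2)) := q in
    dec (output (enc1 w1 (estimate s1, u1)) (enc2 w2 (estimate s2, u2)) s1 s2 z,
         (u1, u2)) <> (w1, w2)].

Definition error_probability : \bar R :=
  (((M1%:R * M2%:R)^-1)%:E *
   \sum_(w1 < M1) \sum_(w2 < M2)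
     (iid_law Q1 n \x iid_law Q2 n \x noise_law n
      \x (dither1_law c \x dither2_law c)) (error_event w1 w2))%E.

(* n^-1 E||X_i||^2, the expectation being over the message, the interference
   estimate and the dither. *)
Definition power1 : \bar R :=
  ((n%:R^-1)%:E * ((M1%:R^-1)%:E * \sum_(w < M1)
    'E_(iid_law Q1 n \x dither1_law c)
      [fun q => sqnorm (enc1 w (estimate q.1, q.2))]))%E.
Definition power2 : \bar R :=
  ((n%:R^-1)%:E * ((M2%:R^-1)%:E * \sum_(w < M2)
    'E_(iid_law Q2 n \x dither2_law c)
      [fun q => sqnorm (enc2 w (estimate q.1, q.2))]))%E.

End one_code.

Definition reliable_rates (P1 P2 : R) : set (R * R) :=
  [set r | [/\ 0 <= r.1, 0 <= r.2 &
    exists c : forall n, code n (num_messages n r.1) (num_messages n r.2),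
      (forall n, (0 < n)%N ->
         (power1 (c n) <= P1%:E)%E /\ (power2 (c n) <= P2%:E)%E) /\
      error_probability (c n) @[n --> \oo] --> 0%E]].

Definition achievable (P1 P2 R1 R2 : R) : Prop :=
  closure (reliable_rates P1 P2) (R1, R2).

End channel.

Section upper_convex_envelope.
Variable R : realType.

Definition concave_majorant (f g : R -> R) : Prop :=
  convex_function (`[0, +oo[%classic : set R) (\- g) /\
  forall x, 0 <= x -> f x <= g x.

Definition is_upper_convex_envelope (f g : R -> R) : Prop :=
  concave_majorant f g /\
  forall h, concave_majorant f h -> forall x, 0 <= x -> g x <= h x.

Lemma is_upper_convex_envelope_exists (f : R -> R) :
  (exists h, concave_majorant f h) -> exists g, is_upper_convex_envelope f g.
Proof.
move=> [h0 h0P].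
pose V x := [set h x | h in concave_majorant f].
have Vlb x : 0 <= x -> has_inf (V x).
  move=> x0; split; first by exists (h0 x), h0.
  by exists (f x) => _ [h [_ fh] <-]; exact: fh.
have infV h x : concave_majorant f h -> 0 <= x -> inf (V x) <= h x.
  by move=> hP x0; apply: ge_inf; [exact: (Vlb x x0).2 | exists h].
exists (fun x => inf (V x)); split; last by move=> h hP x; exact: infV.
split; last first.
  move=> x x0; apply: lb_le_inf; first exact: (Vlb x x0).1.
  by move=> _ [h [_ fh] <-]; exact: fh.
move=> t x y xD yD.
have x0 : 0 <= x by move: xD; rewrite inE/= in_itv/= andbT.
have y0 : 0 <= y by move: yD; rewrite inE/= in_itv/= andbT.
rewrite /= !convRE.
set z := (X in inf (V X)).
have z0 : 0 <= z.
  by apply: addr_ge0; apply: mulr_ge0 => //; rewrite ?subr_ge0.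
rewrite lerNl; apply: lb_le_inf; first exact: (Vlb z z0).1.
move=> _ [h hP <-].
have := hP.1 t x y xD yD; rewrite /= !convRE -/z lerNl; apply: le_trans.
have t0 : 0 <= t%:num by [].
have t1 : 0 <= 1 - t%:num by rewrite subr_ge0.
rewrite (@lerN2 R) (@lerD R)//.
  by apply: (@ler_wpM2l R) => //; rewrite lerN2; exact: infV.
by apply: (@ler_wpM2l R) => //; rewrite lerN2; exact: infV.
Qed.

End upper_convex_envelope.

Definition log2 (R : realType) (x : R) : R := ln x / ln 2.

(* The envelope is a genuine one: the function below has a concave majorant. *)
Lemma sum_rate_envelope_exists (R : realType) (D : R) : 0 < D ->
  exists g, is_upper_convex_envelope
    (fun p => Num.max (2^-1 * log2 (2^-1 + p / D)) 0) g.
Proof.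
move=> D0; apply: is_upper_convex_envelope_exists.
have l2 : 0 < ln (2 : R) by rewrite ln_gt0// ltr1n.
exists (fun p => 2^-1 * (p / D / ln 2)); split.
  move=> t x y _ _; rewrite le_eqVlt; apply/orP; left; apply/eqP.
  suff E (s a b : R) : - (2^-1 * ((s * a + (1 - s) * b) / D / ln 2)) =
      s * - (2^-1 * (a / D / ln 2)) + (1 - s) * - (2^-1 * (b / D / ln 2)).
    exact: E.
  by field; rewrite !gt_eqF.
move=> p p0; rewrite ge_max; apply/andP; split; last first.
  by rewrite mulr_ge0 ?invr_ge0// divr_ge0 ?divr_ge0// ltW.
rewrite ler_pM2l ?invr_gt0// ler_pM2r ?invr_gt0//.
have pD : 0 <= p / D by rewrite divr_ge0 // ltW.
have : ln (1 + (p / D - 2^-1)) <= p / D - 2^-1 by apply: le_ln1Dx; lra.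
have -> : 1 + (p / D - 2^-1) = 2^-1 + p / D by lra.
by move/le_trans; apply; lra.
Qed.

(* Main.v *)
Require Import Defs.
From HB Require Import structures.
From mathcomp Require Import all_boot all_order all_algebra.
From mathcomp Require Import all_classical all_reals all_analysis.
From mathcomp Require Import measurable_realfun zify ring lra.
Set Implicit Arguments.
Unset Strict Implicit.
Unset Printing Implicit Defensive.
Import Order.TTheory GRing.Theory Num.Theory.
Import numFieldNormedType.Exports.
Local Open Scope classical_set_scope.
Local Open Scope ring_scope.

(* Modulo-lattice transmission, with the lattice replaced by an arithmetic progression
   {m g : m < M} on a torus (R/LZ)^k whose fundamental cube contains the Euclidean ball of
   squared radius k p. Each user sends the small representative X_i of
   T_i = A_i + w_i B_i - alpha S~_i modulo the progression, where the dithers A_i, B_i are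
   uniform on the torus, hence T_i is uniform and independent of the interference. Since
   the sum of two progressions of length M is one of length 2M, both interference
   estimates are removed together, and after scaling by alpha = 2p/(2p+D),
   D = E1+E2+N, the receiver sees the sum of the codewords plus a noise
   - (1-alpha)(X_1+X_2) + alpha (S_1-S~_1+S_2-S~_2+Z) of energy about k 2pD/(2p+D).
   - Covering: for d <> 0 the point d g is uniform when g is, so the second moment method
     yields a g whose progression meets a ball of radius sqrt(k p) around almost every
     point as soon as M times the normalised volume of that ball tends to infinity.
   - <X_1,X_2> is small: this is a union bound over pairs of translates, because a cap of
     the ball is contained in a strictly smaller ball.
   - The cross terms with the estimation errors and Z vanish by Chebyshev's inequality,
     and the squared norms concentrate by the weak law of large numbers.
   - Wrong messages: for w' <> w the point tested is uniform, so a union bound gives error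
     probability at most 2 M M_1 M_2 times the volume of the noise ball. Volumes scale
     like radius^k, hence the sum rate 1/2 log2(p / (2pD/(2p+D))) = 1/2 log2(1/2 + p/D).
   Below the abscissa q of the point of the curve whose tangent goes through the origin,
   the envelope is at most this tangent, which is reached by using power q during a
   fraction P/q of the time; above q the curve is its own envelope. *)

(** * Product laws *)

(** The torus is normalised to R/Z: 1/4 is the largest squared radius of a ball contained in the
    fundamental cube, and an amplitude [L] with [L ^+ 2 / 4 = k p] carries the power. One random
    generator suffices because, for a uniform [t], the points [t - m g] are pairwise independent,
    which is all that the second moment method asks. The multipliers [w] of [B] do the same for
    codewords, so that no random codebook is needed. As [g] is only known to exist, nothing is known
    of the law of the quantised inputs beyond their radius; their near orthogonality is therefore
    paid for by about [M ^+ 2] caps. This limits the progression from above: with [b] the volume of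
    the ball, [M b] is about [s ^+ k], where [s > 1] for covering, but [s ^+ 2 * cI] and
    [s * theta * x] must stay below 1. Here [cI] and [theta] are the relative radii of the ball
    around the cap and of the decoding ball, and [x ^+ k] is the order of the number of message
    pairs. All slack comes from a strict rate inequality; equality is recovered by the closure in
    the definition of achievability. *)

Lemma measurable_preim d d' (T : measurableType d) (T' : measurableType d')
    (f : T -> T') (A : set T') :
  measurable_fun setT f -> measurable A -> measurable [set x | A (f x)].
Proof. by move=> mf mA; rewrite -[X in measurable X]setTI; exact: mf. Qed.

Section product_probability.
Context d1 d2 (T1 : measurableType d1) (T2 : measurableType d2) (R : realType).
Variables (P1 : probability T1 R) (P2 : probability T2 R).
Local Open Scope ereal_scope.

Lemma product_probE A : (P1 \x P2) A = \int[P1]_x P2 [set y | A (x, y)].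
Proof. by apply: eq_integral => x _; rewrite /= xsectionE. Qed.

Lemma product_prob_swapE A : measurable A ->
  (P1 \x P2) A = \int[P2]_y P1 [set x | A (x, y)].
Proof.
move=> mA; rewrite (product_measure_unique (m' := (P1 \x^ P2)))//.
- by apply: eq_integral => y _; rewrite /= ysectionE.
- by move=> B C mB mC; exact: product_measure2E.
Qed.

Lemma measurable_section_l (A : set (T1 * T2)) x :
  measurable A -> measurable [set y | A (x, y)].
Proof. by move=> mA; have := measurable_xsection x mA; rewrite xsectionE. Qed.

Lemma measurable_section_r (A : set (T1 * T2)) y :
  measurable A -> measurable [set x | A (x, y)].
Proof. by move=> mA; have := measurable_ysection y mA; rewrite ysectionE. Qed.

Lemma measurable_fun_prob_section_l (A : set (T1 * T2)) :
  measurable A -> measurable_fun setT (P2 \o (fun x => [set y | A (x, y)])).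
Proof.
move=> mA; have := measurable_fun_xsection P2 mA.
by congr (measurable_fun _ _); apply/funext => x /=; rewrite xsectionE.
Qed.

Lemma measurable_fun_prob_section_r (A : set (T1 * T2)) :
  measurable A -> measurable_fun setT (P1 \o (fun y => [set x | A (x, y)])).
Proof.
move=> mA; have := measurable_fun_ysection P1 mA.
by congr (measurable_fun _ _); apply/funext => x /=; rewrite ysectionE.
Qed.

Lemma product_prob_le_l (A : set (T1 * T2)) (B : set T1) (c : \bar R) :
  measurable A -> measurable B -> 0 <= c ->
  (forall x y, A (x, y) -> B x) ->
  (forall x, B x -> P2 [set y | A (x, y)] <= c) ->
  (P1 \x P2) A <= P1 B * c.
Proof.
move=> mA mB c0 AB Ac; rewrite product_probE.
apply: (@le_trans _ _ (\int[P1]_x ((\1_B x)%:E * c))); last first.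
  by rewrite ge0_integralZr// ?integral_indic ?setIT//; exact: measurableT_comp.
apply: ge0_le_integral => //.
- exact: measurable_fun_prob_section_l.
- by apply: emeasurable_funM => //; exact: measurableT_comp.
- move=> x _; rewrite indicE; have [xB|xB] := boolP (x \in B).
    by rewrite mul1e; apply: Ac; rewrite inE in xB.
  rewrite mul0e (_ : [set _ | _] = set0) ?measure0//.
  apply/seteqP; split=> // y /= /AB Bx.
  by rewrite notin_setE in xB.
Qed.

Lemma product_prob_le_r (A : set (T1 * T2)) (B : set T2) (c : \bar R) :
  measurable A -> measurable B -> 0 <= c ->
  (forall x y, A (x, y) -> B y) ->
  (forall y, B y -> P1 [set x | A (x, y)] <= c) ->
  (P1 \x P2) A <= P2 B * c.
Proof.
move=> mA mB c0 AB Ac; rewrite product_prob_swapE//.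
apply: (@le_trans _ _ (\int[P2]_x ((\1_B x)%:E * c))); last first.
  by rewrite ge0_integralZr// ?integral_indic ?setIT//; exact: measurableT_comp.
apply: ge0_le_integral => //.
- exact: measurable_fun_prob_section_r.
- by apply: emeasurable_funM => //; exact: measurableT_comp.
- move=> x _; rewrite indicE; have [xB|xB] := boolP (x \in B).
    by rewrite mul1e; apply: Ac; rewrite inE in xB.
  rewrite mul0e (_ : [set _ | _] = set0) ?measure0//.
  apply/seteqP; split=> // y /= /AB Bx.
  by rewrite notin_setE in xB.
Qed.

Lemma product_prob_le (A : set (T1 * T2)) (c : \bar R) :
  measurable A -> 0 <= c ->
  (forall x, P2 [set y | A (x, y)] <= c) -> (P1 \x P2) A <= c.
Proof.
move=> mA c0 H; apply: le_trans (product_prob_le_l (B := setT) mA _ c0 _ _) _ => //.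
by rewrite probability_setT mul1e.
Qed.

Lemma product_prob_ler (A : set (T1 * T2)) (c : \bar R) :
  measurable A -> 0 <= c ->
  (forall y, P1 [set x | A (x, y)] <= c) -> (P1 \x P2) A <= c.
Proof.
move=> mA c0 H; apply: le_trans (product_prob_le_r (B := setT) mA _ c0 _ _) _ => //.
by rewrite probability_setT mul1e.
Qed.

(** By Fubini, a map that preserves the law on every fibre preserves the product, even if it varies
    with the fibre. This is what keeps a dither uniform and independent of the interference estimate
    by which it is shifted. *)
Lemma product_prob_map_r (tau : T1 * T2 -> T2) (A : set (T1 * T2)) :
  measurable_fun setT tau ->
  (forall x (B : set T2), measurable B -> P2 [set y | B (tau (x, y))] = P2 B) ->
  measurable A -> (P1 \x P2) [set q | A (q.1, tau q)] = (P1 \x P2) A.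
Proof.
move=> mtau tauP mA; rewrite !product_probE.
by apply: eq_integral => x _; apply: (tauP x); exact: measurable_section_l.
Qed.

Lemma product_prob_map_l (tau : T1 * T2 -> T1) (A : set (T1 * T2)) :
  measurable_fun setT tau ->
  (forall y (B : set T1), measurable B -> P1 [set x | B (tau (x, y))] = P1 B) ->
  measurable A -> (P1 \x P2) [set q | A (tau q, q.2)] = (P1 \x P2) A.
Proof.
move=> mtau tauP mA; rewrite !product_prob_swapE//; last first.
  rewrite -[X in measurable X]setTI.
  by apply: (measurable_fun_pair mtau measurable_snd).
by apply: eq_integral => y _; apply: (tauP y); exact: measurable_section_r.
Qed.

Lemma product_prob_map (f : T1 -> T1) (g : T2 -> T2) (A : set (T1 * T2)) :
  measurable_fun setT f -> measurable_fun setT g ->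
  (forall B, measurable B -> P1 [set x | B (f x)] = P1 B) ->
  (forall B, measurable B -> P2 [set x | B (g x)] = P2 B) ->
  measurable A -> (P1 \x P2) [set q | A (f q.1, g q.2)] = (P1 \x P2) A.
Proof.
move=> mf mg fP gP mA.
rewrite -(@product_prob_map_r (g \o snd) A)//; last first.
  exact: measurableT_comp.
rewrite -(@product_prob_map_l (f \o fst) [set q | A (q.1, g q.2)])//.
  exact: measurableT_comp.
rewrite -[X in measurable X]setTI.
apply: (measurable_fun_pair (f := fst) (g := g \o snd)) => //.
exact: measurableT_comp.
Qed.

End product_probability.

Section iid_law_theory.
Context d (T : measurableType d) (R : realType) (Q : probability T R).

Lemma iid_lawSE n (A : set (n.+1.-tuple T)) :
  iid_law Q n.+1 A = (Q \x iid_law Q n)%E [set q | A (tcons q)].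
Proof. by []. Qed.

Lemma measurable_preim_tcons n (A : set (n.+1.-tuple T)) :
  measurable A -> measurable [set q | A (@tcons _ T n q)].
Proof. by move=> mA; rewrite -[X in measurable X]setTI; exact: measurable_tcons. Qed.

Lemma ge0_integral_iid_lawS n (F : n.+1.-tuple T -> \bar R) :
  measurable_fun setT F -> (forall t, (0 <= F t)%E) ->
  (\int[iid_law Q n.+1]_t F t =
   \int[iid_law Q n]_t \int[Q]_x F (tcons (x, t)))%E.
Proof.
move=> mF F0; rewrite /= ge0_integral_distribution//.
rewrite fubini_tonelli2//=.
exact: (measurableT_comp mF (@measurable_tcons _ _ n)).
Qed.

Lemma measurable_map_tuple d' (T' : measurableType d') n (f : 'I_n -> T -> T') :
  (forall i, measurable_fun setT (f i)) ->
  measurable_fun setT (fun t : n.-tuple T => [tuple f i (tnth t i) | i < n]).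
Proof.
move=> mf; apply/measurable_fun_tnthP => i.
rewrite (_ : _ \o _ = f i \o (@tnth _ _ ^~ i)); last first.
  by apply/funext => t /=; rewrite tnth_mktuple.
by apply: measurableT_comp => //; exact: measurable_tnth.
Qed.

Lemma measurable_forall_tnth n (D : set T) : measurable D ->
  measurable [set t : n.-tuple T | forall i, D (tnth t i)].
Proof.
move=> mD; rewrite (_ : [set _ | _] = \bigcap_(i in [set: 'I_n])
    ((fun t : n.-tuple T => tnth t i) @^-1` D)); last first.
  apply/seteqP; split => t /= Ht i; first by move=> _; exact: Ht.
  exact: Ht.
apply: fin_bigcap_measurable => // i _ /=.
by rewrite -[X in measurable X]setTI; exact: measurable_tnth.
Qed.

(* A coordinatewise change of variables; with [D = setT] and [c = 1] it is the
   invariance of the product law, with [c < 1] a scaling. *)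
Lemma iid_law_map_le n (f : 'I_n -> T -> T) (D : set T) (c : R) :
  measurable D -> 0 <= c -> (forall i, measurable_fun setT (f i)) ->
  (forall i B, measurable B ->
     (Q [set x | D x /\ B (f i x)] <= c%:E * Q B)%E) ->
  forall A, measurable A ->
  (iid_law Q n [set t | (forall i, D (tnth t i)) /\
     A [tuple f i (tnth t i) | i < n]] <= (c ^+ n)%:E * iid_law Q n A)%E.
Proof.
move=> mD c0; elim: n f => [|n IH] f mf fD A mA.
  rewrite expr0 mul1e; apply: le_measure; rewrite ?inE//.
  - apply: measurableI; first exact: measurable_forall_tnth.
    rewrite -[X in measurable X]setTI.
    exact: (measurable_map_tuple mf).
  - by move=> t [_]; congr A; apply: eq_from_tnth => -[].
have mDn k : measurable [set t : k.-tuple T | forall i, D (tnth t i)].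
  exact: measurable_forall_tnth.
pose f' i := f (lift ord0 i).
have mf' i : measurable_fun setT (f' i) by exact: mf.
have mmap := measurable_map_tuple mf'.
set A' := [set t | _].
have mA' : measurable A'.
  apply: measurableI => //; rewrite -[X in measurable X]setTI.
  exact: (measurable_map_tuple mf).
have A'E x t : A' (tcons (x, t)) <-> (D x /\ forall i, D (tnth t i)) /\
    A (tcons (f ord0 x, [tuple f' i (tnth t i) | i < n])).
  rewrite /A' /=.
  have -> : [tuple f i (tnth (tcons (x, t)) i) | i < n.+1] =
      tcons (f ord0 x, [tuple f' i (tnth t i) | i < n]).
    apply: eq_from_tnth => i; rewrite tnth_mktuple.
    case: (unliftP ord0 i) => [j ->|->//].
    by rewrite /tcons !tnthS tnth_mktuple.
  split=> -[H HA]; split=> //.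
    split; first by have := H ord0.
    by move=> i; have := H (lift ord0 i); rewrite /tcons tnthS.
  move=> i; case: (unliftP ord0 i) => [j ->|->]; last exact: H.1.
  by rewrite /tcons tnthS; exact: H.2.
rewrite !iid_lawSE exprS.
(* Intermediate event: the tail is already mapped, the head not yet. The head is treated for a fixed
   tail, then the tail for a fixed head by induction. *)
pose B := [set q : T * n.-tuple T | (forall i, D (tnth q.2 i)) /\
   A (tcons (q.1, [tuple f' i (tnth q.2 i) | i < n]))].
have mB : measurable B.
  apply: measurableI.
    exact: (measurable_preim (f := snd) _ (mDn n)).
  apply: (measurable_preim (f := fun q : T * n.-tuple T =>
      (q.1, [tuple f' i (tnth q.2 i) | i < n])) _ (measurable_preim_tcons mA)).
  by apply: measurable_fun_pair => //; exact: (measurableT_comp mmap measurable_snd).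
apply: (@le_trans _ _ (c%:E * (Q \x iid_law Q n) B)%E).
  rewrite !product_prob_swapE//; last exact: measurable_preim_tcons.
  rewrite -ge0_integralZl//; last exact: measurable_fun_prob_section_r.
  apply: ge0_le_integral => //.
  - by apply: measurable_fun_prob_section_r; exact: measurable_preim_tcons.
  - apply: measurable_funeM; exact: (measurable_fun_prob_section_r _ mB).
  move=> t _.
  rewrite (_ : [set x | _] = [set x | D x /\ [set y | B (y, t)] (f ord0 x)]).
    apply: fD; exact: measurable_section_r.
  apply/seteqP; split=> x /=; first by move=> /A'E[[? ?] ?]; split.
  by move=> [? [? ?]]; apply/A'E.
rewrite EFinM -muleA; apply: lee_wpmul2l; first by rewrite lee_fin.
rewrite !product_probE -ge0_integralZl//; last 2 first.
- by apply: measurable_fun_prob_section_l; exact: measurable_preim_tcons.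
- by rewrite lee_fin exprn_ge0.
apply: ge0_le_integral => //.
- exact: measurable_fun_prob_section_l.
- apply: measurable_funeM.
  exact: (measurable_fun_prob_section_l _ (measurable_preim_tcons mA)).
- move=> x _; apply: (IH f' mf' _ [set t | A (tcons (x, t))]).
    by move=> i C mC; exact: fD.
  exact: (measurable_section_l x (measurable_preim_tcons mA)).
Qed.
End iid_law_theory.

(** * The uniform law on the torus *)

Section centered_fractional_part.
Variable R : realType.
Implicit Types (x y a c : R) (m : int).

(** Shortest representative modulo 1. Points of the torus are handled as arbitrary reals and reduced
    when they are measured. *)
Definition cfrac x : R := x - (Num.floor (x + 2^-1))%:~R.

Lemma cfrac_itv x : - 2^-1 <= cfrac x < 2^-1.
Proof.
have /andP[] := floor_itv (x + 2^-1); rewrite intrD /cfrac.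
set z := (Num.floor _)%:~R => h1 h2; apply/andP; split; lra.
Qed.

Lemma cfracDz x m : cfrac (x + m%:~R) = cfrac x.
Proof.
rewrite /cfrac (_ : x + m%:~R + 2^-1 = x + 2^-1 + m%:~R); last by rewrite addrAC.
by rewrite floorDrz ?intr_int// intrKfloor intrD; lra.
Qed.

Lemma cfrac_id x : - 2^-1 <= x < 2^-1 -> cfrac x = x.
Proof.
move=> /andP[h1 h2]; rewrite /cfrac (@floor_def _ _ 0) ?subr0//.
by apply/andP; rewrite /=; split; lra.
Qed.

Lemma cfracP x : exists m, cfrac x = x + m%:~R.
Proof. by exists (- Num.floor (x + 2^-1)); rewrite intrN. Qed.

Lemma cfracDl x y : cfrac (cfrac x + y) = cfrac (x + y).
Proof. by have [m ->] := cfracP x; rewrite addrAC cfracDz. Qed.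

(** With [y = x + m] and [z] the integer nearest to [y], [y^2 - (y - z)^2 = z (2 y - z)], and for an
    integer [z] the two factors never have opposite signs. *)
Lemma cfrac_sqr_le x m : cfrac x ^+ 2 <= (x + m%:~R) ^+ 2.
Proof.
rewrite -(cfracDz x m) /cfrac; set y := x + _.
have /andP[] := floor_itv (y + 2^-1); rewrite intrD.
set z := Num.floor _ => h1 h2.
have [z0|[z1|z1]] : z = 0 \/ ((1 : R) <= z%:~R \/ z%:~R <= (-1 : R)).
- case: (ltrgtP z 0) => zz; [right; right|right; left|by left].
    by rewrite -[-1]/((-1)%:~R) ler_int; lia.
  by rewrite -[1]/(1%:~R) ler_int.
- by rewrite z0 subr0.
- by rewrite -subr_ge0 (_ : _ - _ = z%:~R * (2 * y - z%:~R)); [apply: mulr_ge0; lra|ring].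
- by rewrite -subr_ge0 (_ : _ - _ = - z%:~R * (z%:~R - 2 * y)); [apply: mulr_ge0; lra|ring].
Qed.

Lemma cfrac_sqr_le_id x : cfrac x ^+ 2 <= x ^+ 2.
Proof. by have := cfrac_sqr_le x 0; rewrite addr0. Qed.

(** [cfrac] is not odd, since [1/2] and [-1/2] both go to [-1/2]. The squares agree because each is
    the minimum over a class modulo 1, and the two classes are opposite. *)
Lemma cfracN_sqr x : cfrac (- x) ^+ 2 = cfrac x ^+ 2.
Proof.
have H y : cfrac (- y) ^+ 2 <= cfrac y ^+ 2.
  have [m ->] := cfracP y; rewrite -(sqrrN (y + _)) opprD -intrN.
  exact: cfrac_sqr_le.
by apply/le_anti; rewrite H -{1}(opprK x) H.
Qed.

Lemma measurable_cfrac : measurable_fun setT cfrac.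
Proof.
apply: measurable_funB => //.
apply: (measurableT_comp (f := fun y => (Num.floor y)%:~R : R)).
  apply: nondecreasing_measurable => // y z yz.
  by rewrite ler_int; apply: le_floor.
exact: measurable_funD.
Qed.

End centered_fractional_part.

Section torus_law.
Variable R : realType.
Local Notation mu := (@lebesgue_measure R).

Lemma measurable_affine (a c : R) : measurable_fun setT (fun x : R => a + c * x).
Proof. by apply: measurable_funD => //; exact: measurable_funM. Qed.

(** [c] times the pushforward has the right values on half-open intervals, and these characterise
    Lebesgue measure. *)
Lemma lebesgue_measure_affine (a c : R) (A : set R) : 0 < c -> measurable A ->
  mu [set x | A (a + c * x)] = (c^-1%:E * mu A)%E.
Proof.
move=> c0 mA.
pose phi : R -> measurableTypeR R := fun x => a + c * x.
have c0' : 0 <= c by exact: ltW.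
have mphi : measurable_fun [set: measurableTypeR R] phi by exact: measurable_affine.
pose nu := mscale (NngNum c0') (pushforward mu phi).
suff -> : mu A = nu mphi A.
  rewrite /nu /mscale /= muleA -EFinM mulVf ?gt_eqF// mul1e.
  by [].
apply: (@lebesgue_measure_unique R (nu mphi)) => // _ [[u v]] _ <-.
transitivity (c%:E * mu (phi @^-1` `]u, v]%classic))%E; last by [].
rewrite (_ : phi @^-1` _ = `](u - a) / c, (v - a) / c]%classic); last first.
  apply/seteqP; split => x /=; rewrite !in_itv/= /phi;
  by rewrite ltr_pdivrMr// ler_pdivlMr// ltrBlDl lerBrDl (mulrC x).
rewrite !lebesgue_measure_itv /= !lte_fin (@ltr_pM2r R) ?invr_gt0// ltrD2r.
case: ifPn => _; last by rewrite mule0.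
by rewrite -!EFinD -EFinM; congr EFin; field; rewrite gt_eqF.
Qed.

Lemma Nhalf_lt_half : - 2^-1 < 2^-1 :> R. Proof. by lra. Qed.

Definition torus : probability R R :=
  distribution (uniform_prob Nhalf_lt_half) (@toR R).

Lemma torus_closedE (S : set R) : measurable S ->
  torus S = mu (S `&` `[- 2^-1, 2^-1]).
Proof.
move=> mS.
transitivity (uniform_prob Nhalf_lt_half S); first by [].
rewrite /uniform_prob integral_uniform_pdf.
rewrite (eq_integral (fun=> 1%E)); last first.
  move=> x; rewrite inE => -[_]; rewrite /= in_itv/= /uniform_pdf => ->.
  by rewrite (_ : 2^-1 - _ = 1) ?invr1//; lra.
by rewrite integral_cst ?mul1e//; exact: measurableI.
Qed.

Lemma torusE (S : set R) : measurable S ->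
  torus S = mu (S `&` `[- 2^-1, 2^-1[).
Proof.
move=> mS; rewrite torus_closedE//.
have E : (S `&` `[- 2^-1, 2^-1] =
    (S `&` `[- 2^-1, 2^-1[) `|` (S `&` [set 2^-1]))%classic.
  rewrite -setIUr; congr (_ `&` _); apply/seteqP; split=> x /=;
    rewrite !in_itv/=.
    move=> /andP[-> h] /=; move: h; rewrite le_eqVlt => /orP[/eqP|]; by [right|left].
  move=> [/andP[-> /ltW ->]//|->]; rewrite lexx andbT; lra.
rewrite E measureU//; [|exact: measurableI|exact: measurableI|].
  rewrite [X in (_ + X)%E](_ : _ = 0%E) ?adde0//.
  apply: (@subset_measure0 _ _ _ mu _ [set 2^-1]) => //.
  - exact: measurableI.
  - exact: lebesgue_measure_set1.
apply/seteqP; split=> x //= -[[_]]; rewrite in_itv/= => /andP[_ h] [_ xE].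
by move: h; rewrite xE ltxx.
Qed.

(** Mass of [S], read modulo 1, in the window [[c, c + l[]. It is additive in [l] and 1-periodic in
    [c], so a window of integer length [d] carries [d] times the mass of [S] wherever it starts. *)
Let per (S : set R) (c l : R) : \bar R :=
  mu [set y | c <= y < c + l /\ S (cfrac y)].

Let measurable_per (S : set R) (c l : R) : measurable S ->
  measurable [set y | c <= y < c + l /\ S (cfrac y)].
Proof.
move=> mS; rewrite (_ : [set _ | _] =
  (`[c, c + l[ `&` [set y | S (cfrac y)])%classic).
  apply: measurableI => //; exact: (measurable_preim (@measurable_cfrac R)).
by apply/seteqP; split => x /=; rewrite in_itv.
Qed.

Let per_add S c l l' : measurable S -> 0 <= l -> 0 <= l' ->
  per S c (l + l') = (per S c l + per S (c + l) l')%E.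
Proof.
move=> mS l0 l'0; rewrite /per -measureU//; [|exact: measurable_per..|].
  congr (mu _); apply/seteqP; split => x /=.
    move=> [/andP[h1 h2] h3]; have [h|h] := ltP x (c + l); [left|right];
    by split=> //; apply/andP; split => //; lra.
  by move=> [] [/andP[h1 h2] h3]; split=> //; apply/andP; split; lra.
by apply/seteqP; split => x //= [[/andP[h1 h2] _] [/andP[h3 h4] _]]; lra.
Qed.

Let per_shift S c l (m : int) : measurable S ->
  per S (c + m%:~R) l = per S c l.
Proof.
move=> mS; rewrite /per.
have := @lebesgue_measure_affine (m%:~R) 1 _ ltr01
  (@measurable_per S (c + m%:~R) l mS).
rewrite invr1 mul1e => <-; congr (mu _); apply/seteqP; split => x /=.
  move=> [/andP[h1 h2] h3]; split; first by apply/andP; split; lra.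
  by move: h3; rewrite mul1r addrC cfracDz.
move=> [/andP[h1 h2] h3]; split; first by apply/andP; split; lra.
by rewrite mul1r addrC cfracDz.
Qed.

Let per1 S c : measurable S -> per S c 1 = torus S.
Proof.
move=> mS; have [m cE] := cfracP c.
have /andP[h1 h2] := cfrac_itv c.
rewrite -(per_shift _ _ m)// -cE; move: (cfrac c) h1 h2 => {cE m}c h1 h2.
(* The window [[c, c + 1[] is cut at [1/2], and its right part is moved back by one period to fill
   [[-1/2, c[]. *)
have -> : (1 : R) = (2^-1 - c) + (c + 2^-1) by lra.
rewrite per_add//; [|lra|lra].
have -> : c + (2^-1 - c) = - 2^-1 + 1%:~R by lra.
rewrite (@per_shift _ (-2^-1) _ 1)// addeC.
have -> : c = - 2^-1 + (c + 2^-1) by lra.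
have -> : 2^-1 - (- 2^-1 + (c + 2^-1)) = 2^-1 - c by lra.
have -> : (- 2^-1 + (c + 2^-1)) + 2^-1 = c + 2^-1 by lra.
rewrite -per_add//; [|lra|lra].
rewrite torusE// /per; congr (mu _); apply/seteqP; split=> x /=;
  rewrite in_itv/=.
  move=> [/andP[u v]].
  have xi : - 2^-1 <= x < 2^-1 by apply/andP; split; lra.
  by rewrite cfrac_id.
move=> [Sx] xi; rewrite cfrac_id//; split=> //.
by move/andP: xi => [? ?]; apply/andP; split; lra.
Qed.

Let perM S c d : measurable S -> per S c d%:R = (d%:R%:E * torus S)%E.
Proof.
move=> mS; elim: d c => [|d IH] c.
  rewrite mul0e /per (_ : [set _ | _] = set0) ?measure0//.
  by apply/seteqP; split=> x //= [/andP[? ?] _]; lra.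
rewrite -natr1 per_add// IH per1// EFinD ge0_muleDl ?mul1e//.
Qed.

(** The map sends the unit window to a window of length [d], which covers the torus [d] times, while
    preimages have their lengths divided by [d]. *)
Lemma torus_affine (a : R) (d : nat) (S : set R) : (0 < d)%N -> measurable S ->
  torus [set x | S (cfrac (a + d%:R * x))] = torus S.
Proof.
move=> d0 mS; have d0' : 0 < d%:R :> R by rewrite ltr0n.
have mS' : measurable [set x | S (cfrac (a + d%:R * x))].
  have mf : measurable_fun setT (fun x : R => cfrac (a + d%:R * x)) :=
    measurableT_comp (@measurable_cfrac R) (measurable_affine _ _).
  exact: (measurable_preim mf mS).
rewrite torusE//.
transitivity ((d%:R^-1)%:E * per S (a - d%:R / 2) d%:R)%E; last first.
  by rewrite perM// muleA -EFinM mulVf ?mul1e// gt_eqF.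
rewrite -(lebesgue_measure_affine a d0' (measurable_per (a - d%:R / 2) d%:R mS)).
congr (mu _); apply/seteqP; split => x /=; rewrite in_itv/=.
  move=> [Sx /andP[h1 h2]]; split=> //; apply/andP; split; nra.
move=> [/andP[h1 h2] Sx]; split=> //; apply/andP; split.
  by rewrite -(ler_pM2l d0'); lra.
by rewrite -(ltr_pM2l d0'); lra.
Qed.

(** No reduction modulo 1 occurs: for [|x| <= c / 2] the dilated point stays in the fundamental
    interval. The form [0 + c^-1 * x] is that of the affine change of variables. *)
Lemma torus_scale_le (c : R) (S : set R) : 0 < c <= 1 -> measurable S ->
  (torus [set x : R | (`|x| <= c / 2)%R /\ S (0 + c^-1 * x)%R] <= c%:E * torus S)%E.
Proof.
move=> /andP[c0 c1] mS.
have mI : measurable [set x : R | `|x| <= c / 2].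
  rewrite (_ : [set _ | _] = `[- (c / 2), c / 2]%classic).
    exact: measurable_itv.
  by apply/seteqP; split=> x /=; rewrite in_itv/= ler_norml.
have mS' : measurable [set x | `|x| <= c / 2 /\ S (0 + c^-1 * x)].
  apply: measurableI => //.
  exact: (measurable_preim (measurable_affine 0 c^-1) mS).
have mS2 : measurable (S `&` `[- 2^-1, 2^-1]) by exact: measurableI.
rewrite !torus_closedE//.
have c0' : 0 < c^-1 by rewrite invr_gt0.
have := @lebesgue_measure_affine 0 c^-1 _ c0' mS2; rewrite invrK => <-.
apply: le_measure; rewrite ?inE.
- exact: measurableI.
- exact: (measurable_preim (measurable_affine 0 c^-1) mS2).
- move=> x [/= [xc Sx] _]; split => //=; rewrite in_itv/= add0r.
  by rewrite -ler_norml normrM gtr0_norm// mulrC ler_pdivrMr// mulrC.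
Qed.
End torus_law.

(** * Balls of the torus *)

Lemma measurable_ler_cst d (T : measurableType d) (R : realType) (f : T -> R) (c : R) :
  measurable_fun setT f -> measurable [set x | f x <= c].
Proof.
move=> mf; rewrite (_ : [set _ | _] = [set x | `]-oo, c]%classic (f x)]).
  exact: (measurable_preim mf (measurable_itv _)).
by apply/seteqP; split=> x /=; rewrite in_itv.
Qed.

Lemma measurable_ger_cst d (T : measurableType d) (R : realType) (f : T -> R) (c : R) :
  measurable_fun setT f -> measurable [set x | c <= f x].
Proof.
move=> mf; rewrite (_ : [set _ | _] = [set x | `[c, +oo[%classic (f x)]).
  exact: (measurable_preim mf (measurable_itv _)).
by apply/seteqP; split=> x /=; rewrite in_itv/= andbT.
Qed.

Lemma cfrac_sqr_id (R : realType) (x : R) : `|x| <= 2^-1 -> cfrac x ^+ 2 = x ^+ 2.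
Proof.
rewrite ler_norml => /andP[h1]; rewrite le_eqVlt => /orP[/eqP ->|h2]; last first.
  by rewrite cfrac_id// h1.
rewrite (_ : 2^-1 = - 2^-1 + 1%:~R); last by rewrite /=; lra.
by rewrite cfracDz cfrac_id; [field|lra].
Qed.

Section torus_norm.
Variable R : realType.

Definition tnorm2 k (x : 'I_k -> R) : R := \sum_(i < k) cfrac (x i) ^+ 2.

Definition tdot k (x y : 'I_k -> R) : R := \sum_(i < k) cfrac (x i) * cfrac (y i).

Lemma tnorm2_le k (x y : 'I_k -> R) :
  (forall i, exists m : int, x i = y i + m%:~R) -> tnorm2 x <= \sum_(i < k) y i ^+ 2.
Proof.
move=> xy; apply: ler_sum => i _; have [m ->] := xy i.
by rewrite cfracDz; exact: cfrac_sqr_le_id.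
Qed.

Lemma eq_tnorm2 k (x y : 'I_k -> R) :
  (forall i, exists m : int, x i = y i + m%:~R) -> tnorm2 x = tnorm2 y.
Proof.
by move=> xy; apply: eq_bigr => i _; have [m ->] := xy i; rewrite cfracDz.
Qed.

Lemma measurable_tnorm2 d (T : measurableType d) k (h : 'I_k -> T -> R) :
  (forall i, measurable_fun setT (h i)) ->
  measurable_fun setT (fun x => tnorm2 (h^~ x)).
Proof.
move=> mh; apply: measurable_sum => i; apply: measurable_funX.
exact: (measurableT_comp (@measurable_cfrac R) (mh i)).
Qed.

Lemma measurable_tdot d (T : measurableType d) k (h h' : 'I_k -> T -> R) :
  (forall i, measurable_fun setT (h i)) -> (forall i, measurable_fun setT (h' i)) ->
  measurable_fun setT (fun x => tdot (h^~ x) (h'^~ x)).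
Proof.
move=> mh mh'; apply: measurable_sum => i; apply: measurable_funM.
  exact: (measurableT_comp (@measurable_cfrac R) (mh i)).
exact: (measurableT_comp (@measurable_cfrac R) (mh' i)).
Qed.

End torus_norm.

Section torus_tuple.
Variables (R : realType) (k : nat).
Local Notation mu := (iid_law (torus R) k).

Lemma torus_tuple_affine (a : 'I_k -> R) (d : nat) (A : set (k.-tuple R)) :
  (0 < d)%N -> measurable A ->
  mu [set t | A [tuple cfrac (a i + d%:R * tnth t i) | i < k]] = mu A.
Proof.
move=> d0.
have mf i : measurable_fun setT (fun x : R => cfrac (a i + d%:R * x)) :=
  measurableT_comp (@measurable_cfrac R) (measurable_affine _ _).
have mA' B : measurable B ->
    measurable [set t : k.-tuple R | B [tuple cfrac (a i + d%:R * tnth t i) | i < k]].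
  move=> mB; exact: (measurable_preim (measurable_map_tuple mf) mB).
have le B : measurable B ->
    (mu [set t | B [tuple cfrac (a i + d%:R * tnth t i) | i < k]] <= mu B)%E.
  move=> mB.
  rewrite (_ : [set t | _] = [set t : k.-tuple R | (forall i, setT (tnth t i)) /\
      B [tuple cfrac (a i + d%:R * tnth t i) | i < k]]); last first.
    by apply/seteqP; split=> t //= [].
  have -> : mu B = ((1 ^+ k)%:E * mu B)%E by rewrite expr1n mul1e.
  apply: (@iid_law_map_le _ _ _ (torus R) k
    (fun i x => cfrac (a i + d%:R * x)) setT 1 measurableT ler01 mf _ _ mB).
  move=> i C mC.
  rewrite mul1e (_ : [set x | _] = [set x | C (cfrac (a i + d%:R * x))]); last first.
    by apply/seteqP; split=> x //= [].
  by rewrite torus_affine.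
(* The inequality holds for every event; for the complement it is the reverse inequality, as both
   sides have total mass 1. *)
move=> mA; apply/eqP; rewrite eq_le le//=.
have := le _ (measurableC mA).
rewrite (_ : [set t | _] =
  ~` [set t | A [tuple cfrac (a i + d%:R * tnth t i) | i < k]])//.
rewrite !probability_setC//; last exact: mA'.
have f1 : mu A \is a fin_num by exact: fin_num_measure.
have f2 : mu [set t | A [tuple cfrac (a i + d%:R * tnth t i) | i < k]] \is a fin_num.
  by apply: fin_num_measure; exact: mA'.
by rewrite -(fineK f1) -(fineK f2) -!EFinB !lee_fin lerD2l lerN2.
Qed.

Definition tball (rho : R) : set (k.-tuple R) := [set t | tnorm2 (tnth t) <= rho].

Definition tvol (rho : R) : \bar R := mu (tball rho).

Lemma measurable_tball rho : measurable (tball rho).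
Proof.
apply: measurable_ler_cst; apply: measurable_tnorm2 => i.
exact: measurable_tnth.
Qed.

Lemma tvol_affine (a : 'I_k -> R) (d : int) rho : d != 0 ->
  mu [set t | tnorm2 (fun i => a i + d%:~R * tnth t i) <= rho] = tvol rho.
Proof.
have pos (b : 'I_k -> R) (e : nat) : (0 < e)%N ->
    mu [set t | tnorm2 (fun i => b i + e%:R * tnth t i) <= rho] = tvol rho.
  move=> e0; rewrite /tvol -(torus_tuple_affine b e0 (measurable_tball rho)).
  congr (mu _); apply/seteqP; split=> t; rewrite /tball /=;
    congr (_ <= _); apply: eq_tnorm2 => i; rewrite tnth_mktuple.
    by have [m ->] := cfracP (b i + e%:R * tnth t i); exists (- m); rewrite intrN addrK.
  exact: cfracP.
case: d => d d0; first by rewrite -pmulrn; apply: pos; rewrite lt0n.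
(* A negative multiplier is reduced to its opposite by the symmetry of the ball. *)
rewrite -(pos (fun i => - a i) d.+1)//; congr (mu _).
apply/seteqP; split=> t /=; congr (_ <= _); apply: eq_bigr => i _;
  rewrite NegzE mulrNz -pmulrn -cfracN_sqr; congr (cfrac _ ^+ 2); ring.
Qed.

Lemma tvol_translate (a : 'I_k -> R) rho :
  mu [set t | tnorm2 (fun i => tnth t i + a i) <= rho] = tvol rho.
Proof.
rewrite -(@tvol_affine a 1)//; congr (mu _).
by apply/seteqP; split=> t /=; congr (_ <= _); apply: eq_bigr => i _;
  rewrite mul1r addrC.
Qed.

Lemma le_tvol rho rho' : rho <= rho' -> (tvol rho <= tvol rho')%E.
Proof.
move=> rr; apply: le_measure; rewrite ?inE; [exact: measurable_tball..|].
by move=> t /= /le_trans; apply.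
Qed.

Lemma tvol_fin_num rho : tvol rho \is a fin_num.
Proof. by rewrite fin_num_measure//; exact: measurable_tball. Qed.

(* Almost surely all coordinates are in [-1/2, 1/2], where [cfrac] is the identity up
   to sign; this is what makes the ball a Euclidean one when [rho <= 1/4]. *)
Lemma tvol_scale (c rho : R) : 0 < c <= 1 -> rho <= 4^-1 ->
  (tvol (c ^+ 2 * rho) <= (c ^+ k)%:E * tvol rho)%E.
Proof.
move=> /[dup] c01 /andP[c0 c1] rho4.
pose I0 : set R := [set x | `|x| <= 2^-1].
have mI (r : R) : measurable [set x : R | `|x| <= r].
  by apply: measurable_ler_cst; exact: normr_measurable.
pose S := [set t : k.-tuple R | forall i, I0 (tnth t i)].
have mS : measurable S by apply: measurable_forall_tnth; exact: mI.
have S1 : mu S = 1%E.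
  rewrite (@iid_law_rect _ _ _ (torus R) k (fun=> I0))//; last by move=> _; exact: mI.
  apply: big1 => _ _; rewrite torus_closedE; last exact: mI.
  rewrite (_ : _ `&` _ = `[- 2^-1, 2^-1]%classic :> set R).
    by rewrite lebesgue_measure_itv/= lte_fin ifT -?EFinB; [congr EFin; lra|lra].
  by apply/seteqP; split=> x /=; rewrite in_itv/= -?ler_norml /I0; [move=> []|].
apply: (@le_trans _ _ (mu (S `&` tball (c ^+ 2 * rho)))).
  have mB := measurable_tball (c ^+ 2 * rho).
  apply: (@le_trans _ _ (mu ((S `&` tball (c ^+ 2 * rho)) `|` ~` S))).
    apply: le_measure; rewrite ?inE//.
      by apply: measurableU; [exact: measurableI|exact: measurableC].
    by move=> t Bt; have [St|St] := pselect (S t); [left|right].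
  apply: le_trans; first by apply: measureU2; [exact: measurableI|exact: measurableC].
  by rewrite /= [X in (_ + X)%E]probability_setC// S1 subee// adde0.
have mf (i : 'I_k) := measurable_affine 0 (c^-1 : R).
have c2 : 0 <= c / 2 by rewrite divr_ge0// ltW.
apply: le_trans (iid_law_map_le (mI (c / 2)) (ltW c0) mf _ (measurable_tball rho)).
  apply: le_measure; rewrite ?inE.
  - by apply: measurableI => //; exact: measurable_tball.
  - apply: measurableI; first by apply: measurable_forall_tnth; exact: mI.
    exact: (measurable_preim (measurable_map_tuple mf) (measurable_tball rho)).
  - move=> t [St Bt].
    have St2 : \sum_(i < k) tnth t i ^+ 2 <= c ^+ 2 * rho.
      by apply: le_trans Bt; apply: ler_sum => i _; rewrite cfrac_sqr_id//; exact: St.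
    split=> [i|].
      (* A single coordinate has square at most [c^2 rho <= c^2 / 4]: the small ball lies in the
         cube of side [c], where dividing by [c] does not wrap around. *)
      rewrite /= -(@ler_pXn2r _ 2) ?nnegrE// real_normK ?num_real//.
      apply: (@le_trans _ _ (c ^+ 2 * rho)).
        apply: le_trans St2; rewrite (bigD1 i)//= lerDl.
        by apply: sumr_ge0 => j _; exact: sqr_ge0.
      by rewrite expr_div_n ler_pM2l ?exprn_gt0//; lra.
    rewrite /tball /=; apply: (@le_trans _ _ (\sum_(i < k) (c^-1 * tnth t i) ^+ 2)).
      apply: tnorm2_le => i; exists 0; rewrite tnth_mktuple; ring.
    under eq_bigr do rewrite exprMn.
    by rewrite -mulr_sumr exprVn ler_pdivrMl ?exprn_gt0.
move=> i B mB; exact: torus_scale_le.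
Qed.

(* The part of the ball where [<t, y> >= e] lies in the ball of squared radius
   [1/4 - 4 e^2] centred at [4 e y]. *)
Lemma tvol_cap (y : 'I_k -> R) (e : R) : tnorm2 y <= 4^-1 -> 0 <= e ->
  (mu [set t | (tnorm2 (tnth t) <= 4^-1)%R /\ (e <= tdot (tnth t) y)%R] <=
   tvol (4^-1 - 4 * e ^+ 2))%E.
Proof.
move=> y1 e0; rewrite -(tvol_translate (fun i => - (4 * e * cfrac (y i)))).
apply: le_measure; rewrite ?inE.
- apply: measurableI; first exact: measurable_tball.
  apply: measurable_ger_cst; apply: measurable_tdot => i //.
  exact: measurable_tnth.
- apply: measurable_ler_cst; apply: measurable_tnorm2 => i.
  by apply: measurable_funB => //; exact: measurable_tnth.
move=> t /= [t1 ty].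
apply: (@le_trans _ _ (\sum_(i < k) (cfrac (tnth t i) - 4 * e * cfrac (y i)) ^+ 2)).
  apply: tnorm2_le => i; have [m ->] := cfracP (tnth t i).
  by exists (- m); rewrite intrN; ring.
(* For a centre [l y], the squared distance is at most [1/4 - 2 l e + l^2 / 4]; this is smallest at
   [l = 4 e], with value [1/4 - 4 e^2]. *)
rewrite (_ : \sum_(i < k) _ = tnorm2 (tnth t) - 8 * e * tdot (tnth t) y
    + 16 * e ^+ 2 * tnorm2 y); last first.
  rewrite /tnorm2 /tdot !mulr_sumr -sumrB -big_split/=.
  by apply: eq_bigr => i _; ring.
nra.
Qed.

Lemma tvol_gt0 : (0 < tvol 4^-1)%E.
Proof.
(* Half the side of a cube inside the ball: [k r <= 1/2] and [r <= 1/2] give [k r^2 <= 1/4]. The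
   successor keeps [r] meaningful for [k = 0]. *)
pose r : R := (2 * k.+1%:R)^-1.
have r0 : 0 < r by rewrite invr_gt0 mulr_gt0.
have r1 : r <= 2^-1.
  by rewrite lef_pV2 ?posrE ?mulr_gt0// ler_peMr// ler1n.
pose I0 : set R := `[- r, r]%classic.
have mI : measurable I0 by exact: measurable_itv.
apply: (@lt_le_trans _ _ (mu [set t | forall i, I0 (tnth t i)])).
  rewrite (@iid_law_rect _ _ _ (torus R) k (fun=> I0))//.
  elim/big_ind : _ => //; first by move=> x y; exact: mule_gt0.
  move=> _ _; rewrite torus_closedE//.
  rewrite (_ : _ `&` _ = `[- r, r]%classic :> set R).
    by rewrite lebesgue_measure_itv/= lte_fin ifT -?EFinB ?lte_fin; lra.
  apply/seteqP; split=> x /=; rewrite /I0 /= !in_itv/=; first by case.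
  by move=> /andP[h1 h2]; rewrite h1 h2; split=> //; apply/andP; split; lra.
apply: le_measure; rewrite ?inE; [exact: measurable_forall_tnth|exact: measurable_tball|].
move=> t /= It; rewrite /tball/=.
apply: (@le_trans _ _ (\sum_(i < k) r ^+ 2)).
  apply: ler_sum => i _; apply: le_trans (cfrac_sqr_le_id _) _.
  have := It i; rewrite /I0 /= in_itv/= => /andP[h1 h2].
  by rewrite -[leLHS]real_normK ?num_real// ler_sqr ?nnegrE// ?ler_norml ?h1 ?h2// ltW.
rewrite sumr_const card_ord -[_ *+ k]mulr_natl.
have kr : k%:R * r <= 2^-1.
  rewrite /r invfM mulrCA ler_piMr//.
  by rewrite ler_pdivrMr// mul1r ler_nat.
have k0 : 0 <= k%:R * r by rewrite mulr_ge0// ltW.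
rewrite expr2 mulrA (_ : 4^-1 = 2^-1 * 2^-1); last by field.
by apply: ler_pM => //; exact: ltW.
Qed.

End torus_tuple.

(** * The second moment method for pairwise nearly independent events *)

Section second_moment.
Context d (T : measurableType d) (R : realType) (P : probability T R).

(** Let [N] count the events and [a = M b] be its mean. Pointwise [a^2 1_Z + 2 a N <= N^2 + a^2],
    where [Z] is the event [N = 0]: there both sides are [a^2], elsewhere it is [(N - a)^2 >= 0].
    Integrating, with [E N^2 <= a + a^2], gives [a^2 P(Z) <= a]. Only nonnegative functions are
    integrated. *)
Lemma second_moment_bound (M : nat) (B : 'I_M -> set T) (b : R) :
  (0 < M)%N -> 0 < b -> (forall m, measurable (B m)) ->
  (forall m, P (B m) = b%:E) ->
  (forall m m', m != m' -> P (B m `&` B m') <= (b ^+ 2)%:E)%E ->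
  (P [set x | forall m, ~ B m x] <= ((M%:R * b)^-1)%:E)%E.
Proof.
move=> M0 b0 mB PB PBB.
set Z := [set x | _].
have mZ : measurable Z.
  rewrite (_ : Z = \bigcap_(m in [set: 'I_M]) ~` B m).
    by apply: fin_bigcap_measurable => // m _; exact: measurableC.
  by apply/seteqP; split=> x /= Zx m; [move=> _|]; exact: Zx.
pose a : R := M%:R * b.
have a0 : 0 < a by rewrite mulr_gt0// ltr0n.
pose N x : R := \sum_(m < M) \1_(B m) x.
pose L x : R := a ^+ 2 * \1_Z x + 2 * a * N x.
pose U x : R := (\sum_(m < M) \sum_(m' < M) \1_(B m `&` B m') x) + a ^+ 2.
have LU x : L x <= U x.
  rewrite /L /U; have -> : \sum_(m < M) \sum_(m' < M) \1_(B m `&` B m') x = N x ^+ 2.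
    rewrite expr2 /N mulr_suml; apply: eq_bigr => m _.
    by rewrite mulr_sumr; apply: eq_bigr => m' _; rewrite indicI.
  rewrite [\1_Z x]indicE; have [xZ|xZ] := boolP (x \in Z).
    rewrite inE in xZ.
    have -> : N x = 0.
      apply: big1 => m _; rewrite indicE memNset//.
    by rewrite !mulr0 addr0 mulr1 expr0n/= add0r.
  by rewrite mulr0 add0r -subr_ge0 (_ : _ - _ = (N x - a) ^+ 2) ?sqr_ge0//; ring.
have N0 x : 0 <= N x by apply: sumr_ge0.
have a20 : 0 <= 2 * a by rewrite mulr_ge0// ltW.
have mN : measurable_fun setT N.
  by apply: measurable_sum => m; exact: measurable_indic.
have mL : measurable_fun setT L.
  apply: measurable_funD; apply: measurable_funM => //; exact: measurable_indic.
have mU : measurable_fun setT U.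
  apply: measurable_funD => //; apply: measurable_sum => m; apply: measurable_sum => m'.
  by apply: measurable_indic; exact: measurableI.
have intLU : (\int[P]_x (L x)%:E <= \int[P]_x (U x)%:E)%E.
  apply: ge0_le_integral => //.
  - by move=> x _; rewrite lee_fin addr_ge0// mulr_ge0// sqr_ge0.
  - exact/measurable_EFinP.
  - exact/measurable_EFinP.
  - by move=> x _; rewrite lee_fin.
have indI A : measurable A -> (\int[P]_x (\1_A x)%:E = P A)%E.
  by move=> mA; rewrite integral_indic// setIT.
have intL : (\int[P]_x (L x)%:E = (a ^+ 2)%:E * P Z + (2 * a ^+ 2)%:E)%E.
  under eq_integral do rewrite EFinD (EFinM (a ^+ 2)) (EFinM (2 * a)).
  have m1 A : measurable A -> measurable_fun setT (EFin \o (\1_A : T -> R)).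
    by move=> mA; apply/measurable_EFinP; exact: measurable_indic.
  rewrite ge0_integralD//=; first last.
  - by apply: measurable_funeM; exact/measurable_EFinP.
  - by move=> x _; rewrite -EFinM lee_fin mulr_ge0.
  - by apply: measurable_funeM; exact: m1.
  - by move=> x _; rewrite -EFinM lee_fin mulr_ge0 ?sqr_ge0.
  rewrite ge0_integralZl//; [|exact: m1|by rewrite lee_fin sqr_ge0].
  rewrite indI//; congr (_ + _)%E.
  rewrite ge0_integralZl//; [|exact/measurable_EFinP|by move=> x _; rewrite lee_fin].
  under eq_integral do rewrite /N -sumEFin.
  rewrite ge0_integral_sum//=; last by move=> m; exact: m1.
  under eq_bigr do rewrite indI// PB.
  rewrite sumEFin sumr_const card_ord -[_ *+ M]mulr_natl -EFinM -/a.
  by congr EFin; ring.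
have intU : (\int[P]_x (U x)%:E <=
    (M%:R * b + M%:R * (M%:R - 1) * b ^+ 2 + a ^+ 2)%:E)%E.
  under eq_integral do rewrite EFinD.
  have mm m m' : measurable_fun setT (EFin \o (\1_(B m `&` B m') : T -> R)).
    by apply/measurable_EFinP; apply: measurable_indic; exact: measurableI.
  rewrite ge0_integralD//=; first last.
  - by move=> x _; rewrite lee_fin sqr_ge0.
  - apply/measurable_EFinP; apply: measurable_sum => m; apply: measurable_sum => m'.
    by apply: measurable_indic; exact: measurableI.
  - by move=> x _; rewrite lee_fin; apply: sumr_ge0 => m _; exact: sumr_ge0.
  rewrite integral_cst// [X in (_ + _ * X)%E]probability_setT mule1 EFinD leeD2r//.
  under eq_integral do rewrite -sumEFin.
  rewrite ge0_integral_sum//=; first last.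
  - by move=> m x _; rewrite lee_fin; exact: sumr_ge0.
  - by move=> m; apply/measurable_EFinP; apply: measurable_sum => m';
      apply: measurable_indic; exact: measurableI.
  rewrite (_ : M%:R * b + _ = \sum_(m < M) (b + (M%:R - 1) * b ^+ 2)); last first.
    by rewrite sumr_const card_ord -[_ *+ M]mulr_natl; ring.
  rewrite -sumEFin; apply: lee_sum => m _.
  under eq_integral do rewrite -sumEFin.
  rewrite ge0_integral_sum//=; last by move=> m'; exact: mm.
  rewrite (bigD1 m)//= setIid indI ?PB// EFinD leeD2l//.
  rewrite (_ : (M%:R - 1) * b ^+ 2 = \sum_(m' < M | m' != m) b ^+ 2); last first.
    rewrite sumr_const -[_ *+ #|_|]mulr_natl; congr (_ * _).
    by rewrite cardC1 card_ord -subn1 natrB.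
  rewrite -sumEFin; apply: lee_sum => m' m'm.
  by rewrite indI ?PBB 1?eq_sym//; exact: measurableI.
have {intU}intLU := le_trans intLU intU.
rewrite intL in intLU.
have fZ : P Z \is a fin_num by exact: fin_num_measure.
rewrite -(fineK fZ) -EFinM -EFinD lee_fin in intLU.
rewrite -(fineK fZ) lee_fin -[_^-1]mul1r ler_pdivlMr//.
rewrite -(ler_pM2r a0).
have : a = M%:R * b by [].
have : 0 <= M%:R * b ^+ 2 by rewrite mulr_ge0 ?sqr_ge0.
nra.
Qed.
End second_moment.

(** * A covering arithmetic progression *)

Section covering.
Variables (R : realType) (k : nat).
Local Notation mu := (iid_law (torus R) k).
Local Notation tvol := (@tvol R k).

Definition shifted (m : nat) (g t : k.-tuple R) (i : 'I_k) : R :=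
  tnth t i - m%:R * tnth g i.

Let BM (m : nat) := [set q : k.-tuple R * k.-tuple R |
  tnorm2 (shifted m q.1 q.2) <= 4^-1].

Let measurable_BM m : measurable (BM m).
Proof.
apply: measurable_ler_cst; apply: measurable_tnorm2 => i.
apply: measurable_funB; last apply: measurable_funM => //.
  exact: (measurableT_comp (measurable_tnth i) measurable_snd).
exact: (measurableT_comp (measurable_tnth i) measurable_fst).
Qed.

Let prob_BM m : ((mu \x mu) (BM m) = tvol 4^-1)%E.
Proof.
rewrite product_probE (eq_integral (fun=> tvol 4^-1)); last first.
  move=> g _; rewrite -(tvol_translate (fun i => - (m%:R * tnth g i))).
  by congr (mu _).
by rewrite integral_cst// [X in (_ * X)%E]probability_setT mule1.
Qed.

(** Translating [t] by [m g] turns the events into [t] and [t + (m - m') g] both in the ball. For a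
    fixed [t] the second point is uniform, since [m - m'] is a nonzero integer. *)
Let prob_BMI m m' : m != m' ->
  ((mu \x mu) (BM m `&` BM m') <= tvol 4^-1 * tvol 4^-1)%E.
Proof.
move=> mm'.
pose C := [set q : k.-tuple R * k.-tuple R | tnorm2 (tnth q.2) <= 4^-1 /\
  tnorm2 (fun i => tnth q.2 i + (m%:Z - m'%:Z)%:~R * tnth q.1 i) <= 4^-1].
have mC : measurable C.
  apply: measurableI; apply: measurable_ler_cst; apply: measurable_tnorm2 => i.
    exact: (measurableT_comp (measurable_tnth i) measurable_snd).
  apply: measurable_funD; last apply: measurable_funM => //.
    exact: (measurableT_comp (measurable_tnth i) measurable_snd).
  exact: (measurableT_comp (measurable_tnth i) measurable_fst).
have -> : (mu \x mu)%E (BM m `&` BM m') = (mu \x mu)%E C.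
  rewrite !product_probE; apply: eq_integral => g _.
  have := @torus_tuple_affine R k (fun i => - (m%:R * tnth g i)) 1 _
    (ltn0Sn 0) (measurable_section_l g mC).
  move=> <-; congr (mu _); apply/seteqP; split=> t /=; rewrite /C /BM /=.
    move=> [h1 h2]; split.
      rewrite (_ : tnorm2 _ = tnorm2 (shifted m g t))//.
      apply: eq_tnorm2 => i; rewrite tnth_mktuple mul1r addrC; exact: cfracP.
    rewrite (_ : tnorm2 _ = tnorm2 (shifted m' g t))//.
    apply: eq_tnorm2 => i; rewrite tnth_mktuple mul1r.
    have [z ->] := cfracP (- (m%:R * tnth g i) + tnth t i).
    by exists z; rewrite /shifted intrD intrN -!pmulrn; ring.
  move=> [h1 h2]; split.
    rewrite (_ : tnorm2 _ = tnorm2 (shifted m g t)) in h1 => //.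
    apply: eq_tnorm2 => i; rewrite tnth_mktuple mul1r addrC; exact: cfracP.
  rewrite (_ : tnorm2 _ = tnorm2 (shifted m' g t)) in h2 => //.
  apply: eq_tnorm2 => i; rewrite tnth_mktuple mul1r.
  have [z ->] := cfracP (- (m%:R * tnth g i) + tnth t i).
  by exists z; rewrite /shifted intrD intrN -!pmulrn; ring.
apply: (@product_prob_le_r _ _ _ _ _ mu mu C (@tball R k 4^-1) (tvol 4^-1)) => //.
- exact: measurable_tball.
- by move=> g t [].
move=> t _; rewrite -(@tvol_affine R k (tnth t) (m%:Z - m'%:Z)).
  apply: le_measure; rewrite ?inE; last by move=> g [].
    exact: (measurable_section_r t mC).
  apply: measurable_ler_cst; apply: measurable_tnorm2 => i.
  apply: measurable_funD => //; apply: measurable_funM => //.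
  exact: measurable_tnth.
by rewrite subr_eq0 eqz_nat.
Qed.

Lemma covering (M : nat) : (0 < M)%N -> exists g : k.-tuple R,
  (mu [set t | forall m : 'I_M, (~ tnorm2 (shifted m g t) <= 4^-1)%R] <=
   (2 / (M%:R * fine (tvol 4^-1)))%:E)%E.
Proof.
move=> M0; have := tvol_gt0 R k; rewrite -(fineK (tvol_fin_num k 4^-1)).
set b := fine _ => b0.
have tb : tvol 4^-1 = b%:E by rewrite /b fineK// tvol_fin_num.
have key : ((mu \x mu) [set q | forall m : 'I_M, ~ BM m q] <=
    ((M%:R * b)^-1)%:E)%E.
  apply: second_moment_bound => //; first by move=> m; exact: (etrans (prob_BM m) tb).
  move=> m m' mm'; apply: le_trans (prob_BMI mm') _.
  by rewrite tb -EFinM expr2.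
apply: contrapT => /forallNP H.
have a0 : 0 < M%:R * b by rewrite mulr_gt0// ltr0n.
move: key; apply/negP; rewrite -ltNge.
(* If every [g] exceeded [2 / (M b)], so would the average, which is at most [1 / (M b)]; the factor
   2 makes the contradiction strict. *)
apply: (@lt_le_trans _ _ (2 / (M%:R * b))%:E).
  by rewrite lte_fin ltr_pMl ?invr_gt0// ltr1n.
rewrite product_probE.
have -> : (2 / (M%:R * b))%:E = (\int[mu]_g (2 / (M%:R * b))%:E)%E.
  by rewrite integral_cst// [X in (_ * X)%E]probability_setT mule1.
apply: ge0_le_integral => //.
- by move=> g _; rewrite lee_fin divr_ge0// ltW.
- apply: measurable_fun_prob_section_l.
  rewrite (_ : [set _ | _] = \bigcap_(m in [set: 'I_M]) ~` BM m).
    by apply: fin_bigcap_measurable => // m _; exact: measurableC.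
  by apply/seteqP; split=> x /= Zx m; [move=> _|]; exact: Zx.
- by move=> g _; apply/ltW; rewrite ltNge; apply/negP; exact: H.
Qed.

End covering.

(** * Sums of independent samples *)

Section markov_bound.
Context d (T : measurableType d) (R : realType) (P : probability T R).

Lemma prob_ge_le_integral (F : T -> R) (c w : R) : 0 < c ->
  measurable_fun setT F -> (forall x, 0 <= F x) ->
  (\int[P]_x (F x)%:E <= w%:E)%E -> (P [set x | (c <= F x)%R] <= (w / c)%:E)%E.
Proof.
move=> c0 mF F0 Fw.
have mA := measurable_ger_cst c mF.
rewrite EFinM muleC -lee_pdivrMl ?invr_gt0// invrK; apply: le_trans Fw.
rewrite -[X in (_ * P X)%E]setIT -integral_indic// -ge0_integralZl//.
- apply: ge0_le_integral => //.
  + by move=> x _; rewrite -EFinM lee_fin mulr_ge0// ltW.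
  + by apply: measurable_funeM; apply/measurable_EFinP; exact: measurable_indic.
  + exact/measurable_EFinP.
  + move=> x _; rewrite -EFinM lee_fin indicE.
    by have [|_] := boolP (x \in _); rewrite ?mulr1 ?mulr0// inE.
- by apply/measurable_EFinP; exact: measurable_indic.
- by rewrite lee_fin ltW.
Qed.

End markov_bound.

Section iid_sums.
Context d (T : measurableType d) (R : realType) (Q : probability T R).

(** The code uses only the first [k] of the [n] channel uses, whereas its estimates are proved for
    blocks of length [k]. *)
Definition tprefix k n (le_kn : (k <= n)%N) (t : n.-tuple T) : k.-tuple T :=
  [tuple tnth t (widen_ord le_kn i) | i < k].

Lemma iid_law_prefix k n (le_kn : (k <= n)%N) (A : set (k.-tuple T)) :
  measurable A -> iid_law Q n [set t | A (tprefix le_kn t)] = iid_law Q k A.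
Proof.
elim: k n le_kn A => [|k IH] [|n] le_kn A mA //.
- congr (iid_law Q 0 _); apply/seteqP; split=> t;
  by rewrite /= (_ : tprefix le_kn t = t)//; apply: eq_from_tnth => -[].
- have [At|At] := pselect (A [tuple]).
    rewrite [X in iid_law _ _ X = _](_ : _ = setT) ?[X in _ = iid_law _ _ X](_ : _ = setT) ?probability_setT//.
      by apply/seteqP; split=> // t _; rewrite (_ : t = [tuple])//; apply: eq_from_tnth => -[].
    apply/seteqP; split=> // t _ /=; rewrite (_ : tprefix le_kn t = [tuple])//.
    by apply: eq_from_tnth => -[].
  rewrite [X in iid_law _ _ X = _](_ : _ = set0) ?[X in _ = iid_law _ _ X](_ : _ = set0) ?measure0//.
    apply/seteqP; split=> // t; rewrite (_ : t = [tuple])//.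
    by apply: eq_from_tnth => -[].
  apply/seteqP; split=> // t /=; rewrite (_ : tprefix le_kn t = [tuple])//.
  by apply: eq_from_tnth => -[].
have le_kn' : (k <= n)%N by [].
rewrite !iid_lawSE !product_probE; apply: eq_integral => x _.
rewrite -(IH n le_kn'); last exact: (measurable_section_l x (measurable_preim_tcons mA)).
congr (iid_law Q n _); apply/seteqP; split=> t /=.
all: rewrite (_ : tprefix le_kn (tcons (x, t)) = tcons (x, tprefix le_kn' t))//.
all: apply: eq_from_tnth => i; rewrite tnth_mktuple.
all: case: (unliftP ord0 i) => [j ->|->].
all: try by rewrite (_ : widen_ord _ _ = ord0)//; exact: val_inj.
all: rewrite (_ : widen_ord _ _ = lift ord0 (widen_ord le_kn' j)); [|exact: val_inj].
all: by rewrite /tcons !tnthS tnth_mktuple.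
Qed.

Section centered.
Variables (g : T -> R) (w : R).
Hypotheses (mg : measurable_fun setT g) (w0 : 0 <= w).
Hypothesis g_mean : (\int[Q]_x (g x)%:E = 0)%E.
Hypothesis g_var : (\int[Q]_x (g x ^+ 2)%:E <= w%:E)%E.

Let int_g2 : Q.-integrable setT (EFin \o (fun x => g x ^+ 2)).
Proof.
apply/integrableP; split.
  by apply/measurable_EFinP; exact: measurable_funX.
under eq_integral do rewrite /= ger0_norm ?sqr_ge0//.
exact: le_lt_trans g_var (ltry _).
Qed.

Let int_g : Q.-integrable setT (EFin \o g).
Proof.
have := integrableD measurableT int_g2 (finite_measure_integrable_cst Q 1 measurableT).
apply: le_integrable => //; first exact/measurable_EFinP.
move=> x _ /=; rewrite lee_fin [leRHS]ger0_norm ?addr_ge0 ?sqr_ge0//.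
have := sqr_ge0 (`|g x| - 1); rewrite -[g x ^+ 2]real_normK ?num_real//.
have := normr_ge0 (g x); nra.
Qed.

Lemma integral_affine_sqr (a s : R) :
  (\int[Q]_x ((a * g x + s) ^+ 2)%:E <= (a ^+ 2 * w + s ^+ 2)%:E)%E.
Proof.
under eq_integral.
  move=> x _; rewrite (_ : (a * g x + s) ^+ 2 = a ^+ 2 * g x ^+ 2 +
    2 * a * s * g x + s ^+ 2); last by ring.
  rewrite !EFinD (EFinM (a ^+ 2)) (EFinM (2 * a * s)); over.
have int1 := integrableZl measurableT (a ^+ 2) int_g2.
have int2 := integrableZl measurableT (2 * a * s) int_g.
rewrite integralD//=; [|exact: integrableD|exact: finite_measure_integrable_cst].
rewrite integralD//= !integralZl//= g_mean mule0 adde0 EFinD.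
rewrite integral_cst// [X in (_ + _ * X)%E]probability_setT mule1 leeD2r//.
by rewrite (EFinM (a ^+ 2) w); apply: lee_wpmul2l => //; rewrite lee_fin sqr_ge0.
Qed.

Let measurable_wsum n (a : 'I_n -> R) :
  measurable_fun setT (fun t : n.-tuple T => \sum_(i < n) a i * g (tnth t i)).
Proof.
apply: measurable_sum => i; apply: measurable_funM => //.
exact: (measurableT_comp mg (measurable_tnth i)).
Qed.

(** Orthogonality, one coordinate at a time: for a fixed tail sum, the cross term with the head has
    mean zero. *)
Lemma iid_sqr_sum n (a : 'I_n -> R) :
  (\int[iid_law Q n]_t ((\sum_(i < n) a i * g (tnth t i)) ^+ 2)%:E <=
   (w * \sum_(i < n) a i ^+ 2)%:E)%E.
Proof.
elim: n a => [|n IH] a.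
  under eq_integral do rewrite big_ord0 expr0n/=.
  by rewrite integral0 lee_fin mulr_ge0// sumr_ge0// => i _; exact: sqr_ge0.
rewrite ge0_integral_iid_lawS; last 2 first.
- by apply/measurable_EFinP; apply: measurable_funX; exact: measurable_wsum.
- by move=> t; rewrite lee_fin sqr_ge0.
pose a' i := a (lift ord0 i).
pose S (t : n.-tuple T) := \sum_(i < n) a' i * g (tnth t i).
have mS2 : measurable_fun setT (fun t => S t ^+ 2).
  by apply: measurable_funX; exact: measurable_wsum.
apply: (@le_trans _ _ (\int[iid_law Q n]_t (a ord0 ^+ 2 * w + S t ^+ 2)%:E)%E).
  apply: ge0_le_integral => //.
  - by move=> t _; apply: integral_ge0 => x _; rewrite lee_fin sqr_ge0.
  - apply: (@measurable_fun_fubini_tonelli_G _ _ _ _ _ Q (fun q => ((\sum_(i < n.+1)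
      a i * g (tnth (tcons q) i)) ^+ 2)%:E)); last first.
      by move=> q; rewrite lee_fin sqr_ge0.
    apply: (measurableT_comp (f := fun t : n.+1.-tuple T =>
      ((\sum_(i < n.+1) a i * g (tnth t i)) ^+ 2)%:E)); last exact: measurable_tcons.
    by apply/measurable_EFinP; apply: measurable_funX; exact: measurable_wsum.
  - by apply/measurable_EFinP; exact: measurable_funD.
  - move=> t _; apply: le_trans (integral_affine_sqr (a ord0) (S t)).
    rewrite le_eqVlt; apply/orP; left; apply/eqP; apply: eq_integral => x _.
    rewrite big_ord_recl; congr ((_ + _) ^+ 2)%:E.
    by apply: eq_bigr => i _; rewrite /tcons tnthS.
under eq_integral do rewrite EFinD.
rewrite ge0_integralD//; last 3 first.
- by move=> t _; rewrite lee_fin mulr_ge0 ?sqr_ge0.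
- by move=> t _; rewrite lee_fin sqr_ge0.
- by apply/measurable_EFinP; first [exact: mS|done].
rewrite integral_cst// [X in (_ * X + _)%E]probability_setT mule1.
rewrite big_ord_recl mulrDr EFinD mulrC leeD2l//.
exact: IH.
Qed.

Lemma chebyshev_iid n (a : 'I_n -> R) (c : R) : 0 < c ->
  (iid_law Q n [set t | (c <= \sum_(i < n) a i * g (tnth t i))%R] <=
   (w * (\sum_(i < n) a i ^+ 2) / c ^+ 2)%:E)%E.
Proof.
move=> c0; have c20 : 0 < c ^+ 2 by rewrite exprn_gt0.
have mS := measurable_wsum a.
apply: (@le_trans _ _ (iid_law Q n
    [set t | (c ^+ 2 <= (\sum_(i < n) a i * g (tnth t i)) ^+ 2)%R])); last first.
  apply: prob_ge_le_integral => //; [exact: measurable_funX| |exact: iid_sqr_sum].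
  by move=> t; exact: sqr_ge0.
apply: le_measure; rewrite ?inE; [exact: measurable_ger_cst| |].
  by apply: measurable_ger_cst; exact: measurable_funX.
by move=> t /= h; rewrite ler_sqr ?nnegrE ?(ltW c0)//; apply: le_trans h; exact: ltW.
Qed.

End centered.

Lemma iid_sum (h : T -> R) (w : R) n : measurable_fun setT h ->
  (forall x, 0 <= h x) -> (\int[Q]_x (h x)%:E <= w%:E)%E ->
  (\int[iid_law Q n]_t (\sum_(i < n) h (tnth t i))%:E <= (n%:R * w)%:E)%E.
Proof.
move=> mh h0 hw; elim: n => [|n IH].
  by under eq_integral do rewrite big_ord0; rewrite integral0 mul0r.
have mS n' : measurable_fun setT (fun t : n'.-tuple T => \sum_(i < n') h (tnth t i)).
  apply: measurable_sum => i; exact: (measurableT_comp mh (measurable_tnth i)).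
have S0 n' (t : n'.-tuple T) : 0 <= \sum_(i < n') h (tnth t i) by apply: sumr_ge0.
rewrite ge0_integral_iid_lawS; [|by apply/measurable_EFinP; exact: mS|by move=> t; rewrite lee_fin].
rewrite (eq_integral (fun t : n.-tuple T => ((\int[Q]_x (h x)%:E) +
    (\sum_(i < n) h (tnth t i))%:E)%E)); last first.
  move=> t _; under eq_integral.
    move=> x _; rewrite big_ord_recl EFinD (_ : tnth (tcons (x, t)) ord0 = x)//.
    rewrite (eq_bigr (fun i => h (tnth t i))); last by move=> i _; rewrite /tcons tnthS.
    over.
  rewrite ge0_integralD//=; last 3 first.
  - by move=> x _; rewrite lee_fin.
  - exact/measurable_EFinP.
  - by move=> x _; rewrite lee_fin; apply: sumr_ge0.
  by rewrite integral_cst// [X in (_ + _ * X)%E]probability_setT mule1.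
rewrite ge0_integralD//; last 3 first.
- by move=> t _; apply: integral_ge0 => x _; rewrite lee_fin.
- by move=> t _; rewrite lee_fin.
- by apply/measurable_EFinP; first [exact: mS|done].
rewrite integral_cst// [X in (_ * X + _)%E]probability_setT mule1.
by rewrite -natr1 mulrDl mul1r EFinD addeC leeD.
Qed.

End iid_sums.

(** * Concentration of the energy of a shifted noise *)

Section noise.
Context d (T : measurableType d) (R : realType) (Q : probability T R).
Variables (f : T -> R) (v : R).
Hypotheses (mf : measurable_fun setT f) (v0 : 0 <= v).
Hypothesis f_mean : (\int[Q]_x (f x)%:E = 0)%E.
Hypothesis f_var : (\int[Q]_x (f x ^+ 2)%:E <= v%:E)%E.

Let h x := f x ^+ 2.
Let hc (m : nat) x := Num.min (h x) m%:R.

Let mh : measurable_fun setT h. Proof. exact: measurable_funX. Qed.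
Let mhc m : measurable_fun setT (hc m). Proof. exact: measurable_minr. Qed.
Let h0 x : 0 <= h x. Proof. exact: sqr_ge0. Qed.
Let hc0 m x : 0 <= hc m x. Proof. by rewrite le_min h0 ler0n. Qed.
Let hch m x : hc m x <= h x. Proof. by rewrite ge_min lexx. Qed.

Let int_h_fin : (\int[Q]_x (h x)%:E)%E \is a fin_num.
Proof.
rewrite ge0_fin_numE; first exact: le_lt_trans f_var (ltry _).
by apply: integral_ge0 => x _; rewrite lee_fin.
Qed.

(* Only second moments of [f] are available, so [f ^+ 2] is truncated before applying
   Chebyshev's inequality. *)
Let truncation (tau : R) : 0 < tau ->
  exists m, (\int[Q]_x (h x - hc m x)%:E <= tau%:E)%E.
Proof.
move=> tau0.
have cv := @cvg_monotone_convergence _ _ _ Q setT measurableT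
  (fun m x => (hc m x)%:E) _ _ _.
have limE x : limn (fun m => (hc m x)%:E) = (h x)%:E.
  apply/cvg_lim => //; apply: cvg_near_cst; near=> m.
  congr EFin; apply/min_idPl.
  near: m; exact: nbhs_infty_ger.
have {cv} : (\int[Q]_x (hc m x)%:E @[m --> \oo] --> \int[Q]_x (h x)%:E)%E.
  under [X in _ --> X]eq_integral do rewrite -limE.
  apply: cv.
  - by move=> m; apply/measurable_EFinP; exact: mhc.
  - by move=> m x _; rewrite lee_fin.
  - move=> x _ m m' mm'; rewrite lee_fin le_min /hc ge_min lexx/=.
    by rewrite ge_min ler_nat mm' orbT.
rewrite -(fineK int_h_fin) => /fine_cvgP[] + /cvgrPdist_lt/(_ _ tau0).
move=> [m1 _ H1] [m2 _ H2]; pose m := maxn m1 m2.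
have {}H1 := H1 m (leq_maxl _ _); have {}H2 := H2 m (leq_maxr _ _).
exists m; have : (\int[Q]_x (h x)%:E =
    \int[Q]_x (h x - hc m x)%:E + \int[Q]_x (hc m x)%:E)%E.
  rewrite -ge0_integralD//=.
  - by apply: eq_integral => x _; rewrite -EFinD subrK.
  - by move=> x _; rewrite lee_fin subr_ge0.
  - by apply/measurable_EFinP; exact: measurable_funB.
  - by move=> x _; rewrite lee_fin.
  - by apply/measurable_EFinP; exact: mhc.
move: H2; rewrite /= => H2 E.
have rfin : (\int[Q]_x (h x - hc m x)%:E)%E \is a fin_num.
  move: int_h_fin; rewrite E fin_numD => /andP[].
  by [].
move: E; rewrite -(fineK rfin) -(fineK H1) -(fineK int_h_fin) -EFinD => -[E].
rewrite lee_fin; move: H2; rewrite E addrK => /ltW.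
by apply: le_trans; exact: ler_norm.
Unshelve. all: by end_near.
Qed.

(** [f ^+ 2] is the sum of its truncated mean, at most [v], a bounded centred part handled by
    Chebyshev's inequality, and a nonnegative remainder of small mean handled by Markov's
    inequality. *)
Lemma weak_lln (e delta : R) : 0 < e -> 0 < delta ->
  exists K : R, forall k, K <= k%:R ->
  (iid_law Q k [set t | (k%:R * (v + e) <= \sum_(i < k) f (tnth t i) ^+ 2)%R] <=
   delta%:E)%E.
Proof.
move=> e0 delta0.
(* Markov's inequality at level [k e / 2] turns a mean [k delta e / 4] into probability
   [delta / 2]. *)
have tau0 : 0 < delta * e / 4 by rewrite !mulr_gt0.
have [m Hm] := truncation tau0.
pose em := fine (\int[Q]_x (hc m x)%:E)%E.
have emv : (\int[Q]_x (hc m x)%:E <= v%:E)%E.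
  apply: le_trans f_var; apply: ge0_le_integral => //.
  - by move=> x _; rewrite lee_fin.
  - by apply/measurable_EFinP; exact: mhc.
  - exact/measurable_EFinP.
  - by move=> x _; rewrite lee_fin.
have emE : (\int[Q]_x (hc m x)%:E)%E = em%:E.
  rewrite fineK// ge0_fin_numE ?(le_lt_trans emv) ?ltry//.
  by apply: integral_ge0 => x _; rewrite lee_fin.
have em0 : 0 <= em.
  by rewrite -lee_fin -emE; apply: integral_ge0 => x _; rewrite lee_fin.
have {}emv : em <= v by rewrite -lee_fin -emE.
have emm : em <= m%:R.
  rewrite -lee_fin -emE; apply: (@le_trans _ _ (\int[Q]_x (m%:R)%:E)%E).
    apply: ge0_le_integral => //.
    - by move=> x _; rewrite lee_fin.
    - by apply/measurable_EFinP; exact: mhc.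
    - by move=> x _; rewrite lee_fin /hc ge_min lexx orbT.
  by rewrite integral_cst// [X in (_ * X)%E]probability_setT mule1.
pose g x := hc m x - em.
have mg : measurable_fun setT g by exact: measurable_funB.
have g2 x : g x ^+ 2 <= m%:R ^+ 2.
  have h1 : hc m x <= m%:R by rewrite /hc ge_min lexx orbT.
  have := hc0 m x; rewrite /g => h2.
  rewrite -[leLHS]real_normK ?num_real// ler_sqr ?nnegrE ?ler0n//.
  by rewrite ler_norml; apply/andP; split; lra.
have int_hc : Q.-integrable setT (EFin \o hc m).
  apply/integrableP; split; first by apply/measurable_EFinP; exact: mhc.
  under eq_integral do rewrite /= ger0_norm//.
  by rewrite emE ltry.
have gmean : (\int[Q]_x (g x)%:E = 0)%E.
  under eq_integral do rewrite EFinB.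
  rewrite integralB//; last exact: finite_measure_integrable_cst.
  by rewrite emE integral_cst// [X in (_ - _ * X)%E]probability_setT mule1 subee.
have gvar : (\int[Q]_x (g x ^+ 2)%:E <= (m%:R ^+ 2)%:E)%E.
  apply: (@le_trans _ _ (\int[Q]_x (m%:R ^+ 2)%:E)%E).
    apply: ge0_le_integral => //.
    - by move=> x _; rewrite lee_fin sqr_ge0.
    - by apply/measurable_EFinP; exact: measurable_funX.
    - by move=> x _; rewrite lee_fin.
  by rewrite integral_cst// [X in (_ * X)%E]probability_setT mule1.
(* Chebyshev's bound [m^2 k / (k e / 2)^2] is at most [delta / 2] when [k >= 8 m^2 / (e^2 delta)];
   the added 1 forces [k > 0]. *)
exists (1 + 8 * m%:R ^+ 2 / (e ^+ 2 * delta)) => k kK.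
have k0 : 0 < k%:R :> R.
  apply: lt_le_trans kK; rewrite ltr_pwDl// mulr_ge0 ?mulr_ge0 ?sqr_ge0//.
  by rewrite invr_ge0 mulr_ge0 ?sqr_ge0// ltW.
have c0 : 0 < k%:R * (e / 2) by rewrite !mulr_gt0.
have cheb := chebyshev_iid mg (sqr_ge0 _) gmean gvar (fun=> 1) c0 (n := k).
pose r x := h x - hc m x.
have mr : measurable_fun setT r by exact: measurable_funB.
have r0 x : 0 <= r x by rewrite subr_ge0.
have mS (u : T -> R) : measurable_fun setT u ->
    measurable_fun setT (fun t : k.-tuple T => \sum_(i < k) u (tnth t i)).
  move=> mu; apply: measurable_sum => i.
  exact: (measurableT_comp mu (measurable_tnth i)).
have mark := prob_ge_le_integral c0 (mS r mr) _ (iid_sum k mr r0 Hm).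
apply: (@le_trans _ _ (iid_law Q k ([set t | k%:R * (e / 2) <= \sum_(i < k) 1 * g (tnth t i)]
   `|` [set t | k%:R * (e / 2) <= \sum_(i < k) r (tnth t i)]))).
  apply: le_measure; rewrite ?inE.
  - by apply: measurable_ger_cst; exact: (mS h).
  - apply: measurableU; apply: measurable_ger_cst; last exact: mS.
    by apply: (mS (fun x => 1 * g x)); exact: measurable_funM.
  - move=> t /= H; have [H1|H1] := leP (k%:R * (e / 2)) (\sum_(i < k) 1 * g (tnth t i)).
      by left.
    right; rewrite leNgt; apply/negP => H2.
    move: H; apply/negP; rewrite -ltNge.
    have -> : \sum_(i < k) f (tnth t i) ^+ 2 =
      \sum_(i < k) 1 * g (tnth t i) + \sum_(i < k) r (tnth t i) + k%:R * em.
      rewrite -big_split/= (_ : k%:R * em = \sum_(i < k) em) -?big_split/=; last first.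
        by rewrite sumr_const card_ord mulr_natl.
      by apply: eq_bigr => i _; rewrite /g /r /h; ring.
    have : k%:R * em <= k%:R * v by rewrite ler_pM2l.
    by nra.
apply: le_trans.
  apply: measureU2.
    apply: measurable_ger_cst.
    by apply: (mS (fun x => 1 * g x)); exact: measurable_funM.
  by apply: measurable_ger_cst; exact: mS.
apply: le_trans (leeD cheb (mark _)) _ => [t|]; first by apply: sumr_ge0.
rewrite -EFinD lee_fin.
have -> : \sum_(i < k) 1 ^+ 2 = k%:R :> R.
  by under eq_bigr do rewrite expr1n; rewrite sumr_const card_ord.
have -> : k%:R * (delta * e / 4) / (k%:R * (e / 2)) = delta / 2.
  by field; rewrite !gt_eqF.
have -> : m%:R ^+ 2 * k%:R / (k%:R * (e / 2)) ^+ 2 = (4 * m%:R ^+ 2 / e ^+ 2) / k%:R.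
  by field; rewrite !gt_eqF.
suff : 4 * m%:R ^+ 2 / e ^+ 2 / k%:R <= delta / 2 by lra.
rewrite ler_pdivrMr//; have : 8 * m%:R ^+ 2 / (e ^+ 2 * delta) <= k%:R by lra.
rewrite ler_pdivrMr ?mulr_gt0 ?exprn_gt0// => H.
rewrite ler_pdivrMr ?exprn_gt0//; nra.
Qed.

(** The square is expanded: the cross term has variance at most [v k C], the noise energy obeys the
    weak law. That [K] does not depend on [a] is essential, for [a] will be a random vector that is
    conditioned upon. *)
Lemma noise_energy (C e delta : R) : 0 < e -> 0 < delta ->
  exists K : R, forall k, K <= k%:R -> forall a : 'I_k -> R,
  \sum_(i < k) a i ^+ 2 <= k%:R * C ->
  (iid_law Q k [set t | (\sum_(i < k) a i ^+ 2 + k%:R * (v + e) <=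
      \sum_(i < k) (a i + f (tnth t i)) ^+ 2)%R] <= delta%:E)%E.
Proof.
move=> e0 delta0.
have e20 : 0 < e / 2 by rewrite divr_gt0.
have delta20 : 0 < delta / 2 by rewrite divr_gt0.
have [K HK] := weak_lln e20 delta20.
(* From [v k C / (k e / 4)^2 <= delta / 2]. Twice the threshold [k e / 4] of the cross term and the
   [k e / 2] of the weak law add up to [k e]. The absolute value allows any sign of [C]. *)
pose D : R := `|32 * v * C / (e ^+ 2 * delta)|.
exists (Num.max K (1 + D)) => k; rewrite ge_max => /andP[kK kD] a aC.
have k0 : 0 < k%:R :> R.
  by apply: lt_le_trans kD; rewrite ltr_pwDl ?normr_ge0.
have c0 : 0 < k%:R * (e / 4) by rewrite !mulr_gt0.
have cheb := chebyshev_iid mf v0 f_mean f_var a c0 (n := k).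
have mfi (i : 'I_k) : measurable_fun setT (fun t : k.-tuple T => f (tnth t i)).
  exact: (measurableT_comp mf (measurable_tnth i)).
have m1 : measurable [set t : k.-tuple T | k%:R * (e / 4) <= \sum_(i < k) a i * f (tnth t i)].
  by apply: measurable_ger_cst; apply: measurable_sum => i; exact: measurable_funM.
have m2 : measurable [set t : k.-tuple T | k%:R * (v + e / 2) <= \sum_(i < k) f (tnth t i) ^+ 2].
  by apply: measurable_ger_cst; apply: measurable_sum => i; exact: measurable_funX.
apply: (@le_trans _ _ (iid_law Q k
   ([set t | k%:R * (e / 4) <= \sum_(i < k) a i * f (tnth t i)]
   `|` [set t | k%:R * (v + e / 2) <= \sum_(i < k) f (tnth t i) ^+ 2]))).
  apply: le_measure; rewrite ?inE.
  - apply: measurable_ger_cst; apply: measurable_sum => i; apply: measurable_funX.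
    exact: measurable_funD.
  - exact: measurableU.
  - move=> t /= H.
    have [H1|H1] := leP (k%:R * (e / 4)) (\sum_(i < k) a i * f (tnth t i)); first by left.
    right; rewrite leNgt; apply/negP => H2.
    move: H; apply/negP; rewrite -ltNge.
    have -> : \sum_(i < k) (a i + f (tnth t i)) ^+ 2 = \sum_(i < k) a i ^+ 2 +
        2 * (\sum_(i < k) a i * f (tnth t i)) + \sum_(i < k) f (tnth t i) ^+ 2.
      by rewrite mulr_sumr -!big_split/=; apply: eq_bigr => i _; ring.
    nra.
apply: le_trans; first exact: measureU2.
apply: le_trans (leeD cheb (HK _ kK)) _.
rewrite -EFinD lee_fin.
suff : v * (\sum_(i < k) a i ^+ 2) / (k%:R * (e / 4)) ^+ 2 <= delta / 2 by lra.
apply: (@le_trans _ _ (v * (k%:R * C) / (k%:R * (e / 4)) ^+ 2)).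
  by rewrite ler_pM2r ?invr_gt0 ?exprn_gt0// ler_wpM2l.
have -> : v * (k%:R * C) / (k%:R * (e / 4)) ^+ 2 = 16 * v * C / e ^+ 2 / k%:R.
  by field; rewrite !gt_eqF.
rewrite ler_pdivrMr//.
have : 32 * v * C / (e ^+ 2 * delta) <= k%:R.
  by apply: le_trans (ler_norm _) _; rewrite -/D; lra.
rewrite ler_pdivrMr ?mulr_gt0 ?exprn_gt0// => H.
rewrite ler_pdivrMr ?exprn_gt0//; nra.
Qed.

End noise.

(** * Moments of the Gaussian law *)

Section gaussian_moments.
Variable R : realType.
Local Notation mu := (@lebesgue_measure R).

(** The Radon-Nikodym derivative of the normal law and its density have the same integral over every
    measurable set, hence agree almost everywhere. *)
Lemma ge0_integral_normal_prob (m s : R) (F : R -> \bar R) :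
  measurable_fun setT F -> (forall x, 0 <= F x)%E ->
  (\int[normal_prob m s]_x F x = \int[mu]_x (F x * (normal_pdf m s x)%:E))%E.
Proof.
move=> mF F0.
have dom := normal_prob_dominates m s.
rewrite -(Radon_Nikodym_SigmaFinite.change_of_variables dom F0 measurableT mF).
pose rn := Radon_Nikodym_SigmaFinite.f (normal_prob m s) mu.
have irn : mu.-integrable setT rn.
  exact: (Radon_Nikodym_SigmaFinite.f_integrable dom).
have mrn := measurable_int _ irn.
have mpdf : measurable_fun setT (fun x : R => (normal_pdf m s x)%:E).
  by apply/measurable_EFinP; exact: measurable_normal_pdf.
apply: ge0_ae_eq_integral => //.
- exact: emeasurable_funM.
- exact: emeasurable_funM.
- move=> x _; rewrite mule_ge0//; exact: Radon_Nikodym_SigmaFinite.f_ge0.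
- by move=> x _; rewrite mule_ge0// lee_fin normal_pdf_ge0.
have H : ae_eq mu setT rn (fun x : R => (normal_pdf m s x)%:E).
  apply: integral_ae_eq => // A _ mA.
  exact/esym/(Radon_Nikodym_SigmaFinite.f_integral dom).
by apply: filterS H => x H _; rewrite -/rn H.
Qed.

Let pdfE (m s x : R) : 0 < s ->
  normal_pdf m s x = normal_peak s * normal_fun m s x.
Proof. by move=> s0; rewrite /normal_pdf gt_eqF. Qed.

Lemma normal_pdf_le (s s' x : R) : 0 < s -> s < s' ->
  normal_pdf 0 s x * (1 + (s ^- 2 - s' ^- 2) / 2 * x ^+ 2) <=
  s' / s * normal_pdf 0 s' x.
Proof.
move=> s0 ss'; have s'0 : 0 < s' by exact: lt_trans ss'.
rewrite !pdfE//.
have peakE u : 0 < u -> normal_peak u = u^-1 * (Num.sqrt (pi *+ 2))^-1.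
  move=> u0; rewrite /normal_peak -mulrnAr sqrtrM ?sqr_ge0// sqrtr_sqr gtr0_norm//.
  by rewrite invfM.
rewrite !peakE//; have : 0 < (Num.sqrt (pi *+ 2 : R))^-1.
  by rewrite invr_gt0 sqrtr_gt0 mulrn_wgt0 ?pi_gt0.
set z := (Num.sqrt _)^-1 => z0; rewrite (_ : s' / s * _ = s^-1 * z * normal_fun 0 s' x); last first.
  by field; rewrite !gt_eqF.
rewrite -[leLHS]mulrA ler_pM2l; last by apply: mulr_gt0 => //; rewrite invr_gt0.
rewrite /normal_fun !subr0.
have -> : - x ^+ 2 / (s' ^+ 2 *+ 2) =
    - x ^+ 2 / (s ^+ 2 *+ 2) + (s ^- 2 - s' ^- 2) / 2 * x ^+ 2.
  by field; rewrite !gt_eqF.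
by rewrite expRD ler_pM2l ?expR_gt0// expR_ge1Dx.
Qed.

(* Compare with a larger standard deviation [s']: [1 + c x^2 <= exp (c x^2)] turns the
   normalisation of the density of parameter [s'] into an upper bound on the second
   moment; then let [s'] tend to [s]. *)
Let normal_second_moment (s : R) : 0 < s ->
  (\int[normal_prob 0 s]_x (x ^+ 2)%:E <= (s ^+ 2)%:E)%E.
Proof.
move=> s0; set I := (\int[_]_x _)%E.
have mx2 : measurable_fun [set: measurableTypeR R] (fun x : R => (x ^+ 2)%:E).
  by apply/measurable_EFinP; exact: measurable_funX.
have I0 : (0 <= I)%E by apply: integral_ge0 => x _; rewrite lee_fin sqr_ge0.
have key s' : s < s' -> (1 + ((s ^- 2 - s' ^- 2) / 2)%:E * I <= (s' / s)%:E)%E.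
  move=> ss'; have s'0 : 0 < s' by exact: lt_trans ss'.
  set c := (s ^- 2 - s' ^- 2) / 2.
  have c0 : 0 <= c.
    by rewrite divr_ge0// subr_ge0 lef_pV2 ?posrE ?exprn_gt0// ler_sqr ?nnegrE ltW.
  have -> : (1 + c%:E * I = \int[normal_prob 0 s]_x (1 + c * x ^+ 2)%:E)%E.
    under eq_integral do rewrite EFinD EFinM.
    rewrite ge0_integralD//=; last 2 first.
    - by move=> x _; rewrite -EFinM lee_fin mulr_ge0 ?sqr_ge0.
    - exact: measurable_funeM.
    rewrite integral_cst// [X in (_ * X + _)%E]probability_setT mule1.
    by rewrite ge0_integralZl// => x _; rewrite lee_fin sqr_ge0.
  rewrite ge0_integral_normal_prob; last 2 first.
  - apply/measurable_EFinP; apply: measurable_funD => //.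
    by apply: measurable_funM => //; exact: measurable_funX.
  - by move=> x; rewrite lee_fin addr_ge0// mulr_ge0 ?sqr_ge0.
  have -> : (s' / s)%:E = (\int[mu]_x ((s' / s)%:E * (normal_pdf 0 s' x)%:E))%E.
    rewrite ge0_integralZl//.
    - by rewrite integral_normal_pdf mule1.
    - by apply/measurable_EFinP; exact: measurable_normal_pdf.
    - by move=> x _; rewrite lee_fin normal_pdf_ge0.
    - by rewrite lee_fin divr_ge0 ?ltW.
  apply: ge0_le_integral => //.
  - move=> x _; rewrite mule_ge0// lee_fin ?normal_pdf_ge0//.
    by rewrite addr_ge0// mulr_ge0 ?sqr_ge0.
  - apply: emeasurable_funM; apply/measurable_EFinP; last exact: measurable_normal_pdf.
    apply: measurable_funD => //.
    by apply: measurable_funM => //; exact: measurable_funX.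
  - by apply: measurable_funeM; apply/measurable_EFinP; exact: measurable_normal_pdf.
  - by move=> x _; rewrite -!EFinM lee_fin mulrC; exact: normal_pdf_le.
have Ifin : I \is a fin_num.
  rewrite ge0_fin_numE//.
  (* Any [s' > s] shows that the moment is finite, the right-hand side of [key] being finite and the
     coefficient of [I] positive. *)
  have s2 : s < 2 * s by lra.
  have := key _ s2; case: I I0 {key} => [r| |]//; first by rewrite ltry.
  rewrite mulry gtr0_sg ?mul1e; last first.
    by rewrite divr_gt0// subr_gt0 ltf_pV2 ?posrE ?exprn_gt0//; nra.
  by [].
rewrite -(fineK Ifin) lee_fin.
have i0 : 0 <= fine I by exact: fine_ge0.
have key2 e : 0 < e -> fine I <= (s + e) ^+ 2.
  move=> e0; have se : s < s + e by lra.
  have := key _ se; rewrite -{1}(fineK Ifin) -EFinM -EFinD lee_fin.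
  move: (fine I) i0 => i i0.
  (* The factor [e / s] is common to both sides; [(2 s + e) / (2 s)], which is at least 1, is then
     dropped. *)
  have -> : (s ^- 2 - (s + e) ^- 2) / 2 * i =
     (e / s) * ((2 * s + e) / (2 * s) * (i / (s + e) ^+ 2)).
    by field; rewrite !gt_eqF//; lra.
  have -> : (s + e) / s = 1 + e / s by field; rewrite gt_eqF.
  rewrite lerD2l -{2}(mulr1 (e / s)) ler_pM2l ?divr_gt0// => h.
  have s2 : 0 < (s + e) ^+ 2 by rewrite exprn_gt0//; lra.
  rewrite -[leRHS]mul1r -ler_pdivrMr//; apply: le_trans h.
  rewrite ler_peMl ?divr_ge0 ?(ltW s2)//.
  by rewrite ler_pdivlMr ?mul1r; lra.
apply/ler_addgt0Pr => e e0.
(* Here [(s + u)^2 = s^2 + u (2 s + u) <= s^2 + u (2 s + 1) <= s^2 + e]. *)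
pose u := Num.min 1 (e / (2 * s + 1)).
have u0 : 0 < u by rewrite lt_min ltr01 divr_gt0//; lra.
apply: le_trans (key2 _ u0) _.
have u1 : u <= 1 by rewrite ge_min lexx.
have : u <= e / (2 * s + 1) by rewrite ge_min lexx orbT.
rewrite ler_pdivlMr; last lra.
nra.
Qed.

(** The positive and negative parts are exchanged by [x |-> -x], which preserves the density. Their
    difference makes sense because [max(x, 0) <= 1 + x^2] is integrable. *)
Let normal_mean (s : R) : 0 < s -> (\int[normal_prob 0 s]_x x%:E = 0)%E.
Proof.
move=> s0.
pose F (x : R) : \bar R := (Num.max x 0)%:E.
have mF : measurable_fun [set: measurableTypeR R] F.
  by apply/measurable_EFinP; exact: measurable_maxr.
have F0 x : (0 <= F x)%E by rewrite lee_fin le_max lexx orbT.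
have FN : (\int[normal_prob 0 s]_x F (- x)%R = \int[normal_prob 0 s]_x F x)%E.
  have mN : measurable_fun [set: measurableTypeR R] (-%R : measurableTypeR R -> measurableTypeR R).
    exact: oppr_measurable.
  rewrite !ge0_integral_normal_prob//; last exact: measurableT_comp.
  pose G (x : R) := (F x * (normal_pdf 0 s x)%:E)%E.
  have mG : measurable_fun [set: measurableTypeR R] G.
    apply: emeasurable_funM => //; apply/measurable_EFinP.
    exact: measurable_normal_pdf.
  transitivity (\int[mu]_x (G \o (-%R : measurableTypeR R -> measurableTypeR R)) x)%E.
    apply: eq_integral => x _; rewrite /G /=; congr (_ * _%:E)%E.
    by rewrite !pdfE// /normal_fun !subr0 sqrrN.
  rewrite -(ge0_integral_pushforward mN mu measurableT mG)//.
    by apply: eq_measure_integral => // A mA _; exact: lebesgue_measureN.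
  by move=> x _; rewrite mule_ge0// lee_fin normal_pdf_ge0.
have -> : (\int[normal_prob 0 s]_x x%:E =
    \int[normal_prob 0 s]_x F x - \int[normal_prob 0 s]_x F (- x)%R)%E.
  rewrite integralE; congr (_ - _)%E; apply: eq_integral => x _.
    by rewrite funeposE -EFin_max.
  by rewrite funenegE /F EFin_max EFinN.
rewrite FN subee// ge0_fin_numE; last exact: integral_ge0.
apply: (@le_lt_trans _ _ (\int[normal_prob 0 s]_x (1 + x ^+ 2)%:E)%E).
  apply: ge0_le_integral => //.
  - apply/measurable_EFinP; apply: measurable_funD => //; exact: measurable_funX.
  - by move=> x _; rewrite lee_fin ge_max; nra.
have mx2 : measurable_fun [set: measurableTypeR R] (fun x : R => (x ^+ 2)%:E).
  by apply/measurable_EFinP; exact: measurable_funX.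
under eq_integral do rewrite EFinD.
rewrite ge0_integralD//=; last by move=> x _; rewrite lee_fin sqr_ge0.
rewrite integral_cst// [X in (_ * X + _)%E]probability_setT mule1 lte_add_pinfty ?ltry//.
exact: le_lt_trans (normal_second_moment s0) (ltry _).
Qed.

Lemma gaussian_second_moment (N : R) : 0 < N ->
  (\int[gaussian 0 N]_x (x ^+ 2)%:E <= N%:E)%E.
Proof.
move=> N0; rewrite ge0_integral_distribution.
- apply: le_trans (normal_second_moment _) _; first by rewrite sqrtr_gt0.
  by rewrite sqr_sqrtr// ltW.
- by apply/measurable_EFinP; exact: measurable_funX.
- by move=> x; rewrite lee_fin sqr_ge0.
Qed.

Lemma gaussian_mean (N : R) : 0 < N -> (\int[gaussian 0 N]_x x%:E = 0)%E.
Proof.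
move=> N0; have s0 : 0 < Num.sqrt N by rewrite sqrtr_gt0.
rewrite -[RHS](normal_mean s0) [LHS]integralE [RHS]integralE.
have mid : measurable_fun [set: R] (fun x : R => x%:E) by exact/measurable_EFinP.
congr (_ - _)%E; rewrite ge0_integral_distribution//.
- exact: measurable_funepos.
- exact: measurable_funeneg.
Qed.

End gaussian_moments.

(** * The code *)

(** The choice factors through the table of all test results, which takes finitely many values. *)
Lemma measurable_pick d (T : measurableType d) (F : finType) (p0 : F)
    (test : T -> F -> bool) :
  (forall p, measurable [set q | test q p]) ->
  forall p, measurable ((fun q => odflt p0 [pick p | test q p]) @^-1` [set p]).
Proof.
move=> mtest p1.
pose h (b : {ffun F -> bool}) := odflt p0 [pick p | b p].
rewrite (_ : _ @^-1` _ = \bigcup_(b in [set b : {ffun F -> bool} | h b = p1])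
  \bigcap_(p in [set: F]) [set q | test q p = b p]); last first.
  have hE q : h (finfun (test q)) = odflt p0 [pick p | test q p].
    by rewrite /h (eq_pick (ffunE (test q))).
  apply/seteqP; split=> q /=.
    move=> <-; exists (finfun (test q)); first exact: hE.
    by move=> p _ /=; rewrite ffunE.
  move=> [b /= <- bq]; rewrite -hE; congr h; apply/ffunP => p.
  by rewrite ffunE; exact: bq.
apply: fin_bigcup_measurable => // b _; apply: fin_bigcap_measurable => // p _.
case: (b p); first exact: mtest.
rewrite (_ : [set _ | _] = ~` [set q | test q p]); first exact: measurableC.
by apply/seteqP; split=> q /=; case: (test q p).
Qed.

Lemma measurable_tnth_comp d (T : measurableType d) d' (T' : measurableType d')
    n (f : T -> n.-tuple T') i :
  measurable_fun setT f -> measurable_fun setT (fun x => tnth (f x) i).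
Proof. by move=> mf; exact: (measurableT_comp (measurable_tnth i) mf). Qed.

Section quantizer.
Variables (R : realType) (k : nat) (g : k.-tuple R).

(* The value [0] returned when no translate is in the ball need not be congruent to [t]
   modulo the progression: it counts as an encoding failure. *)
Fixpoint quant (M : nat) (t : k.-tuple R) : k.-tuple R :=
  if M is m.+1 then
    if tnorm2 (shifted m g t) <= 4^-1 then [tuple cfrac (shifted m g t i) | i < k]
    else quant m t
  else [tuple 0 | i < k].

(** The bound holds also for the default value, so the power constraint is met surely and not only
    when the encoding succeeds. *)
Lemma quant_energy M t : \sum_(i < k) tnth (quant M t) i ^+ 2 <= 4^-1.
Proof.
elim: M => [|m IH] /=.
  by rewrite big1 ?invr_ge0// => i _; rewrite tnth_mktuple expr0n.
case: ifPn => // h; under eq_bigr do rewrite tnth_mktuple.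
exact: h.
Qed.

Lemma quantP M t : (exists m : 'I_M, tnorm2 (shifted m g t) <= 4^-1) ->
  exists2 m : 'I_M, tnorm2 (shifted m g t) <= 4^-1 &
    forall i, tnth (quant M t) i = cfrac (shifted m g t i).
Proof.
elim: M => [|m IH]; first by case=> -[].
move=> [[j jm] /= jball] /=; case: ifPn => h.
  by exists ord_max => // i; rewrite tnth_mktuple.
have jm' : (j < m)%N.
  rewrite ltn_neqAle -ltnS jm andbT; apply: contraNneq h => <-; exact: jball.
have [|m' h1 h2] := IH; first by exists (Ordinal jm').
by exists (widen_ord (leqnSn m) m').
Qed.

Lemma measurable_shifted m i : measurable_fun setT (fun t => shifted m g t i).
Proof. by apply: measurable_funB => //; exact: measurable_tnth. Qed.

Lemma measurable_quant M : measurable_fun setT (quant M).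
Proof.
elim: M => [|m IH] //=; apply: measurable_fun_ifT => //.
  apply: (measurable_fun_ler (g := cst 4^-1)) => //; apply: measurable_tnorm2 => i.
  exact: measurable_shifted.
apply/measurable_fun_tnthP => i.
rewrite (_ : _ \o _ = fun t => cfrac (shifted m g t i)); last first.
  by apply/funext => t /=; rewrite tnth_mktuple.
exact: (measurableT_comp (@measurable_cfrac R) (measurable_shifted m i)).
Qed.

End quantizer.

Section code_construction.
Variables (R : realType) (k n : nat) (le_kn : (k <= n)%N).
Variables (M1 M2 M : nat) (p0 : 'I_M1 * 'I_M2).
Variables (g : k.-tuple R) (L alpha c rho : R).
Local Notation V := (k.-tuple R).
Local Notation mu := (iid_law (torus R) k).

(* In a dither [(B, A)] the codeword of message [w] is [A + w B]: the codewords are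
   pairwise independent and uniform on the torus. *)
Definition dithered (w : nat) (q : n.-tuple R * (V * V)) : V :=
  [tuple cfrac (tnth q.2.2 i + (w%:R * tnth q.2.1 i -
    alpha / L * tnth q.1 (widen_ord le_kn i))) | i < k].

(** Silence after the first [k] uses implements time sharing: the power of the whole block is spent
    on a fraction of it. *)
Definition embed (x : V) : n.-tuple R :=
  [tuple if insub (val j) is Some i then L * tnth x i else 0 | j < n].

Definition encoder (w : nat) (q : n.-tuple R * (V * V)) : n.-tuple R :=
  embed (quant g M (dithered w q)).

(** The constant [c] will be the sum of the means of the estimation errors. These need not vanish,
    since only second moments are prescribed, but the decoder can subtract them. *)
Definition residue (w1 w2 : nat) (q : n.-tuple R * ((V * V) * (V * V))) (i : 'I_k) : R :=
  alpha / L * (tnth q.1 (widen_ord le_kn i) - c)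
  - (tnth q.2.1.2 i + w1%:R * tnth q.2.1.1 i)
  - (tnth q.2.2.2 i + w2%:R * tnth q.2.2.1 i).

(* The indices of the translates used by the two encoders add up to less than [2 M]. *)
Definition accepts (q : n.-tuple R * ((V * V) * (V * V))) (w : 'I_M1 * 'I_M2) : bool :=
  [exists m : 'I_(2 * M),
    tnorm2 (fun i => residue w.1 w.2 q i + m%:R * tnth g i) <= rho].

Definition decoder (q : n.-tuple R * ((V * V) * (V * V))) : 'I_M1 * 'I_M2 :=
  odflt p0 [pick w | accepts q w].

Lemma tnth_embed (x : V) i : tnth (embed x) (widen_ord le_kn i) = L * tnth x i.
Proof.
rewrite tnth_mktuple; case: insubP => [j jk ji|].
  by congr (_ * tnth x _); exact: val_inj.
by rewrite /= ltn_ord.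
Qed.

Lemma sqnorm_embed (x : V) : sqnorm (embed x) = L ^+ 2 * \sum_(i < k) tnth x i ^+ 2.
Proof.
rewrite /sqnorm mulr_sumr.
pose F j : R := if insub j is Some i then (L * tnth x i) ^+ 2 else 0.
rewrite (eq_bigr (fun j : 'I_n => F j)); last first.
  move=> j _; rewrite tnth_mktuple /F; case: insub => //; by rewrite expr0n.
rewrite -(big_mkord xpredT F) (big_cat_nat (n := k))//= [X in _ + X]big_nat_cond.
rewrite [X in _ + X]big1 ?addr0; last first.
  move=> j; rewrite andbT => /andP[kj _]; rewrite /F insubF//.
  by apply/negbTE; rewrite -leqNgt.
rewrite big_mkord; apply: eq_bigr => i _; rewrite /F.
case: insubP => [j jk ji|]; last by rewrite ltn_ord.
by rewrite exprMn; congr (_ * tnth x _ ^+ 2); exact: val_inj.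
Qed.

Lemma encoder_energy w q : sqnorm (encoder w q) <= L ^+ 2 / 4.
Proof. by rewrite sqnorm_embed ler_wpM2l ?sqr_ge0// quant_energy. Qed.

Lemma measurable_dithered w : measurable_fun setT (dithered w).
Proof.
apply/measurable_fun_tnthP => i.
rewrite (_ : _ \o _ = fun q => cfrac (tnth q.2.2 i + (w%:R * tnth q.2.1 i -
    alpha / L * tnth q.1 (widen_ord le_kn i)))); last first.
  by apply/funext => q /=; rewrite tnth_mktuple.
apply: (measurableT_comp (@measurable_cfrac R)).
apply: measurable_funD.
  by apply: measurable_tnth_comp; exact: measurableT_comp.
apply: measurable_funB; apply: measurable_funM => //.
  by apply: measurable_tnth_comp; exact: measurableT_comp.
exact: measurable_tnth_comp.
Qed.

Lemma measurable_embed : measurable_fun setT embed.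
Proof.
apply/measurable_fun_tnthP => j.
rewrite (_ : _ \o _ = fun x : V => if insub (val j) is Some i then L * tnth x i else 0); last first.
  by apply/funext => q /=; rewrite tnth_mktuple.
case: insub => [i|]//; apply: measurable_funM => //; exact: measurable_tnth.
Qed.

Lemma measurable_encoder w : measurable_fun setT (encoder w).
Proof.
exact: (measurableT_comp measurable_embed
  (measurableT_comp (measurable_quant g M) (measurable_dithered w))).
Qed.

Lemma measurable_residue w1 w2 i : measurable_fun setT (fun q => residue w1 w2 q i).
Proof.
have m1 (f : n.-tuple R * ((V * V) * (V * V)) -> V) : measurable_fun setT f ->
  measurable_fun setT (fun q => tnth (f q) i) by exact: measurable_tnth_comp.
apply: measurable_funB; first apply: measurable_funB.
- apply: measurable_funM => //; apply: measurable_funB => //.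
  exact: measurable_tnth_comp.
- apply: measurable_funD; last apply: measurable_funM => //.
    apply: m1; exact: (measurableT_comp measurable_snd (measurableT_comp measurable_fst measurable_snd)).
  apply: m1; exact: (measurableT_comp measurable_fst (measurableT_comp measurable_fst measurable_snd)).
- apply: measurable_funD; last apply: measurable_funM => //.
    apply: m1; exact: (measurableT_comp measurable_snd (measurableT_comp measurable_snd measurable_snd)).
  apply: m1; exact: (measurableT_comp measurable_fst (measurableT_comp measurable_snd measurable_snd)).
Qed.

Lemma measurable_decoder w : measurable (decoder @^-1` [set w]).
Proof.
apply: (@measurable_pick _ _ _ p0 accepts) => {}w.
rewrite (_ : [set _ | _] = \bigcup_(m in [set: 'I_(2 * M)])
  [set q | tnorm2 (fun i => residue w.1 w.2 q i + m%:R * tnth g i) <= rho]).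
  apply: fin_bigcup_measurable => // m _; apply: measurable_ler_cst.
  apply: measurable_tnorm2 => i; apply: measurable_funD => //.
  exact: measurable_residue.
apply/seteqP; split=> q /=; first by move=> /existsP[m mq]; exists m.
by move=> [m _ mq]; apply/existsP; exists m.
Qed.

Definition dither_law : probability (V * V)%type R := (mu \x mu)%E.

Definition torus_code : Defs.code R n M1 M2 :=
  @Code R n M1 M2 _ _ _ _ dither_law dither_law
    (fun w => encoder w) (fun w => encoder w) decoder
    (fun w => measurable_encoder w) (fun w => measurable_encoder w) measurable_decoder.

End code_construction.

Lemma prob_exists_le d (T : measurableType d) (R : realType) (P : probability T R)
    (F : finType) (A : F -> set T) (c : R) :
  (forall i, measurable (A i)) -> (forall i, (P (A i) <= c%:E)%E) ->
  measurable [set q | exists i, A i q] /\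
  (P [set q | exists i, A i q] <= (#|F|%:R * c)%:E)%E.
Proof.
move=> mA PA.
have H (s : seq F) : measurable [set q | exists2 i, i \in s & A i q] /\
    (P [set q | exists2 i, i \in s & A i q] <= ((size s)%:R * c)%:E)%E.
  elim: s => [|j s [mS IH]].
    rewrite (_ : [set _ | _] = set0); first by split; rewrite ?measure0 ?mul0r.
    by apply/seteqP; split=> q //= [].
  rewrite (_ : [set q | _] = A j `|` [set q | exists2 i, i \in s & A i q]).
    split; first exact: measurableU.
    apply: le_trans; first exact: measureU2.
    by rewrite /= -natr1 mulrDl mul1r EFinD addeC leeD.
  apply/seteqP; split=> q /=.
    move=> [i]; rewrite inE => /orP[/eqP ->|]; first by left.
    by move=> si Ai; right; exists i.
  move=> [Aj|[i si Ai]]; first by exists j => //; rewrite mem_head.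
  by exists i => //; rewrite inE si orbT.
have := H (enum F); rewrite -cardE.
rewrite (_ : [set q | _] = [set q | exists i, A i q])//.
apply/seteqP; split=> q /=; first by move=> [i _ Ai]; exists i.
by move=> [i Ai]; exists i => //; rewrite mem_enum.
Qed.

(** * Error analysis *)

Section change_of_dither.
Variables (R : realType) (k n : nat) (le_kn : (k <= n)%N) (L alpha : R).
Local Notation V := (k.-tuple R).
Local Notation mu := (iid_law (torus R) k).
Local Notation dithered := (dithered le_kn L alpha).

(** For a fixed [B] and a fixed interference estimate, the quantised point is a translate of the
    uniform offset [A]. *)
Lemma dithered_preserve (w : nat) (e : n.-tuple R) (A : set (V * V)) :
  measurable A ->
  (mu \x mu)%E [set u | A (u.1, dithered w (e, u))] = (mu \x mu)%E A.
Proof.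
move=> mA; apply: (@product_prob_map_r _ _ _ _ _ mu mu (fun u => dithered w (e, u))) => //.
  apply: (measurableT_comp (measurable_dithered le_kn L alpha w)).
  exact: measurable_fun_pair.
move=> B S mS.
rewrite -(torus_tuple_affine (fun i => w%:R * tnth B i -
  alpha / L * tnth e (widen_ord le_kn i)) (ltn0Sn 0) mS).
congr (mu _); apply/seteqP; split=> t /=; congr S; apply: eq_from_tnth => i;
  by rewrite !tnth_mktuple /= mul1r addrC.
Qed.

Lemma measurable_estimate : measurable_fun setT (@estimate R n).
Proof.
apply/measurable_fun_tnthP => i.
rewrite (_ : _ \o _ = fun s : n.-tuple (R * R) => (tnth s i).2); last first.
  by apply/funext => q /=; rewrite tnth_mktuple.
exact: (measurableT_comp measurable_snd (measurable_tnth i)).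
Qed.

Variables (Q1 Q2 : probability (R * R)%type R) (G : probability R R).
Local Notation Omega := ((n.-tuple (R * R) * n.-tuple (R * R) * n.-tuple R) *
  ((V * V) * (V * V)))%type.
Local Notation P := ((iid_law Q1 n \x iid_law Q2 n \x iid_law G n) \x
  ((mu \x mu) \x (mu \x mu)))%E.

(* Replaces the offset [A] of each dither by the point that its encoder quantizes. The
   law is preserved, so the transmitted points become independent of the
   interferences and of [B]. *)
Definition redither (w1 w2 : nat) (q : Omega) : Omega :=
  (q.1, ((q.2.1.1, dithered w1 (estimate q.1.1.1, q.2.1)),
         (q.2.2.1, dithered w2 (estimate q.1.1.2, q.2.2)))).

Lemma measurable_redither w1 w2 : measurable_fun setT (redither w1 w2).
Proof.
have m1 : measurable_fun setT (fun q : Omega => q.2.1).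
  exact: (measurableT_comp measurable_fst measurable_snd).
have m2 : measurable_fun setT (fun q : Omega => q.2.2).
  exact: (measurableT_comp measurable_snd measurable_snd).
have ms : measurable_fun setT (fun q : Omega => q.1.1).
  exact: (measurableT_comp measurable_fst measurable_fst).
apply: measurable_fun_pair => //; apply: measurable_fun_pair;
  apply: measurable_fun_pair.
- exact: (measurableT_comp measurable_fst m1).
- apply: (measurableT_comp (measurable_dithered le_kn L alpha w1)).
  apply: measurable_fun_pair => //; apply: (measurableT_comp measurable_estimate).
  exact: (measurableT_comp measurable_fst ms).
- exact: (measurableT_comp measurable_fst m2).
- apply: (measurableT_comp (measurable_dithered le_kn L alpha w2)).
  apply: measurable_fun_pair => //; apply: (measurableT_comp measurable_estimate).
  exact: (measurableT_comp measurable_snd ms).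
Qed.

Lemma redither_preserve w1 w2 (A : set Omega) : measurable A ->
  P [set q | A (redither w1 w2 q)] = P A.
Proof.
move=> mA.
pose PO : probability _ R := (iid_law Q1 n \x iid_law Q2 n \x iid_law G n)%E.
pose PD : probability _ R := ((mu \x mu) \x (mu \x mu))%E.
have -> : P = (PO \x PD)%E by [].
have mtau := measurableT_comp measurable_snd (measurable_redither w1 w2).
have H := @product_prob_map_r _ _ _ _ _ PO PD (snd \o redither w1 w2) A mtau _ mA.
apply: H.
move=> o B mB.
have md w e : measurable_fun setT (fun u : V * V => (u.1, dithered w (e, u))).
  apply: measurable_fun_pair => //.
  apply: (measurableT_comp (measurable_dithered le_kn L alpha w)).
  exact: measurable_fun_pair.
apply: (@product_prob_map _ _ _ _ _ (mu \x mu)%E (mu \x mu)%E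
  (fun u => (u.1, dithered w1 (estimate o.1.1, u)))
  (fun u => (u.1, dithered w2 (estimate o.1.2, u)))) => //.
- by move=> C mC; exact: dithered_preserve.
- by move=> C mC; exact: dithered_preserve.
Qed.

End change_of_dither.

(** * Deterministic analysis of the decoder *)

Section decoding.
Variables (R : realType) (k n : nat) (le_kn : (k <= n)%N).
Variables (M1 M2 M : nat) (p0 : 'I_M1 * 'I_M2).
Variables (g : k.-tuple R) (L alpha rho m1 m2 e C0 : R).
Local Notation V := (k.-tuple R).
Local Notation Omega := ((n.-tuple (R * R) * n.-tuple (R * R) * n.-tuple R) *
  ((V * V) * (V * V)))%type.
Local Notation pre := (widen_ord le_kn).
Local Notation beta := (alpha / L).

Definition centered_error (m : R) (s : R * R) : R := s.1 - s.2 - m.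

Definition residual_input (t1 t2 : V) (i : 'I_k) : R :=
  (alpha - 1) * (tnth (quant g M t1) i + tnth (quant g M t2) i).

Definition effective_noise (q : Omega) (i : 'I_k) : R :=
  residual_input q.2.1.2 q.2.2.2 i
  + beta * centered_error m1 (tnth q.1.1.1 (pre i))
  + beta * centered_error m2 (tnth q.1.1.2 (pre i))
  + beta * tnth q.1.2 (pre i).

(* The point tested by the decoder for the messages [(w1 + d1, w2 + d2)], after
   [redither]. *)
Definition confusion (d1 d2 : int) (m : nat) (q : Omega) (i : 'I_k) : R :=
  beta * (L * tnth (quant g M q.2.1.2) i + L * tnth (quant g M q.2.2.2) i
    + (tnth q.1.1.1 (pre i)).1 + (tnth q.1.1.2 (pre i)).1 + tnth q.1.2 (pre i)
    - (m1 + m2))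
  - tnth q.2.1.2 i - beta * (tnth q.1.1.1 (pre i)).2
  - tnth q.2.2.2 i - beta * (tnth q.1.1.2 (pre i)).2
  + m%:R * tnth g i - d1%:~R * tnth q.2.1.1 i - d2%:~R * tnth q.2.2.1 i.

Definition uncovered (t : V) : Prop := forall m : 'I_M, ~ tnorm2 (shifted m g t) <= 4^-1.

(** Indexed by all pairs of translates instead of the pair selected by the quantisers, so that each
    event bears on two independent uniform points. *)
Definition aligned (m m' : nat) (t t' : V) : Prop :=
  [/\ tnorm2 (shifted m g t) <= 4^-1, tnorm2 (shifted m' g t') <= 4^-1 &
      e <= tdot (shifted m' g t') (shifted m g t)].

(** The first clause allows the noise estimates, valid for bounded shifts, to be applied once the
    dithers are fixed. *)
Definition noisy (q : Omega) : Prop :=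
  \sum_(i < k) residual_input q.2.1.2 q.2.2.2 i ^+ 2 <= C0 /\
  rho <= \sum_(i < k) effective_noise q i ^+ 2.

Variables (w1 : 'I_M1) (w2 : 'I_M2) (q : Omega).

Let q' := redither le_kn L alpha w1 w2 q.
Let y : n.-tuple R := output
  (encoder le_kn M g L alpha w1 (estimate q.1.1.1, q.2.1))
  (encoder le_kn M g L alpha w2 (estimate q.1.1.2, q.2.2)) q.1.1.1 q.1.1.2 q.1.2.

(** Solving for the offset, [A_i = T_i - w_i B_i + beta S~_i] modulo 1, leaves only the difference
    between tested and sent messages in front of [B_i]. *)
Let residue_confusion (p : 'I_M1 * 'I_M2) (m : nat) :
  tnorm2 (fun i => residue le_kn L alpha (m1 + m2) p.1 p.2 (y, q.2) i + m%:R * tnth g i) =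
  tnorm2 (confusion (p.1%:Z - w1%:Z) (p.2%:Z - w2%:Z) m q').
Proof.
apply: eq_tnorm2 => i; rewrite /residue /confusion /=.
rewrite {1}/y /output tnth_mktuple /encoder !tnth_embed.
move: (tnth (quant _ _ _) i) (tnth (quant _ _ _) i) => X1 X2.
rewrite !tnth_mktuple /=.
have [z1 ->] := cfracP (tnth q.2.1.2 i + (w1%:R * tnth q.2.1.1 i -
  beta * (tnth q.1.1.1 (pre i)).2)).
have [z2 ->] := cfracP (tnth q.2.2.2 i + (w2%:R * tnth q.2.2.1 i -
  beta * (tnth q.1.1.2 (pre i)).2)).
exists (z1 + z2); rewrite !intrD !intrN -!pmulrn; ring.
Qed.

Hypothesis L0 : L != 0.

(** With the true messages [B_1] and [B_2] disappear. The index [a + b] supplies both translates,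
    and [- T_i] plus its translate is minus the quantised input modulo 1. *)
Let confusion_effective (a b : nat) :
  (forall i, tnth (quant g M q'.2.1.2) i = cfrac (shifted a g q'.2.1.2 i)) ->
  (forall i, tnth (quant g M q'.2.2.2) i = cfrac (shifted b g q'.2.2.2 i)) ->
  tnorm2 (confusion 0 0 (a + b) q') <= \sum_(i < k) effective_noise q' i ^+ 2.
Proof.
move=> qa qb; apply: tnorm2_le => i.
rewrite /confusion /effective_noise /residual_input /centered_error.
have [z1 E1] := cfracP (shifted a g q'.2.1.2 i).
have [z2 E2] := cfracP (shifted b g q'.2.2.2 i).
rewrite qa qb E1 E2 /shifted; exists (z1 + z2).
rewrite intrD natrD; field.
exact: L0.
Qed.

Hypothesis C0e : (1 - alpha) ^+ 2 * (2^-1 + 2 * e) <= C0.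

Lemma decoder_correct :
  ~ uncovered q'.2.1.2 -> ~ uncovered q'.2.2.2 ->
  (forall m m' : 'I_M, ~ aligned m m' q'.2.1.2 q'.2.2.2) ->
  ~ noisy q' ->
  (forall (p : 'I_M1 * 'I_M2) (m : 'I_(2 * M)), p != (w1, w2) ->
    ~ tnorm2 (confusion (p.1%:Z - w1%:Z) (p.2%:Z - w2%:Z) m q') <= rho) ->
  decoder le_kn M p0 g L alpha (m1 + m2) rho (y, q.2) = (w1, w2).
Proof.
move=> c1 c2 al no cf.
have /quantP[a aball aE] : exists m : 'I_M, tnorm2 (shifted m g q'.2.1.2) <= 4^-1.
  by apply: contrapT => H; apply: c1 => m mq; apply: H; exists m.
have /quantP[b bball bE] : exists m : 'I_M, tnorm2 (shifted m g q'.2.2.2) <= 4^-1.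
  by apply: contrapT => H; apply: c2 => m mq; apply: H; exists m.
have dot : tdot (shifted b g q'.2.2.2) (shifted a g q'.2.1.2) <= e.
  by rewrite leNgt; apply/negP => /ltW h; exact: (al a b).
have energy : \sum_(i < k) residual_input q'.2.1.2 q'.2.2.2 i ^+ 2 <= C0.
  apply: le_trans C0e.
  (* Two energies of at most [1/4] and twice an inner product of at most [e] explain
     [2^-1 + 2 * e]. *)
  have -> : \sum_(i < k) residual_input q'.2.1.2 q'.2.2.2 i ^+ 2 = (1 - alpha) ^+ 2 *
      (tnorm2 (shifted a g q'.2.1.2) + tnorm2 (shifted b g q'.2.2.2) +
       2 * tdot (shifted b g q'.2.2.2) (shifted a g q'.2.1.2)).
    rewrite /tnorm2 /tdot [2 * _]mulr_sumr -!big_split/= mulr_sumr.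
    by apply: eq_bigr => i _; rewrite /residual_input aE bE; ring.
  by apply: ler_wpM2l; [exact: sqr_ge0|lra].
have eff : \sum_(i < k) effective_noise q' i ^+ 2 <= rho.
  by rewrite leNgt; apply/negP => /ltW h; exact: no.
have ab : (a + b < 2 * M)%N by rewrite mul2n -addnn; have := ltn_ord a; have := ltn_ord b; lia.
have acc : accepts le_kn M g L alpha (m1 + m2) rho (y, q.2) (w1, w2).
  apply/existsP; exists (Ordinal ab) => /=.
  rewrite (residue_confusion (w1, w2)) /= !subrr.
  exact: le_trans (confusion_effective aE bE) eff.
rewrite /decoder; case: pickP => [p /existsP[m] pm|/(_ (w1, w2))]; last by rewrite acc.
apply/eqP; apply: contraT => pw; have := cf _ m pw.
by rewrite -residue_confusion.
Qed.

End decoding.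

(** * Energy of the three independent noises added to a given vector *)

Section noise_bound.
Context d (T : measurableType d) (R : realType) (Q : probability T R).
Variables (k n : nat) (le_kn : (k <= n)%N) (f : T -> R).
Hypothesis mf : measurable_fun setT f.
Local Notation pre := (widen_ord le_kn).

(** Uniform in [a], which stands for the residual input together with the noises already added. *)
Definition noise_bounded (C kappa delta : R) : Prop :=
  forall a : 'I_k -> R, \sum_(i < k) a i ^+ 2 <= C ->
  (iid_law Q k [set t | (\sum_(i < k) a i ^+ 2 + kappa <=
    \sum_(i < k) (a i + f (tnth t i)) ^+ 2)%R] <= delta%:E)%E.

Lemma noise_bounded_prefix (C kappa delta : R) : noise_bounded C kappa delta ->
  forall a : 'I_k -> R, \sum_(i < k) a i ^+ 2 <= C ->
  (iid_law Q n [set t | (\sum_(i < k) a i ^+ 2 + kappa <=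
    \sum_(i < k) (a i + f (tnth t (pre i))) ^+ 2)%R] <= delta%:E)%E.
Proof.
move=> H a aC; have mA : measurable [set t : k.-tuple T |
    \sum_(i < k) a i ^+ 2 + kappa <= \sum_(i < k) (a i + f (tnth t i)) ^+ 2].
  apply: measurable_ger_cst; apply: measurable_sum => i; apply: measurable_funX.
  apply: measurable_funD => //; exact: (measurableT_comp mf (measurable_tnth i)).
apply: le_trans (H a aC); rewrite -(iid_law_prefix Q le_kn mA).
rewrite (_ : [set t | _] = [set t | [set t : k.-tuple T |
    \sum_(i < k) a i ^+ 2 + kappa <= \sum_(i < k) (a i + f (tnth t i)) ^+ 2]
    (tprefix le_kn t)])//.
by apply/seteqP; split=> t /=; congr (_ <= _); apply: eq_bigr => i _;
  rewrite tnth_mktuple.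
Qed.

End noise_bound.

Section three_noises.
Context d1 d2 d3 (T1 : measurableType d1) (T2 : measurableType d2)
  (T3 : measurableType d3) (R : realType).
Variables (Q1 : probability T1 R) (Q2 : probability T2 R) (Q3 : probability T3 R).
Variables (k n : nat) (le_kn : (k <= n)%N).
Variables (f1 : T1 -> R) (f2 : T2 -> R) (f3 : T3 -> R).
Hypotheses (mf1 : measurable_fun setT f1) (mf2 : measurable_fun setT f2)
  (mf3 : measurable_fun setT f3).
Variables (C0 C k1 k2 k3 delta : R).
Hypotheses (delta0 : 0 <= delta) (k10 : 0 <= k1) (k20 : 0 <= k2) (Ck : C0 + k1 + k2 <= C).
Hypotheses (H1 : noise_bounded Q1 k f1 C k1 delta)
  (H2 : noise_bounded Q2 k f2 C k2 delta) (H3 : noise_bounded Q3 k f3 C k3 delta).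
Local Notation pre := (widen_ord le_kn).
Local Notation P1 := (iid_law Q1 n).
Local Notation P2 := (iid_law Q2 n).
Local Notation P3 := (iid_law Q3 n).

(** The noises are added one by one. At each stage the current sum is fixed by conditioning and its
    energy is still at most [C]; the next noise raises it by [k1], [k2] or [k3] or more with
    probability at most [delta]. *)
Lemma prob_three_noises_le (a : 'I_k -> R) : \sum_(i < k) a i ^+ 2 <= C0 ->
  ((P1 \x P2 \x P3) [set q | (C0 + k1 + k2 + k3 <= \sum_(i < k)
    (a i + f1 (tnth q.1.1 (pre i)) + f2 (tnth q.1.2 (pre i)) + f3 (tnth q.2 (pre i))) ^+ 2)%R]
   <= (3 * delta)%:E)%E.
Proof.
move=> aC.
have C0C : C0 <= C by apply: le_trans Ck; rewrite -addrA lerDl addr_ge0.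
have C1C : C0 + k1 <= C by apply: le_trans Ck; rewrite lerDl.
pose b (q : n.-tuple T1 * n.-tuple T2 * n.-tuple T3) i := a i + f1 (tnth q.1.1 (pre i)).
pose c (q : n.-tuple T1 * n.-tuple T2 * n.-tuple T3) i := b q i + f2 (tnth q.1.2 (pre i)).
pose e (q : n.-tuple T1 * n.-tuple T2 * n.-tuple T3) i := c q i + f3 (tnth q.2 (pre i)).
have mb i : measurable_fun setT (fun q => b q i).
  apply: measurable_funD => //; apply: (measurableT_comp mf1).
  apply: measurable_tnth_comp; exact: (measurableT_comp measurable_fst measurable_fst).
have mc i : measurable_fun setT (fun q => c q i).
  apply: measurable_funD => //; apply: (measurableT_comp mf2).
  apply: measurable_tnth_comp; exact: (measurableT_comp measurable_snd measurable_fst).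
have me i : measurable_fun setT (fun q => e q i).
  apply: measurable_funD => //; apply: (measurableT_comp mf3).
  apply: measurable_tnth_comp; exact: measurable_snd.
pose sq (h : n.-tuple T1 * n.-tuple T2 * n.-tuple T3 -> 'I_k -> R) q :=
  \sum_(i < k) h q i ^+ 2.
have msq h : (forall i, measurable_fun setT (fun q => h q i)) -> measurable_fun setT (sq h).
  by move=> mh; apply: measurable_sum => i; apply: measurable_funX; exact: mh.
have msb := msq b mb; have msc := msq c mc; have mse := msq e me.
pose A1 := [set q | \sum_(i < k) a i ^+ 2 + k1 <= sq b q].
pose A2 := [set q | sq b q <= C0 + k1] `&` [set q | k2 <= sq c q - sq b q].
pose A3 := [set q | sq c q <= C0 + k1 + k2] `&` [set q | k3 <= sq e q - sq c q].
have mA1 : measurable A1 by exact: measurable_ger_cst.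
have mA2 : measurable A2.
  by apply: measurableI; [exact: measurable_ler_cst|apply: measurable_ger_cst; exact: measurable_funB].
have mA3 : measurable A3.
  by apply: measurableI; [exact: measurable_ler_cst|apply: measurable_ger_cst; exact: measurable_funB].
pose P := (P1 \x P2 \x P3)%E.
have PA1 : (P A1 <= delta%:E)%E.
  apply: product_prob_ler => // z.
  apply: product_prob_ler => //; first exact: measurable_section_r.
  move=> s2; apply: (noise_bounded_prefix le_kn mf1 H1).
  exact: le_trans aC C0C.
have PA2 : (P A2 <= delta%:E)%E.
  apply: product_prob_ler => // z.
  apply: product_prob_le => //; first exact: measurable_section_r.
  (* [point] fills a coordinate on which [b] does not depend; the same device serves for [c]
     below. *)
  move=> s1; have [h|h] := leP (sq b (s1, point, z)) (C0 + k1); last first.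
    rewrite (_ : [set _ | _] = set0) ?measure0//.
    apply/seteqP; split=> // s2 -[/= h' _]; move: h; rewrite ltNge.
    by rewrite (_ : sq b _ = sq b (s1, s2, z))// h'.
  apply: le_trans (noise_bounded_prefix le_kn mf2 H2 (a := b (s1, point, z)) _); last first.
    exact: le_trans h C1C.
  rewrite le_eqVlt; apply/orP; left; apply/eqP; congr (P2 _).
  apply/seteqP; split=> s2 /=.
    by move=> [_] /=; rewrite /A2 /= lerBrDl.
  by move=> h2; split => //=; rewrite lerBrDl.
have PA3 : (P A3 <= delta%:E)%E.
  apply: product_prob_le => // -[s1 s2].
  have [h|h] := leP (sq c (s1, s2, point)) (C0 + k1 + k2); last first.
    rewrite (_ : [set _ | _] = set0) ?measure0//.
    apply/seteqP; split=> // z -[/= h' _]; move: h; rewrite ltNge.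
    by rewrite (_ : sq c _ = sq c (s1, s2, z))// h'.
  apply: le_trans (noise_bounded_prefix le_kn mf3 H3 (a := c (s1, s2, point)) _); last first.
    exact: le_trans h Ck.
  rewrite le_eqVlt; apply/orP; left; apply/eqP; congr (P3 _).
  apply/seteqP; split=> z /=.
    by move=> [_] /=; rewrite lerBrDl.
  by move=> h2; split => //=; rewrite lerBrDl.
apply: (@le_trans _ _ (P (A1 `|` A2 `|` A3))).
  apply: le_measure; rewrite ?inE.
  - by apply: (@measurable_ger_cst _ _ R (sq e)).
  - by apply: measurableU => //; exact: measurableU.
  - move=> q /= h; have [h1|h1] := leP (\sum_(i < k) a i ^+ 2 + k1) (sq b q).
      by left; left.
    have [h2|h2] := leP k2 (sq c q - sq b q).
      by left; right; split=> //=; lra.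
    right; split=> /=; first lra.
    by have : C0 + k1 + k2 + k3 <= sq e q by []; lra.
apply: le_trans; first by apply: measureU2 => //; exact: measurableU.
rewrite (_ : 3 * delta = delta + delta + delta); last by ring.
rewrite 2!EFinD; apply: leeD => //.
by apply: le_trans; [exact: measureU2|exact: leeD].
Qed.

End three_noises.

(** * Probabilities of the events that can cause an error *)

Section bad_events.
Variables (R : realType) (k n : nat) (le_kn : (k <= n)%N).
Variables (M : nat) (g : k.-tuple R) (L alpha m1 m2 e C0 C k1 k2 k3 : R).
Variables (Q1 Q2 : probability (R * R)%type R) (G : probability R R).
Local Notation V := (k.-tuple R).
Local Notation Omega := ((n.-tuple (R * R) * n.-tuple (R * R) * n.-tuple R) *
  ((V * V) * (V * V)))%type.
Local Notation pre := (widen_ord le_kn).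
Local Notation beta := (alpha / L).
Local Notation mu := (iid_law (torus R) k).
Local Notation PO := (iid_law Q1 n \x iid_law Q2 n \x iid_law G n)%E.
Local Notation PD := ((mu \x mu) \x (mu \x mu))%E.
Local Notation P := (PO \x PD)%E.
Local Notation rho := (C0 + k1 + k2 + k3).
Local Notation uncovered := (uncovered M g).

Variables (eta b bI br delta : R).
Hypotheses (eta0 : 0 <= eta) (b0 : 0 <= b) (bI0 : 0 <= bI) (br0 : 0 <= br)
  (delta0 : 0 <= delta) (e0 : 0 <= e) (k10 : 0 <= k1) (k20 : 0 <= k2)
  (Ck : C0 + k1 + k2 <= C).
Hypothesis cov : (mu uncovered <= eta%:E)%E.
Hypothesis volb : tvol k 4^-1 = b%:E.
Hypothesis volI : (tvol k (4^-1 - 4 * e ^+ 2) <= bI%:E)%E.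
Hypothesis volr : (tvol k rho <= br%:E)%E.
Hypothesis noise1 : noise_bounded Q1 k (fun s => beta * centered_error m1 s) C k1 delta.
Hypothesis noise2 : noise_bounded Q2 k (fun s => beta * centered_error m2 s) C k2 delta.
Hypothesis noise3 : noise_bounded G k (fun z => beta * z) C k3 delta.

Let m_B1 : measurable_fun setT (fun q : Omega => q.2.1.1).
Proof. exact: (measurableT_comp measurable_fst (measurableT_comp measurable_fst measurable_snd)). Qed.
Let m_T1 : measurable_fun setT (fun q : Omega => q.2.1.2).
Proof. exact: (measurableT_comp measurable_snd (measurableT_comp measurable_fst measurable_snd)). Qed.
Let m_B2 : measurable_fun setT (fun q : Omega => q.2.2.1).
Proof. exact: (measurableT_comp measurable_fst (measurableT_comp measurable_snd measurable_snd)). Qed.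
Let m_T2 : measurable_fun setT (fun q : Omega => q.2.2.2).
Proof. exact: (measurableT_comp measurable_snd (measurableT_comp measurable_snd measurable_snd)). Qed.
Let m_s1 i : measurable_fun setT (fun q : Omega => tnth q.1.1.1 i).
Proof.
apply: measurable_tnth_comp.
exact: (measurableT_comp measurable_fst (measurableT_comp measurable_fst measurable_fst)).
Qed.
Let m_s2 i : measurable_fun setT (fun q : Omega => tnth q.1.1.2 i).
Proof.
apply: measurable_tnth_comp.
exact: (measurableT_comp measurable_snd (measurableT_comp measurable_fst measurable_fst)).
Qed.
Let m_z i : measurable_fun setT (fun q : Omega => tnth q.1.2 i).
Proof.
apply: measurable_tnth_comp.
exact: (measurableT_comp measurable_snd measurable_fst).
Qed.
Let m_shifted m (f : Omega -> V) i : measurable_fun setT f ->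
  measurable_fun setT (fun q => shifted m g (f q) i).
Proof. by move=> mf; exact: (measurableT_comp (measurable_shifted g m i) mf). Qed.
Let m_quant (f : Omega -> V) i : measurable_fun setT f ->
  measurable_fun setT (fun q => tnth (quant g M (f q)) i).
Proof.
move=> mf; apply: measurable_tnth_comp.
exact: (measurableT_comp (measurable_quant g M) mf).
Qed.

Lemma measurable_uncovered : measurable uncovered.
Proof.
rewrite (_ : uncovered = \bigcap_(m in [set: 'I_M])
    ~` [set t | tnorm2 (shifted m g t) <= 4^-1]).
  apply: fin_bigcap_measurable => // m _; apply: measurableC.
  apply: measurable_ler_cst; apply: measurable_tnorm2 => i.
  exact: measurable_shifted.
by apply/seteqP; split=> x /= Zx m; [move=> _|]; exact: Zx.
Qed.

Let prob_uncovered1 : measurable [set q : Omega | uncovered q.2.1.2] /\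
  (P [set q | uncovered q.2.1.2] <= eta%:E)%E.
Proof.
have mA : measurable [set q : Omega | uncovered q.2.1.2].
  exact: (measurable_preim m_T1 measurable_uncovered).
split=> //; apply: product_prob_le => // o.
have mA1 := measurable_section_l o mA.
apply: product_prob_ler => // u2.
have mA2 := measurable_section_r u2 mA1.
exact: product_prob_le.
Qed.

Let prob_uncovered2 : measurable [set q : Omega | uncovered q.2.2.2] /\
  (P [set q | uncovered q.2.2.2] <= eta%:E)%E.
Proof.
have mA : measurable [set q : Omega | uncovered q.2.2.2].
  exact: (measurable_preim m_T2 measurable_uncovered).
split=> //; apply: product_prob_le => // o.
have mA1 := measurable_section_l o mA.
apply: product_prob_le => // u1.
have mA2 := measurable_section_l u1 mA1.
exact: product_prob_le.
Qed.

(** The first point falls in its ball with probability [b]; given it, the second must fall in a cap.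
    Keeping the factor [b] matters: [M] is about [s^k / b], so the union over pairs is of order
    [(M b)^2 cI^k]. *)
Let prob_aligned (m m' : nat) :
  measurable [set q : Omega | aligned g e m m' q.2.1.2 q.2.2.2] /\
  (P [set q | aligned g e m m' q.2.1.2 q.2.2.2] <= (b * bI)%:E)%E.
Proof.
have mA : measurable [set q : Omega | aligned g e m m' q.2.1.2 q.2.2.2].
  rewrite (_ : [set q | _] = [set q : Omega | tnorm2 (shifted m g q.2.1.2) <= 4^-1] `&`
    [set q : Omega | tnorm2 (shifted m' g q.2.2.2) <= 4^-1] `&`
    [set q : Omega | e <= tdot (shifted m' g q.2.2.2) (shifted m g q.2.1.2)]).
    apply: measurableI; first apply: measurableI.
    - by apply: measurable_ler_cst; apply: measurable_tnorm2 => i; exact: m_shifted.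
    - by apply: measurable_ler_cst; apply: measurable_tnorm2 => i; exact: m_shifted.
    - by apply: measurable_ger_cst; apply: measurable_tdot => i; exact: m_shifted.
  by apply/seteqP; split=> q /=; [move=> [? ? ?]|move=> [[? ?] ?]].
split=> //; apply: product_prob_le => //; first by rewrite lee_fin mulr_ge0.
move=> o; have mA1 := measurable_section_l o mA.
have mball : measurable [set t : V | tnorm2 (shifted m g t) <= 4^-1].
  by apply: measurable_ler_cst; apply: measurable_tnorm2 => i; exact: measurable_shifted.
pose B := [set u : V * V | tnorm2 (shifted m g u.2) <= 4^-1].
have mB : measurable B by exact: (measurable_preim measurable_snd mball).
rewrite EFinM; apply: (@le_trans _ _ ((mu \x mu) B * bI%:E)%E); last first.
  apply: lee_wpmul2r; first by rewrite lee_fin.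
  apply: product_prob_le => //.
  by move=> B1; rewrite -volb -(tvol_translate (fun i => - (m%:R * tnth g i))).
apply: product_prob_le_l => //; first by move=> u1 u2 [].
move=> [B1 t1] t1ball; have mA2 := measurable_section_l (B1, t1) mA1.
apply: product_prob_le => //.
move=> B2; apply: le_trans volI.
apply: le_trans (tvol_cap (y := shifted m g t1) t1ball e0).
pose S := [set t : V | tnorm2 (tnth t) <= 4^-1 /\ e <= tdot (tnth t) (shifted m g t1)].
have mS : measurable S.
  apply: measurableI; first exact: measurable_tball.
  apply: measurable_ger_cst; apply: measurable_tdot => i //.
  exact: measurable_tnth.
rewrite -(torus_tuple_affine (fun i => - (m'%:R * tnth g i)) (ltn0Sn 0) mS).
have E t : tnorm2 (tnth [tuple cfrac (- (m'%:R * tnth g i) + 1%:R * tnth t i) | i < k]) =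
    tnorm2 (shifted m' g t) /\
    tdot (tnth [tuple cfrac (- (m'%:R * tnth g i) + 1%:R * tnth t i) | i < k]) (shifted m g t1) =
    tdot (shifted m' g t) (shifted m g t1).
  have F i : cfrac (tnth [tuple cfrac (- (m'%:R * tnth g i) + 1%:R * tnth t i) | i < k] i) =
      cfrac (shifted m' g t i).
    rewrite tnth_mktuple mul1r addrC.
    by have := cfracDl (tnth t i - m'%:R * tnth g i) 0; rewrite !addr0.
  by split; apply: eq_bigr => i _; rewrite F.
rewrite le_eqVlt; apply/orP; left; apply/eqP; congr (mu _).
apply/seteqP; split=> t /=; rewrite /S /= (E t).1 (E t).2; first by move=> [].
by move=> [].
Qed.

Let prob_noisy : measurable [set q : Omega | noisy le_kn M g L alpha rho m1 m2 C0 q] /\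
  (P [set q | noisy le_kn M g L alpha rho m1 m2 C0 q] <= (3 * delta)%:E)%E.
Proof.
have mx i : measurable_fun setT (fun q : Omega =>
    residual_input M g alpha q.2.1.2 q.2.2.2 i).
  by apply: measurable_funM => //; apply: measurable_funD; exact: m_quant.
have mce m (f : Omega -> R * R) : measurable_fun setT f ->
    measurable_fun setT (fun q => beta * centered_error m (f q)).
  move=> mf; apply: measurable_funM => //; apply: measurable_funB => //.
  apply: measurable_funB; first exact: (measurableT_comp measurable_fst mf).
  exact: (measurableT_comp measurable_snd mf).
have mA : measurable [set q : Omega | noisy le_kn M g L alpha rho m1 m2 C0 q].
  apply: measurableI; first apply: measurable_ler_cst; last apply: measurable_ger_cst.
    by apply: measurable_sum => i; exact: measurable_funX.
  apply: measurable_sum => i; apply: measurable_funX; apply: measurable_funD.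
    apply: measurable_funD; last exact: mce.
    by apply: measurable_funD; last exact: mce.
  exact: measurable_funM.
split=> //; apply: product_prob_ler => //; first by rewrite lee_fin mulr_ge0.
move=> u; have mA1 := measurable_section_r u mA.
have [h|h] := leP (\sum_(i < k) residual_input M g alpha u.1.2 u.2.2 i ^+ 2) C0; last first.
  rewrite (_ : [set _ | _] = set0) ?measure0 ?lee_fin ?mulr_ge0//.
  by apply/seteqP; split=> // o [/= h' _]; move: h; rewrite ltNge h'.
have mc1 m : measurable_fun setT (fun s : R * R => beta * centered_error m s).
  apply: measurable_funM => //; apply: measurable_funB => //; exact: measurable_funB.
have mc3 : measurable_fun setT (fun z : R => beta * z) by exact: measurable_funM.
apply: le_trans (prob_three_noises_le le_kn (mc1 m1) (mc1 m2) mc3 delta0 k10 k20 Ck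
  noise1 noise2 noise3 h).
rewrite le_eqVlt; apply/orP; left; apply/eqP; congr (_ _).
by apply/seteqP; split=> o /=; [move=> []|split].
Qed.

(** After the change of dithers, [B_1] and [B_2] enter this point only through [- d1 B_1] and
    [- d2 B_2]. Fixing everything but one with a nonzero coefficient leaves a uniform point. *)
Let prob_confusion (d1 d2 : int) (m : nat) : (d1 != 0) || (d2 != 0) ->
  measurable [set q : Omega | tnorm2 (confusion le_kn M g L alpha m1 m2 d1 d2 m q) <= rho] /\
  (P [set q | (tnorm2 (confusion le_kn M g L alpha m1 m2 d1 d2 m q) <= rho)%R] <= br%:E)%E.
Proof.
move=> d12.
have mA : measurable [set q : Omega |
    tnorm2 (confusion le_kn M g L alpha m1 m2 d1 d2 m q) <= rho].
  apply: measurable_ler_cst; apply: measurable_tnorm2 => i.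
  apply: measurable_funB; last first.
    by apply: measurable_funM => //; exact: measurable_tnth_comp.
  apply: measurable_funB; last first.
    by apply: measurable_funM => //; exact: measurable_tnth_comp.
  apply: measurable_funD => //.
  apply: measurable_funB; last first.
    by apply: measurable_funM => //; exact: (measurableT_comp measurable_snd (m_s2 _)).
  apply: measurable_funB; last exact: measurable_tnth_comp.
  apply: measurable_funB; last first.
    by apply: measurable_funM => //; exact: (measurableT_comp measurable_snd (m_s1 _)).
  apply: measurable_funB; last exact: measurable_tnth_comp.
  apply: measurable_funM => //; apply: measurable_funB => //.
  apply: measurable_funD => //; apply: measurable_funD.
    apply: measurable_funD; last exact: (measurableT_comp measurable_fst (m_s1 _)).
    by apply: measurable_funD; apply: measurable_funM => //; exact: m_quant.
  exact: (measurableT_comp measurable_fst (m_s2 _)).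
split=> //; apply: product_prob_le => // o.
have mA1 := measurable_section_l o mA.
have [d10|d10] := boolP (d1 != 0).
  apply: product_prob_ler => // u2.
  have mA2 := measurable_section_r u2 mA1.
  apply: product_prob_ler => // t1; apply: le_trans volr.
  have d1N : - d1 != 0 by rewrite oppr_eq0.
  (* The offset is the rest of the point, obtained with coefficient 0; the zero tuple stands in for
     [B_1]. *)
  rewrite -(tvol_affine (fun i => confusion le_kn M g L alpha m1 m2 0 d2 m
    (o, (([tuple 0 | i < k], t1), u2)) i) rho d1N).
  rewrite le_eqVlt; apply/orP; left; apply/eqP; congr (mu _).
  by apply/seteqP; split=> B /=; congr (_ <= _); apply: eq_bigr => i _;
    congr (cfrac _ ^+ 2); rewrite /confusion /= intrN; ring.
have d20 : d2 != 0 by move: d12; rewrite (negbTE d10).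
apply: product_prob_le => // u1.
have mA2 := measurable_section_l u1 mA1.
apply: product_prob_ler => // t2; apply: le_trans volr.
have d2N : - d2 != 0 by rewrite oppr_eq0.
rewrite -(tvol_affine (fun i => confusion le_kn M g L alpha m1 m2 d1 0 m
  (o, (u1, ([tuple 0 | i < k], t2))) i) rho d2N).
rewrite le_eqVlt; apply/orP; left; apply/eqP; congr (mu _).
by apply/seteqP; split=> B /=; congr (_ <= _); apply: eq_bigr => i _;
  congr (cfrac _ ^+ 2); rewrite /confusion /= intrN; ring.
Qed.

Definition bad_event (M1 M2 : nat) (w : 'I_M1 * 'I_M2) : set Omega :=
  [set q | uncovered q.2.1.2] `|` [set q | uncovered q.2.2.2]
  `|` [set q | exists mm : 'I_M * 'I_M, aligned g e mm.1 mm.2 q.2.1.2 q.2.2.2]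
  `|` [set q | noisy le_kn M g L alpha rho m1 m2 C0 q]
  `|` [set q | exists pm : ('I_M1 * 'I_M2) * 'I_(2 * M), pm.1 != w /\
     tnorm2 (confusion le_kn M g L alpha m1 m2
      (pm.1.1%:Z - w.1%:Z) (pm.1.2%:Z - w.2%:Z) pm.2 q) <= rho].

Lemma prob_bad_event (M1 M2 : nat) (w : 'I_M1 * 'I_M2) :
  measurable (bad_event w) /\
  (P (bad_event w) <= (2 * eta + M%:R ^+ 2 * (b * bI) + 3 * delta
     + (M1 * M2)%:R * (2 * M)%:R * br)%:E)%E.
Proof.
have [mU1 pU1] := prob_uncovered1; have [mU2 pU2] := prob_uncovered2.
have [mN pN] := prob_noisy.
pose PP : probability _ R := P.
have [mI pI] := @prob_exists_le _ _ R PP _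
  (fun mm : 'I_M * 'I_M => [set q | aligned g e mm.1 mm.2 q.2.1.2 q.2.2.2]) (b * bI)
  (fun mm => (prob_aligned mm.1 mm.2).1) (fun mm => (prob_aligned mm.1 mm.2).2).
have conf (pm : ('I_M1 * 'I_M2) * 'I_(2 * M)) :
   measurable [set q : Omega | pm.1 != w /\ tnorm2 (confusion le_kn M g L alpha m1 m2
      (pm.1.1%:Z - w.1%:Z) (pm.1.2%:Z - w.2%:Z) pm.2 q) <= rho] /\
   (P [set q | pm.1 != w /\ (tnorm2 (confusion le_kn M g L alpha m1 m2
      (pm.1.1%:Z - w.1%:Z) (pm.1.2%:Z - w.2%:Z) pm.2 q) <= rho)%R] <= br%:E)%E.
  have [->|pw] := eqVneq pm.1 w.
    rewrite (_ : [set q : Omega | _] = set0); last first.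
      by apply/seteqP; split=> // q [].
    by rewrite (measure0 PP) lee_fin.
  rewrite (_ : [set q : Omega | _] = [set q : Omega | tnorm2 (confusion le_kn M g L alpha m1 m2
      (pm.1.1%:Z - w.1%:Z) (pm.1.2%:Z - w.2%:Z) pm.2 q) <= rho]); last first.
    by apply/seteqP; split=> q /=; [case|].
  apply: prob_confusion; rewrite !subr_eq0 !eqz_nat -negb_and.
  by apply: contra pw => /andP[/eqP h1 /eqP h2]; apply/eqP; case: (pm.1) w h1 h2
    => [x y] [x' y'] /= h1 h2; congr (_, _); exact: val_inj.
have [mC pC] := @prob_exists_le _ _ R PP _ _ br (fun pm => (conf pm).1) (fun pm => (conf pm).2).
split; first by do 4?[apply: measurableU => //].
rewrite !card_prod !card_ord in pI pC.
rewrite (_ : P = PP)// /bad_event !EFinD.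
apply: le_trans; first by apply: measureU2 => //; do 3?[apply: measurableU => //].
apply: leeD; last by move: pC; rewrite natrM.
apply: le_trans; first by apply: measureU2 => //; do 2?[apply: measurableU => //].
apply: leeD => //.
apply: le_trans; first by apply: measureU2 => //; exact: measurableU.
apply: leeD; last by move: pI; rewrite natrM expr2.
rewrite mulr_natl mulr2n EFinD.
apply: le_trans; first by apply: measureU2.
apply: leeD; [exact: pU1|exact: pU2].
Qed.

End bad_events.

(** * Power and error probability of the code *)

Section torus_code_performance.
Variables (R : realType) (k n : nat) (le_kn : (k <= n)%N).
Variables (M1 M2 M : nat) (p0 : 'I_M1 * 'I_M2).
Variables (g : k.-tuple R) (N L alpha m1 m2 e C0 C k1 k2 k3 : R).
Variables (Q1 Q2 : probability (R * R)%type R).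
Local Notation V := (k.-tuple R).
Local Notation mu := (iid_law (torus R) k).
Local Notation G := (gaussian 0 N).
Local Notation rho := (C0 + k1 + k2 + k3).
Local Notation beta := (alpha / L).
Local Notation code := (torus_code le_kn M p0 g L alpha (m1 + m2) rho).

Let M1_gt0 : (0 < M1)%N. Proof. by case: p0 => -[m mM] _; exact: leq_ltn_trans mM. Qed.
Let M2_gt0 : (0 < M2)%N. Proof. by case: p0 => _ [m mM]; exact: leq_ltn_trans mM. Qed.

Let average_power d (D : measurableType d) (PD : probability D R) (M' : nat)
    (F : 'I_M' -> D -> R) (A P : R) : (0 < M')%N -> (0 < n)%N ->
  (forall w, measurable_fun setT (F w)) -> (forall w x, 0 <= F w x <= A) ->
  A <= n%:R * P ->
  ((n%:R^-1)%:E * ((M'%:R^-1)%:E * \sum_(w < M') 'E_PD[F w]) <= P%:E)%E.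
Proof.
move=> M'0 n0 mF FA AP.
have sumA : (\sum_(w < M') 'E_PD[F w] <= \sum_(w < M') A%:E)%E.
  apply: lee_sum => w _; rewrite unlock.
  apply: (@le_trans _ _ (\int[PD]_x A%:E)%E).
    apply: ge0_le_integral => //.
    - by move=> x _; rewrite lee_fin; case/andP: (FA w x).
    - by apply/measurable_EFinP; exact: mF.
    - by move=> x _; rewrite lee_fin; case/andP: (FA w x).
  by rewrite integral_cst// [X in (_ * X)%E]probability_setT mule1.
apply: (@le_trans _ _ ((n%:R^-1)%:E * ((M'%:R^-1)%:E * \sum_(w < M') A%:E))%E).
  by apply: lee_wpmul2l; rewrite ?lee_fin ?invr_ge0//; apply: lee_wpmul2l;
    rewrite ?lee_fin ?invr_ge0.
rewrite sumEFin sumr_const card_ord -[A *+ M']mulr_natl -!EFinM lee_fin.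
by rewrite mulKf ?pnatr_eq0 -?lt0n// ler_pdivrMl ?ltr0n.
Qed.

Let measurable_sqnorm : measurable_fun setT (@sqnorm R n).
Proof.
by apply: measurable_sum => i; apply: measurable_funX; exact: measurable_tnth.
Qed.

Let sqnorm_encoder w q : 0 <= sqnorm (encoder le_kn M g L alpha w q) <= L ^+ 2 / 4.
Proof.
by rewrite encoder_energy andbT; apply: sumr_ge0 => i _; exact: sqr_ge0.
Qed.

Let measurable_sqnorm_encoder d (D : measurableType d) w (f : D -> n.-tuple R * (V * V)) :
  measurable_fun setT f ->
  measurable_fun setT (fun x => sqnorm (encoder le_kn M g L alpha w (f x))).
Proof.
move=> mf; apply: (measurableT_comp measurable_sqnorm).
exact: (measurableT_comp (measurable_encoder le_kn M g L alpha w) mf).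
Qed.

Lemma torus_code_power (P : R) : (0 < n)%N -> L ^+ 2 / 4 <= n%:R * P ->
  (power1 Q1 code <= P%:E)%E /\ (power2 Q2 code <= P%:E)%E.
Proof.
move=> n0 LP.
have mest : measurable_fun setT (fun q : n.-tuple (R * R) * (V * V) => (estimate q.1, q.2)).
  by apply: measurable_fun_pair => //; exact: (measurableT_comp (@measurable_estimate R n)).
by split; apply: average_power LP => // w;
  try exact: (measurable_sqnorm_encoder w mest); move=> x; exact: sqnorm_encoder.
Qed.

Variables (eta b bI br delta : R).
Hypotheses (eta0 : 0 <= eta) (b0 : 0 <= b) (bI0 : 0 <= bI) (br0 : 0 <= br)
  (delta0 : 0 <= delta) (e0 : 0 <= e) (k10 : 0 <= k1) (k20 : 0 <= k2)
  (Ck : C0 + k1 + k2 <= C) (L0 : L != 0)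
  (C0e : (1 - alpha) ^+ 2 * (2^-1 + 2 * e) <= C0).
Hypothesis cov : (mu (uncovered M g) <= eta%:E)%E.
Hypothesis volb : tvol k 4^-1 = b%:E.
Hypothesis volI : (tvol k (4^-1 - 4 * e ^+ 2) <= bI%:E)%E.
Hypothesis volr : (tvol k rho <= br%:E)%E.
Hypothesis noise1 : noise_bounded Q1 k (fun s => beta * centered_error m1 s) C k1 delta.
Hypothesis noise2 : noise_bounded Q2 k (fun s => beta * centered_error m2 s) C k2 delta.
Hypothesis noise3 : noise_bounded G k (fun z => beta * z) C k3 delta.
Local Notation Omega := ((n.-tuple (R * R) * n.-tuple (R * R) * n.-tuple R) *
  ((V * V) * (V * V)))%type.

Let transmit (w : 'I_M1 * 'I_M2) (q : Omega) : n.-tuple R :=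
  output (encoder le_kn M g L alpha w.1 (estimate q.1.1.1, q.2.1))
    (encoder le_kn M g L alpha w.2 (estimate q.1.1.2, q.2.2)) q.1.1.1 q.1.1.2 q.1.2.

Let measurable_transmit w : measurable_fun setT (transmit w).
Proof.
have m1' : measurable_fun setT (fun q : Omega => q.2.1).
  exact: (measurableT_comp measurable_fst measurable_snd).
have m2' : measurable_fun setT (fun q : Omega => q.2.2).
  exact: (measurableT_comp measurable_snd measurable_snd).
have ms1 : measurable_fun setT (fun q : Omega => q.1.1.1).
  exact: (measurableT_comp measurable_fst (measurableT_comp measurable_fst measurable_fst)).
have ms2 : measurable_fun setT (fun q : Omega => q.1.1.2).
  exact: (measurableT_comp measurable_snd (measurableT_comp measurable_fst measurable_fst)).
have mz : measurable_fun setT (fun q : Omega => q.1.2).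
  exact: (measurableT_comp measurable_snd measurable_fst).
have menc w' (f : Omega -> n.-tuple (R * R)) (h : Omega -> V * V) i :
  measurable_fun setT f -> measurable_fun setT h ->
  measurable_fun setT (fun q => tnth (encoder le_kn M g L alpha w' (estimate (f q), h q)) i).
  move=> mf mh; apply: measurable_tnth_comp.
  apply: (measurableT_comp (measurable_encoder le_kn M g L alpha w')).
  apply: measurable_fun_pair => //; exact: (measurableT_comp (@measurable_estimate R n)).
apply/measurable_fun_tnthP => i.
rewrite (_ : _ \o _ = fun q =>
   tnth (encoder le_kn M g L alpha w.1 (estimate q.1.1.1, q.2.1)) i +
   tnth (encoder le_kn M g L alpha w.2 (estimate q.1.1.2, q.2.2)) i +
   (tnth q.1.1.1 i).1 + (tnth q.1.1.2 i).1 + tnth q.1.2 i); last first.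
  by apply/funext => q /=; rewrite !tnth_mktuple.
apply: measurable_funD; last exact: measurable_tnth_comp.
apply: measurable_funD; last first.
  exact: (measurableT_comp measurable_fst (measurable_tnth_comp i ms2)).
apply: measurable_funD; last first.
  exact: (measurableT_comp measurable_fst (measurable_tnth_comp i ms1)).
by apply: measurable_funD; exact: menc.
Qed.

Lemma torus_code_error :
  (error_probability N Q1 Q2 code <= (2 * eta + M%:R ^+ 2 * (b * bI) + 3 * delta
     + (M1 * M2)%:R * (2 * M)%:R * br)%:E)%E.
Proof.
set B := 2 * eta + _ + _ + _.
have key (w1 : 'I_M1) (w2 : 'I_M2) :
  ((iid_law Q1 n \x iid_law Q2 n \x noise_law N n \x ((mu \x mu) \x (mu \x mu)))%E
     (@error_event R n M1 M2 code w1 w2) <= B%:E)%E.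
  have [mbad pbad] := prob_bad_event le_kn eta0 b0 bI0 br0 delta0 e0 k10 k20 Ck
    cov volb volI volr noise1 noise2 noise3 (w1, w2).
  apply: le_trans pbad.
  (* The bad event, stated for the changed dithers, is pulled back to the actual ones at no cost in
     probability; the inclusion of the error event is then pointwise. *)
  rewrite -(redither_preserve le_kn L alpha Q1 Q2 G w1 w2 mbad).
  have -> : @error_event R n M1 M2 code w1 w2 = [set q : Omega |
      (~` (decoder le_kn M p0 g L alpha (m1 + m2) rho @^-1` [set (w1, w2)]))
      (transmit (w1, w2) q, q.2)].
    by apply/seteqP; split=> -[[[s1 s2] z] [u1 u2]] /=.
  pose PO : probability _ R := (iid_law Q1 n \x iid_law Q2 n \x iid_law G n)%E.
  pose PD : probability _ R := ((mu \x mu) \x (mu \x mu))%E.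
  pose PP : probability _ R := (PO \x PD)%E.
  have -> : (iid_law Q1 n \x iid_law Q2 n \x noise_law N n \x
    ((mu \x mu) \x (mu \x mu)))%E = PP :> (set Omega -> \bar R) by [].
  have mt : measurable_fun setT (fun q : Omega => (transmit (w1, w2) q, q.2)).
    by apply: measurable_fun_pair => //; exact: measurable_transmit.
  apply: le_measure; rewrite ?inE.
  - apply: (measurable_preim mt); apply: measurableC; exact: measurable_decoder.
  - exact: (measurable_preim (measurable_redither le_kn L alpha w1 w2) mbad).
  - move=> q /= err; apply: contrapT => nbad; apply: err.
    move: nbad; rewrite /bad_event /= => nbad.
    apply: (@decoder_correct R k n le_kn M1 M2 M p0 g L alpha rho m1 m2 e C0 w1 w2 q L0 C0e).
    + by move=> h; apply: nbad; left; left; left; left.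
    + by move=> h; apply: nbad; left; left; left; right.
    + by move=> m m' h; apply: nbad; left; left; right; exists (m, m').
    + by move=> h; apply: nbad; left; right.
    + by move=> p m pw h; apply: nbad; right; exists (p, m); split=> //; exact/eqP.
rewrite /error_probability.
have M12 : 0 < M1%:R * M2%:R :> R by rewrite mulr_gt0// ltr0n.
apply: (@le_trans _ _ (((M1%:R * M2%:R)^-1)%:E * \sum_(w1 < M1) \sum_(w2 < M2) B%:E)%E).
  apply: lee_wpmul2l; first by rewrite lee_fin invr_ge0 ltW.
  by apply: lee_sum => w1 _; apply: lee_sum => w2 _; exact: key.
under eq_bigr do rewrite sumEFin sumr_const card_ord -[B *+ M2]mulr_natl.
rewrite sumEFin sumr_const card_ord -[(M2%:R * B) *+ M1]mulr_natl -EFinM lee_fin.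
by rewrite mulrA mulKf// gt_eqF.
Qed.

End torus_code_performance.

(** * Rates *)

Section noise_scaled.
Context d (T : measurableType d) (R : realType) (Q : probability T R).
Variables (f : T -> R) (v : R).
Hypotheses (mf : measurable_fun setT f) (v0 : 0 <= v).
Hypothesis f_mean : (\int[Q]_x (f x)%:E = 0)%E.
Hypothesis f_var : (\int[Q]_x (f x ^+ 2)%:E <= v%:E)%E.

(** The squared scale is of order [1/k], so a block energy near [k v] becomes independent of [k]: on
    the torus the radii stay fixed while the dimension grows. *)
Lemma noise_scaled (p alpha C e delta : R) : 0 < p -> 0 < alpha -> 0 < e -> 0 < delta ->
  exists K : R, forall k, (0 < k)%N -> K <= k%:R ->
  noise_bounded Q k (fun x => alpha / (2 * Num.sqrt (k%:R * p)) * f x) C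
    (alpha ^+ 2 * (v + e) / (4 * p)) delta.
Proof.
move=> p0 alpha0 e0 delta0.
have [K HK] := noise_energy mf v0 f_mean f_var (4 * p * C / alpha ^+ 2) e0 delta0.
exists K => k k0 kK a aC.
have kp0 : 0 < k%:R * p by rewrite mulr_gt0// ltr0n.
have k0' : 0 < k%:R :> R by rewrite ltr0n.
set beta := alpha / _.
have beta0 : 0 < beta by rewrite divr_gt0// mulr_gt0// sqrtr_gt0.
have beta2 : beta ^+ 2 = alpha ^+ 2 / (4 * (k%:R * p)).
  rewrite /beta expr_div_n exprMn sqr_sqrtr ?ltW//; congr (_ / (_ * _)); ring.
have beta20 : 0 < beta ^+ 2 by rewrite exprn_gt0.
have sumE : \sum_(i < k) (a i / beta) ^+ 2 = (\sum_(i < k) a i ^+ 2) / beta ^+ 2.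
  by rewrite mulr_suml; apply: eq_bigr => i _; rewrite expr_div_n.
apply: le_trans (HK k kK (fun i => a i / beta) _); last first.
  rewrite sumE ler_pdivrMr//; apply: le_trans aC _.
  rewrite beta2 le_eqVlt; apply/orP; left; apply/eqP.
  by field; rewrite !gt_eqF.
rewrite le_eqVlt; apply/orP; left; apply/eqP; congr (iid_law _ _ _).
rewrite sumE; apply/seteqP; split=> t /=.
all: have -> : \sum_(i < k) (a i + beta * f (tnth t i)) ^+ 2 =
   beta ^+ 2 * \sum_(i < k) (a i / beta + f (tnth t i)) ^+ 2
  by rewrite mulr_sumr; apply: eq_bigr => i _; field; rewrite gt_eqF.
all: have -> : \sum_(i < k) a i ^+ 2 + alpha ^+ 2 * (v + e) / (4 * p) =
   beta ^+ 2 * ((\sum_(i < k) a i ^+ 2) / beta ^+ 2 + k%:R * (v + e))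
  by rewrite [RHS]mulrDr [beta ^+ 2 * (_ / _)]mulrC divfK ?gt_eqF// beta2; congr (_ + _);
     field; rewrite !gt_eqF.
all: by rewrite ler_pM2l.
Qed.

End noise_scaled.

Section centering.
Context d (T : measurableType d) (R : realType) (Q : probability T R).

Lemma centered_moments (f : T -> R) (v : R) : measurable_fun setT f ->
  (\int[Q]_x (f x ^+ 2)%:E = v%:E)%E -> exists m : R,
  (\int[Q]_x (f x - m)%:E = 0)%E /\ (\int[Q]_x ((f x - m) ^+ 2)%:E <= v%:E)%E.
Proof.
move=> mf fv.
have int_f2 : Q.-integrable setT (EFin \o (fun x => f x ^+ 2)).
  apply/integrableP; split.
    by apply/measurable_EFinP; exact: measurable_funX.
  under eq_integral do rewrite /= ger0_norm ?sqr_ge0//.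
  by rewrite fv ltry.
have int_c (c : R) : Q.-integrable setT (EFin \o cst c).
  exact: finite_measure_integrable_cst.
have int_f : Q.-integrable setT (EFin \o f).
  have := integrableD measurableT int_f2 (int_c 1).
  apply: le_integrable => //; first exact/measurable_EFinP.
  move=> x _ /=; rewrite lee_fin [leRHS]ger0_norm ?addr_ge0 ?sqr_ge0//.
  have := sqr_ge0 (`|f x| - 1); rewrite -[f x ^+ 2]real_normK ?num_real//.
  have := normr_ge0 (f x); nra.
have fin : (\int[Q]_x (f x)%:E)%E \is a fin_num by exact: integrable_fin_num.
exists (fine (\int[Q]_x (f x)%:E)); set m := fine _.
have fm : (\int[Q]_x (f x)%:E)%E = m%:E by rewrite fineK.
have cstE (c : R) : (\int[Q]_x c%:E = c%:E)%E.
  by rewrite integral_cst// [X in (_ * X)%E]probability_setT mule1.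
split.
  under eq_integral do rewrite EFinB.
  by rewrite integralB//= ?cstE ?fm ?subee//; exact: int_c.
under eq_integral.
  move=> x _; rewrite (_ : (f x - m) ^+ 2 = f x ^+ 2 + (- (2 * m)) * f x + m ^+ 2); last by ring.
  rewrite !EFinD (EFinM (- (2 * m))); over.
have int1 := integrableZl measurableT (- (2 * m)) int_f.
rewrite integralD//=; [|exact: integrableD|exact: int_c].
rewrite integralD//= integralZl//= fv cstE fm -EFinM -!EFinD lee_fin.
have := sqr_ge0 m; nra.
Qed.

End centering.

Lemma absz_ceil_bounds (R : realType) (y : R) : 0 < y ->
  (0 < `|Num.ceil y|)%N /\ y <= (`|Num.ceil y|%N)%:R <= y + 1.
Proof.
move=> y0; have c0 : 0 < Num.ceil y by rewrite ceil_gt0.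
split; first by rewrite absz_gt0 gt_eqF.
rewrite natr_absz ger0_norm ?(ltW c0)//.
have /andP[h1 h2] := ceil_itv y; rewrite h2/=.
by move: h1; rewrite intrB => /ltW; lra.
Qed.

Lemma num_messages_bounds (R : realType) (n : nat) (r : R) : 0 <= r ->
  (0 < num_messages n r)%N /\ (num_messages n r)%:R <= 2 * 2 `^ (n%:R * r).
Proof.
move=> r0; have y1 : 1 <= 2 `^ (n%:R * r) :> R.
  by rewrite -[leLHS](powRr0 2) ler_powR ?ler1n// mulr_ge0.
have [c0 /andP[_ h]] := absz_ceil_bounds (lt_le_trans ltr01 y1).
by split=> //; rewrite /num_messages; apply: le_trans h _; lra.
Qed.

Section code_existence.
Variables (R : realType) (N : R) (Q1 Q2 : probability (R * R)%type R).
Variables (p alpha m1 m2 e C0 C k1 k2 k3 theta s cI : R).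
Hypotheses (p0 : 0 < p) (e0 : 0 <= e) (k10 : 0 <= k1) (k20 : 0 <= k2)
  (Ck : C0 + k1 + k2 <= C) (C0e : (1 - alpha) ^+ 2 * (2^-1 + 2 * e) <= C0)
  (theta01 : 0 < theta <= 1) (rho_theta : C0 + k1 + k2 + k3 <= theta ^+ 2 / 4)
  (s1 : 1 <= s) (cI01 : 0 < cI <= 1) (cIe : 1 - 16 * e ^+ 2 <= cI ^+ 2).

(** This is [alpha / L] for [L = 2 sqrt(k p)], the amplitude that turns the squared radius [1/4]
    into [k p]. *)
Definition code_scale (k : nat) : R := alpha / (2 * Num.sqrt (k%:R * p)).

(** The tolerance [delta] is quantified after the code, so that a single sequence of codes serves
    all tolerances. *)
Lemma torus_code_exists (n k M1 M2 : nat) : (k <= n)%N -> (0 < k)%N ->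
  (0 < M1)%N -> (0 < M2)%N -> exists c : Defs.code R n M1 M2,
  (forall P, (0 < n)%N -> k%:R * p <= n%:R * P ->
     (power1 Q1 c <= P%:E)%E /\ (power2 Q2 c <= P%:E)%E) /\
  (forall delta, 0 <= delta ->
     noise_bounded Q1 k (fun x => code_scale k * centered_error m1 x) C k1 delta ->
     noise_bounded Q2 k (fun x => code_scale k * centered_error m2 x) C k2 delta ->
     noise_bounded (gaussian 0 N) k (fun x => code_scale k * x) C k3 delta ->
     (error_probability N Q1 Q2 c <= (4 * s^-1 ^+ k + 4 * (s ^+ 2 * cI) ^+ k
       + 3 * delta + (M1 * M2)%:R * (4 * (s * theta) ^+ k))%:E)%E).
Proof.
move=> le_kn k0 M10 M20.
have [th0 th1] := andP theta01; have [cI0 cI1] := andP cI01.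
pose b := fine (tvol k (4^-1 : R)).
have bE : tvol k 4^-1 = b%:E by rewrite fineK// tvol_fin_num.
have b0 : 0 < b by rewrite -lte_fin -bE; exact: tvol_gt0.
have b1 : b <= 1.
  by rewrite -lee_fin -bE; apply: probability_le1; exact: measurable_tball.
have s0 : 0 < s by exact: lt_le_trans s1.
have sk1 : 1 <= s ^+ k by exact: exprn_ege1.
have sk0 : 0 < s ^+ k by exact: lt_le_trans sk1.
(* [M] is [s^k / b] rounded up, and [b <= 1 <= s^k], so [M b] lies between [s^k] and [2 s^k]. The
   lower bound serves covering, the upper one both union bounds. *)
have [M0 /andP[Ml Mu]] := absz_ceil_bounds (divr_gt0 sk0 b0).
move: (`|_|%N) M0 Ml Mu => M M0 Ml Mu.
have Mb1 : s ^+ k <= M%:R * b by rewrite -ler_pdivrMr.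
have Mb2 : M%:R * b <= 2 * s ^+ k.
  apply: (@le_trans _ _ ((s ^+ k / b + 1) * b)); first by rewrite ler_pM2r.
  by rewrite mulrDl mul1r divfK ?gt_eqF//; lra.
have Mb0 : 0 < M%:R * b by exact: lt_le_trans Mb1.
have [g gcov] := @covering R k M M0.
have L0 : 2 * Num.sqrt (k%:R * p) != 0 :> R.
  by rewrite mulf_neq0// gt_eqF// sqrtr_gt0 mulr_gt0// ltr0n.
exists (torus_code le_kn M (Ordinal M10, Ordinal M20) g (2 * Num.sqrt (k%:R * p)) alpha
  (m1 + m2) (C0 + k1 + k2 + k3)); split.
  move=> P n0 kP; apply: torus_code_power => //; apply: le_trans kP.
  rewrite exprMn sqr_sqrtr ?mulr_ge0 ?(ltW p0)//.
  by rewrite le_eqVlt; apply/orP; left; apply/eqP; field.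
move=> delta delta0 n1 n2 n3.
pose eta := 2 / (M%:R * b).
have eta0 : 0 <= eta by rewrite divr_ge0// ltW.
pose bI := cI ^+ k * b; pose br := theta ^+ k * b.
have bI0 : 0 <= bI by rewrite mulr_ge0 ?exprn_ge0// ltW.
have br0 : 0 <= br by rewrite mulr_ge0 ?exprn_ge0// ltW.
have volI : (tvol k (4^-1 - 4 * e ^+ 2) <= bI%:E)%E.
  rewrite EFinM -bE; apply: le_trans (tvol_scale k cI01 (lexx _)).
  by apply: le_tvol; have := cIe; lra.
have volr : (tvol k (C0 + k1 + k2 + k3) <= br%:E)%E.
  rewrite EFinM -bE; apply: le_trans (tvol_scale k theta01 (lexx _)).
  exact: le_tvol.
apply: le_trans (torus_code_error le_kn (Ordinal M10, Ordinal M20) eta0 (ltW b0) bI0 br0 delta0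
  e0 k10 k20 Ck L0 C0e gcov bE volI volr n1 n2 n3) _.
rewrite lee_fin; apply: lerD; first (apply: lerD => //; apply: lerD).
- rewrite /eta mulrA -natrM exprVn ler_pM2l// lef_pV2//.
- rewrite (_ : _ * (b * bI) = (M%:R * b) ^+ 2 * cI ^+ k); last by rewrite /bI; ring.
  rewrite [(s ^+ 2 * cI) ^+ k]exprMn exprAC mulrA ler_pM2r ?exprn_gt0//.
  rewrite (_ : 4 * _ = (2 * s ^+ k) ^+ 2); last by ring.
  by rewrite ler_sqr ?nnegrE //; [exact: ltW|apply: ltW; rewrite mulr_gt0].
- rewrite -mulrA ler_wpM2l// natrM /br exprMn.
  rewrite (_ : 2 * _ * _ = 2 * (M%:R * b) * theta ^+ k); last by ring.
  rewrite [leRHS]mulrA ler_pM2r ?exprn_gt0//; lra.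
Qed.

End code_existence.

Lemma expr_eventually_le (R : realType) (a c : R) : 0 <= a < 1 -> 0 < c ->
  exists k0 : nat, forall k, (k0 <= k)%N -> a ^+ k <= c.
Proof.
move=> /andP[a0 a1] c0.
have : a ^+ k @[k --> \oo] --> 0.
  by apply: cvg_expr; rewrite ger0_norm.
move=> /cvgrPdist_le/(_ _ c0)[k0 _ H]; exists k0 => k kk.
have := H k kk; rewrite /= sub0r normrN; apply: le_trans; exact: ler_norm.
Qed.

Lemma error_probability_ge0 (R : realType) (N : R) (Q1 Q2 : probability (R * R)%type R)
    n M1 M2 (c : Defs.code R n M1 M2) : (0 <= error_probability N Q1 Q2 c)%E.
Proof.
apply: mule_ge0; first by rewrite lee_fin invr_ge0 mulr_ge0.
apply: sume_ge0 => w1 _; apply: sume_ge0 => w2 _.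
by apply: integral_ge0 => o _; apply: integral_ge0.
Qed.

Lemma ge0_cvg0_ereal (R : realType) (u : nat -> \bar R) : (forall n, 0 <= u n)%E ->
  (forall c : R, 0 < c -> exists n0 : nat, forall n, (n0 <= n)%N -> (u n <= c%:E)%E) ->
  u n @[n --> \oo] --> 0%E.
Proof.
move=> u0 H; apply/fine_cvgP; split.
  have [n0 h] := H 1 ltr01; exists n0 => // n /= nn.
  by rewrite ge0_fin_numE//; exact: le_lt_trans (h n nn) (ltry _).
apply/cvgrPdist_le => c c0; have [n0 h] := H c c0; exists n0 => // n /= nn.
rewrite sub0r normrN ger0_norm ?fine_ge0//.
have fin : u n \is a fin_num.
  by rewrite ge0_fin_numE//; exact: le_lt_trans (h n nn) (ltry _).
by rewrite -lee_fin fineK// h.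
Qed.

Section reliable.
Variables (R : realType) (N p lam P E1 E2 : R) (Q1 Q2 : probability (R * R)%type R).
Local Notation D := (E1 + E2 + N).
Hypotheses (N0 : 0 < N) (p0 : 0 < p) (lam01 : 0 < lam <= 1) (lamP : lam * p <= P).
Hypotheses (E10 : 0 <= E1) (E20 : 0 <= E2).
Hypothesis Q1E : (\int[Q1]_s ((s.1 - s.2) ^+ 2)%:E = E1%:E)%E.
Hypothesis Q2E : (\int[Q2]_s ((s.1 - s.2) ^+ 2)%:E = E2%:E)%E.
Variables (r1 r2 : R).
Hypotheses (r10 : 0 <= r1) (r20 : 0 <= r2).

Let code_exists (C0 C k1 k2 k3 alpha m1 m2 e theta s cI : R) :
  0 <= e -> 0 <= k1 -> 0 <= k2 -> C0 + k1 + k2 <= C ->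
  (1 - alpha) ^+ 2 * (2^-1 + 2 * e) <= C0 -> 0 < theta <= 1 ->
  C0 + k1 + k2 + k3 <= theta ^+ 2 / 4 -> 1 <= s -> 0 < cI <= 1 ->
  1 - 16 * e ^+ 2 <= cI ^+ 2 -> forall n, let k := Num.truncn (lam * n%:R) in
  exists c : Defs.code R n (num_messages n r1) (num_messages n r2),
  ((0 < n)%N -> (power1 Q1 c <= P%:E)%E /\ (power2 Q2 c <= P%:E)%E) /\
  (forall delta, 0 <= delta -> (0 < k)%N ->
     noise_bounded Q1 k (fun x => code_scale p alpha k * centered_error m1 x) C k1 delta ->
     noise_bounded Q2 k (fun x => code_scale p alpha k * centered_error m2 x) C k2 delta ->
     noise_bounded (gaussian 0 N) k (fun x => code_scale p alpha k * x) C k3 delta ->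
     (error_probability N Q1 Q2 c <= (4 * s^-1 ^+ k + 4 * (s ^+ 2 * cI) ^+ k
       + 3 * delta + (num_messages n r1 * num_messages n r2)%:R *
         (4 * (s * theta) ^+ k))%:E)%E).
Proof.
move=> e0 k10 k20 Ck C0e th rt s1 cI01 cIe n k.
have [lam0 lam1] := andP lam01.
have [M10 _] := num_messages_bounds n r10; have [M20 _] := num_messages_bounds n r20.
have ln0 : 0 <= lam * n%:R by rewrite mulr_ge0// ltW.
have /andP[kl _] := truncn_itv ln0; rewrite -/k in kl.
have kn : (k <= n)%N by rewrite -(ler_nat R); apply: le_trans kl _; rewrite ler_piMl.
have kP : k%:R * p <= n%:R * P.
  apply: (@le_trans _ _ (lam * n%:R * p)); first by rewrite ler_wpM2r// ltW.
  by rewrite mulrAC mulrC ler_wpM2l.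
have [k0|k0] := posnP k; last first.
  have [c [cP cE]] := torus_code_exists N Q1 Q2 m1 m2 p0 e0 k10 k20 Ck C0e th rt s1
    cI01 cIe kn k0 M10 M20.
  by exists c; split=> [n0|delta d0 _]; [exact: cP|exact: cE].
(* For small [n] no channel use is available: a silent code meets the power constraint, and the
   error clause assumes [k > 0]. *)
exists (torus_code (leq0n n) 0 (Ordinal M10, Ordinal M20) [tuple] 0 0 (0 + 0) (0 + 0 + 0 + 0)).
split=> [n0|delta d0]; last by rewrite k0.
have LP : 0 ^+ 2 / 4 <= n%:R * P :> R.
  by rewrite expr0n/= mul0r; apply: le_trans kP; rewrite k0 mul0r.
exact: (torus_code_power (leq0n n) 0 (Ordinal M10, Ordinal M20) [tuple] 0 0 0 0 0 0 0 Q1 Q2 n0 LP).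
Qed.

Hypothesis rate : r1 + r2 < lam * (2^-1 * log2 (2^-1 + p / D)).

Lemma reliable_time_shared : reliable_rates N Q1 Q2 P P (r1, r2).
Proof.
have [lam0 lam1] := andP lam01.
have D0 : 0 < D by rewrite ltr_wpDl ?addr_ge0.
have l2 : 0 < ln (2 : R) by rewrite ln_gt0// ltr1n.
have mdiff : measurable_fun setT (fun s : R * R => s.1 - s.2) by exact: measurable_funB.
have [m1 [m1m m1v]] := centered_moments mdiff Q1E.
have [m2 [m2m m2v]] := centered_moments mdiff Q2E.
have mc m : measurable_fun setT (@centered_error R m) by exact: measurable_funB.
have mid : measurable_fun [set: R] (fun x : R => x) by [].
have gm := gaussian_mean N0; have gv := gaussian_second_moment N0.
pose r := (r1 + r2) / lam.
have r0 : 0 <= r by rewrite divr_ge0 ?addr_ge0// ltW.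
pose x : R := 2 `^ r.
have x1 : 1 <= x by rewrite -[leLHS](powRr0 2) ler_powR ?ler1n.
have x0 : 0 < x by exact: lt_le_trans x1.
pose w := 2 * D / (2 * p + D).
have pD0 : 0 < 2 * p + D by rewrite addr_gt0// mulr_gt0.
have w0 : 0 < w by rewrite divr_gt0// mulr_gt0.
have wx : w * x ^+ 2 < 1.
  have h0 : 0 < 2^-1 + p / D by rewrite addr_gt0// divr_gt0.
  have -> : w = (2^-1 + p / D)^-1 by rewrite /w; field; rewrite !gt_eqF//; lra.
  rewrite mulrC ltr_pdivrMr// mul1r -ltr_ln ?posrE ?exprn_gt0//.
  rewrite lnXn// ln_powR -[(r * ln 2) *+ 2]mulr_natl.
  have : r * ln 2 < 2^-1 * ln (2^-1 + p / D).
    by rewrite -ltr_pdivlMr// -mulrA ltr_pdivrMr// mulrC; exact: rate.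
  by lra.
(* [theta] is the relative radius of the decoding ball: its square lies halfway between the noise
   level [w] and [x ^- 2], where the number of messages would take over. *)
pose th2 := (w + x ^- 2) / 2; pose theta := Num.sqrt th2.
have x20 : 0 < x ^+ 2 by rewrite exprn_gt0.
have wx' : w < x ^- 2 by rewrite -div1r ltr_pdivlMr.
have th20 : 0 < th2 by rewrite divr_gt0// addr_gt0// invr_gt0.
have theta2 : theta ^+ 2 = th2 by rewrite sqr_sqrtr// ltW.
have theta0 : 0 < theta by rewrite sqrtr_gt0.
have wth : w < th2 by rewrite /th2; lra.
have thx : (theta * x) ^+ 2 < 1.
  rewrite exprMn theta2 -(mulVf (lt0r_neq0 x20)) ltr_pM2r//; rewrite /th2; lra.
have thx1 : theta * x < 1.
  by rewrite -(@ltr_pXn2r _ 2) ?nnegrE ?expr1n// mulr_ge0 ?ltW.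
have theta1 : theta <= 1.
  apply: le_trans (ltW thx1); rewrite ler_peMr//; exact: ltW.
(* The minimiser of [(1 - alpha)^2 / 2 + alpha^2 D / (4 p)], the limiting energy of the effective
   noise; the minimum is [w / 4]. *)
pose alpha := 2 * p / (2 * p + D).
have alpha0 : 0 < alpha by rewrite divr_gt0// mulr_gt0.
have alpha1 : alpha <= 1 by rewrite ler_pdivrMr// mul1r; lra.
pose tau := (th2 - w) / 4.
have tau0 : 0 < tau by rewrite divr_gt0// subr_gt0.
(* The slack [tau] between [w / 4] and [theta^2 / 4] is shared: [2 e <= tau / 2] for the inner
   product, [3 eps / (4 p) = tau / 2] for the three noises. The bound [1/8] keeps [1 - 16 e^2]
   positive. *)
pose e := Num.min (tau / 4) (8^-1).
have e0 : 0 < e by rewrite lt_min invr_gt0 ltr0n andbT divr_gt0.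
have e8 : e <= 8^-1 by rewrite ge_min lexx orbT.
have et : e <= tau / 4 by rewrite ge_min lexx.
pose eps := 2 * tau * p / 3.
have eps0 : 0 < eps by apply: divr_gt0 => //; apply: mulr_gt0 => //; exact: mulr_gt0.
pose C0 := (1 - alpha) ^+ 2 * (2^-1 + 2 * e).
pose kap (v : R) := alpha ^+ 2 * (v + eps) / (4 * p).
have kap0 v : 0 <= v -> 0 <= kap v.
  move=> v0; apply: divr_ge0; last by rewrite mulr_ge0// ltW.
  by apply: mulr_ge0; [exact: sqr_ge0|apply: addr_ge0 => //; exact: ltW].
pose C := C0 + kap E1 + kap E2.
have rt : C0 + kap E1 + kap E2 + kap N <= theta ^+ 2 / 4.
  have -> : C0 + kap E1 + kap E2 + kap N =
    w / 4 + 2 * e * (1 - alpha) ^+ 2 + alpha ^+ 2 * (tau / 2).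
    rewrite /C0 /kap /eps /alpha /w; field; rewrite !gt_eqF//; lra.
  have a2 : alpha ^+ 2 <= 1 by rewrite expr_le1// ltW.
  have a3 : (1 - alpha) ^+ 2 <= 1 by rewrite expr_le1//; lra.
  have b2 : alpha ^+ 2 * (tau / 2) <= tau / 2 by rewrite ler_piMl// divr_ge0// ltW.
  have b3 : 2 * e * (1 - alpha) ^+ 2 <= 2 * e by rewrite ler_piMr// mulr_ge0// ltW.
  by rewrite theta2; move: b2 b3 et; rewrite /tau; lra.
have e2 : e ^+ 2 <= 8^-1 ^+ 2 by rewrite ler_sqr ?nnegrE ?invr_ge0// ltW.
pose cI := Num.sqrt (1 - 16 * e ^+ 2).
have e20 : 0 < e ^+ 2 by rewrite exprn_gt0.
have cI20 : 0 < 1 - 16 * e ^+ 2 by move: e2; rewrite (_ : 8^-1 ^+ 2 = 64^-1); [lra|field].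
have cI2 : cI ^+ 2 = 1 - 16 * e ^+ 2 by rewrite sqr_sqrtr// ltW.
have cI0 : 0 < cI by rewrite sqrtr_gt0.
have cI1 : cI < 1.
  by rewrite -(@ltr_pXn2r _ 2) ?nnegrE ?expr1n ?cI2//; [lra|exact: ltW].
pose y := Num.max cI (theta * x).
have y1 : y < 1 by rewrite gt_max cI1.
have y0 : 0 < y by rewrite lt_max cI0.
(* [s2 * y] is the midpoint of [y] and 1. Since [s <= s2], it dominates both [s ^+ 2 * cI] and
   [s * (theta * x)]. *)
pose s2 := (1 + y^-1) / 2; pose s := Num.sqrt s2.
have yi : 1 < y^-1 by rewrite invf_gt1.
have s21 : 1 < s2 by rewrite /s2; lra.
have s20 : 0 < s2 by exact: lt_trans s21.
have s2E : s ^+ 2 = s2 by rewrite sqr_sqrtr// ltW.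
have s0 : 0 < s by rewrite sqrtr_gt0.
have s1 : 1 < s by rewrite -(@ltr_pXn2r _ 2) ?nnegrE ?expr1n ?s2E// ltW.
have s2y : s2 * y < 1.
  have -> : s2 * y = (1 + y) / 2 by rewrite /s2; field; rewrite gt_eqF.
  by lra.
have sc1 : s ^+ 2 * cI < 1.
  apply: le_lt_trans s2y; rewrite s2E ler_pM2l// le_max lexx//.
have sth1 : s * (theta * x) < 1.
  apply: le_lt_trans s2y; apply: (@le_trans _ _ (s * y)).
    by rewrite ler_pM2l// le_max lexx orbT.
  by rewrite ler_pM2r// -s2E expr2 ler_peMl ?ltW.
have thp : 0 < theta <= 1 by rewrite theta0.
have cIp : 0 < cI <= 1 by rewrite cI0 ltW.
have cIe : 1 - 16 * e ^+ 2 <= cI ^+ 2 by rewrite cI2.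
have codes := @code_exists C0 C (kap E1) (kap E2) (kap N) alpha m1 m2 e theta s cI
  (ltW e0) (kap0 _ E10) (kap0 _ E20) (lexx _) (lexx _) thp rt (ltW s1) cIp cIe.
pose c n := sval (cid (codes n)); have cP n := svalP (cid (codes n)).
split => //; exists c; split=> [n n0|]; first exact: (cP n).1.
apply: ge0_cvg0_ereal => [n|del del0]; first exact: error_probability_ge0.
have d60 : 0 < del / 6 by rewrite divr_gt0.
have [K1 H1] := noise_scaled (mc m1) E10 m1m m1v C p0 alpha0 eps0 d60.
have [K2 H2] := noise_scaled (mc m2) E20 m2m m2v C p0 alpha0 eps0 d60.
have [K3 H3] := noise_scaled mid (ltW N0) gm gv C p0 alpha0 eps0 d60.
have d24 : 0 < del / 24 by rewrite divr_gt0.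
(* There are at most [4 x^(k+1)] message pairs, as [lam n < k + 1], so the last term is at most
   [16 x] times the power bounded here, that is [del / 6]. The other terms take [del / 6], [del / 6]
   and [del / 2]. *)
have d48 : 0 < del / (96 * x) by rewrite divr_gt0// mulr_gt0.
have si1 : 0 <= s^-1 < 1 by rewrite invr_ge0 ltW//= invf_lt1.
have sc01 : 0 <= s ^+ 2 * cI < 1 by rewrite sc1 mulr_ge0 ?sqr_ge0// ltW.
have st01 : 0 <= s * (theta * x) < 1 by rewrite sth1 !mulr_ge0 ?ltW.
have [j1 J1] := expr_eventually_le si1 d24.
have [j2 J2] := expr_eventually_le sc01 d24.
have [j3 J3] := expr_eventually_le st01 d48.
pose K := Num.max 1 (Num.max K1 (Num.max K2 (Num.max K3
  (Num.max j1%:R (Num.max j2%:R j3%:R))))).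
have [n0 n0K] : exists n0 : nat, K + 1 <= lam * n0%:R.
  exists (`|Num.ceil ((K + 1) / lam)|)%N.
  have K0 : 0 < (K + 1) / lam by rewrite divr_gt0// addr_gt0// lt_max ltr01.
  have [_ /andP[h _]] := absz_ceil_bounds K0.
  by rewrite mulrC -ler_pdivrMr.
exists n0 => n nn0; set k := Num.truncn (lam * n%:R).
have ln0 : 0 <= lam * n%:R by rewrite mulr_ge0// ltW.
have /andP[_ kl] := truncn_itv ln0; rewrite -/k in kl.
have Kk : K <= k%:R.
  move: kl; rewrite -natr1 => kl.
  have nn0' : lam * n0%:R <= lam * n%:R by rewrite ler_pM2l// ler_nat.
  by rewrite -(lerD2r 1); apply: le_trans n0K (le_trans nn0' (ltW kl)).
move: Kk; rewrite !ge_max => /and5P[k1 kK1 kK2 kK3 /and3P[kj1 kj2 kj3]].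
have k0 : (0 < k)%N by rewrite -(ltr_nat R) (lt_le_trans ltr01).
have d60' : 0 <= del / 6 by exact: ltW.
have := (cP n).2 _ d60' k0 (H1 k k0 kK1) (H2 k k0 kK2) (H3 k k0 kK3).
move=> /le_trans; apply; rewrite lee_fin.
have {J1}J1 : s^-1 ^+ k <= del / 24 by apply: J1; rewrite -(ler_nat R).
have {J2}J2 : (s ^+ 2 * cI) ^+ k <= del / 24 by apply: J2; rewrite -(ler_nat R).
have {J3}J3 : (s * (theta * x)) ^+ k <= del / (96 * x) by apply: J3; rewrite -(ler_nat R).
suff : (num_messages n r1 * num_messages n r2)%:R * (4 * (s * theta) ^+ k) <= del / 6.
  move=> J4; apply: le_trans (_ : _ <= 4 * (del / 24) + 4 * (del / 24) + 3 * (del / 6) + del / 6) _.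
    by rewrite lerD// lerD2r lerD// ler_pM2l.
  by rewrite le_eqVlt; apply/orP; left; apply/eqP; field.
have [_ N1] := num_messages_bounds n r10; have [_ N2] := num_messages_bounds n r20.
have stk : 0 < (s * theta) ^+ k by rewrite exprn_gt0// mulr_gt0.
have M12 : (num_messages n r1 * num_messages n r2)%:R <= 4 * (x ^+ k * x).
  rewrite natrM; apply: (le_trans (ler_pM _ _ N1 N2)) => //.
  rewrite [leLHS](_ : _ = 4 * (2 `^ (n%:R * r1) * 2 `^ (n%:R * r2))); last by ring.
  rewrite -powRD; last by rewrite pnatr_eq0 implybT.
  rewrite ler_pM2l// -exprSr -powR_mulrn ?(ltW x0)// -powRrM.
  apply: ler_powR; first by rewrite ler1n.
  rewrite -mulrDr (_ : n%:R * (r1 + r2) = r * (lam * n%:R)); last first.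
    by rewrite /r; field; rewrite gt_eqF.
  by rewrite ler_wpM2l// ltW.
apply: (@le_trans _ _ (4 * (x ^+ k * x) * (4 * (s * theta) ^+ k))).
  by rewrite ler_pM2r// mulr_gt0.
rewrite [leLHS](_ : _ = 16 * x * (s * (theta * x)) ^+ k); last by rewrite !exprMn; ring.
apply: (@le_trans _ _ (16 * x * (del / (96 * x)))); first by rewrite ler_pM2l// mulr_gt0.
by rewrite le_eqVlt; apply/orP; left; apply/eqP; field; rewrite gt_eqF.
Qed.

End reliable.

(** * The upper convex envelope *)

Section tangent.
Variables (R : realType) (D : R).
Hypothesis D0 : 0 < D.

Let l2 : 0 < ln (2 : R). Proof. by rewrite ln_gt0// ltr1n. Qed.

Local Notation rate p := (2^-1 * log2 (2^-1 + p / D)).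

(** Tangent line to the rate curve at the abscissa where [1/2 + x / D = u]. *)
Definition tangent (u x : R) : R := (2 * ln 2)^-1 * (ln u + ((2^-1 + x / D) / u - 1)).

(** The tangent dominates the logarithm by concavity. The condition on [ln u] says that it is
    nonnegative at 0; being increasing, it then dominates the zero branch as well. *)
Lemma envelope_le_tangent (f : R -> R) (u : R) : 0 < u ->
  is_upper_convex_envelope (fun x => Num.max (rate x) 0) f ->
  1 - (2 * u)^-1 <= ln u -> forall x, 0 <= x -> f x <= tangent u x.
Proof.
move=> u0 [_ fmin] lnu x x0; apply: fmin => //; split.
  move=> t a b _ _; rewrite le_eqVlt; apply/orP; left; apply/eqP.
  suff E (s y z : R) : - tangent u (s * y + (1 - s) * z) =
      s * - tangent u y + (1 - s) * - tangent u z by exact: E.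
  by rewrite /tangent; field; rewrite !gt_eqF.
move=> {x0}x x0; rewrite /tangent ge_max; apply/andP; split; last first.
  apply: mulr_ge0; first by rewrite invr_ge0 mulr_ge0// ltW.
  have : 0 <= x / D / u by rewrite !divr_ge0// ltW.
  have -> : (2^-1 + x / D) / u = (2 * u)^-1 + x / D / u.
    by field; rewrite !gt_eqF.
  by lra.
have y0 : 0 < 2^-1 + x / D by rewrite ltr_pwDl// divr_ge0// ltW.
rewrite /log2 (_ : 2^-1 * _ = (2 * ln 2)^-1 * ln (2^-1 + x / D)); last first.
  by field; rewrite gt_eqF.
rewrite ler_pM2l ?invr_gt0 ?mulr_gt0// -lerBlDl -ln_div ?posrE//.
have z0 : 0 < (2^-1 + x / D) / u by rewrite divr_gt0.
have := @le_ln1Dx R ((2^-1 + x / D) / u - 1); rewrite [1 + _]addrCA subrr addr0; apply.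
by rewrite ltrBrDr addNr.
Qed.

Lemma tangent_rate (u p : R) : u = 2^-1 + p / D -> u != 0 -> tangent u p = rate p.
Proof.
by move=> uE u0; rewrite /tangent -uE divff// subrr addr0 /log2 invfM -mulrA (mulrC _ (ln u)).
Qed.

(* [v = 1/2 + q / D] where [q] is the abscissa of the point whose tangent goes through
   the origin. *)
Lemma tangent_point (u : R) : 0 < u -> ln u < 1 - (2 * u)^-1 ->
  exists v, [/\ u <= v & ln v = 1 - (2 * v)^-1].
Proof.
move=> u0 ulow.
pose phi (v : R) := ln v + (2 * v)^-1.
(* At [expR 1] the logarithm alone equals 1, which supplies the upper end for the intermediate value
   theorem. *)
have ue : u <= expR 1.
  rewrite -ler_ln ?posrE ?expR_gt0// expRK; apply: le_trans (ltW ulow) _.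
  by rewrite gerDl oppr_le0 invr_ge0 mulr_ge0// ltW.
have cphi : {within `[u, expR 1], continuous phi}.
  apply: continuous_in_subspaceT => v; rewrite inE/= in_itv/= => /andP[uv _].
  have v0 : 0 < v by exact: lt_le_trans uv.
  apply: cvgD; first exact: continuous_ln.
  apply: cvgV; first by rewrite mulf_neq0// gt_eqF.
  by apply: cvgM; [exact: cvg_cst|exact: cvg_id].
have [|v] := IVT ue cphi (v := 1).
  rewrite ge_min le_max; apply/andP; split; apply/orP; [left|right]; rewrite /phi.
    by move: ulow; lra.
  by rewrite expRK lerDl invr_ge0 mulr_ge0// expR_ge0.
rewrite in_itv/= => /andP[uv _] phiv; exists v; split=> //.
by move: phiv; rewrite /phi; lra.
Qed.

End tangent.

(** Reliability is proved under a strict rate inequality; shrinking a boundary pair towards the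
    origin produces it. *)
Lemma closure_shrink (R : realType) (A : set (R * R)) (a b : R) :
  (forall t : R, 0 < t <= 1 -> A ((1 - t) * a, (1 - t) * b)) -> closure A (a, b).
Proof.
move=> H B nB.
have cv : ((1 - harmonic n) * a, (1 - harmonic n) * b) @[n --> \oo] --> (a, b).
  have c1 : 1 - harmonic n @[n --> \oo] --> (1 : R).
    by rewrite -[X in _ --> X]subr0; apply: cvgB; [exact: cvg_cst|exact: cvg_harmonic].
  have cM (z : R) : (1 - harmonic n) * z @[n --> \oo] --> z.
    by rewrite -[X in _ --> X]mul1r; apply: cvgM => //; exact: cvg_cst.
  exact: cvg_pair (cM a) (cM b).
have [n0 _ Hn] := cv _ nB.
exists ((1 - harmonic n0) * a, (1 - harmonic n0) * b); split; last exact: (Hn n0 (leqnn n0)).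
by apply: H; rewrite /harmonic invr_gt0 ltr0n/= invf_le1 ?ler1n ?ltr0n.
Qed.

Theorem theorem2 (R : realType) (N P E1 E2 : R)
    (Q1 Q2 : probability (R * R)%type R) (ucef : R -> R) (R1 R2 : R) :
  0 < N -> 0 < P -> 0 <= E1 -> 0 <= E2 ->
  ('E_Q1[fun s => ((s.1 - s.2) ^+ 2)%R] = E1%:E)%E ->
  ('E_Q2[fun s => ((s.1 - s.2) ^+ 2)%R] = E2%:E)%E ->
  is_upper_convex_envelope
    (fun p => Num.max (2^-1 * log2 (2^-1 + p / (E1 + E2 + N))) 0) ucef ->
  0 <= R1 -> 0 <= R2 -> R1 + R2 <= ucef P ->
  achievable N Q1 Q2 P P R1 R2.
Proof.
move=> N0 P0 E10 E20; rewrite unlock => Q1E Q2E env R10 R20 sum.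
have D0 : 0 < E1 + E2 + N by rewrite ltr_wpDl ?addr_ge0.
have l2 : 0 < ln (2 : R) by rewrite ln_gt0// ltr1n.
set D := E1 + E2 + N in D0 env *.
have [p [lam [p0 lam01 lamP rate0 ubound]]] : exists p lam : R,
    [/\ 0 < p, 0 < lam <= 1, lam * p <= P,
      0 < lam * (2^-1 * log2 (2^-1 + p / D)) &
      ucef P <= lam * (2^-1 * log2 (2^-1 + p / D))].
  pose u := 2^-1 + P / D.
  have PD : 0 < P / D by rewrite divr_gt0.
  have u0 : 0 < u by rewrite addr_gt0.
  have u2 : (2 * u)^-1 < 1 by rewrite invf_lt1 ?mulr_gt0//; rewrite /u; lra.
  (* If the tangent at [P] is nonnegative at 0, it bounds the envelope and touches the rate at [P]:
     no time sharing is called for. *)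
  have [tang|untang] := leP (1 - (2 * u)^-1) (ln u).
    exists P, 1; rewrite !mul1r; split=> //; first by rewrite ltr01 lexx.
      by rewrite mulr_gt0// divr_gt0//; apply: lt_le_trans tang; rewrite subr_gt0.
    rewrite -(tangent_rate (erefl u)) ?gt_eqF//.
    by apply: envelope_le_tangent => //; exact: ltW.
  have [v [uv vE]] := tangent_point u0 untang.
  have v0 : 0 < v by exact: lt_le_trans uv.
  pose q := D * (v - 2^-1).
  have qD : 2^-1 + q / D = v by rewrite /q; field; rewrite gt_eqF.
  have Pq : P <= q.
    by rewrite /q mulrC -ler_pdivrMr//; move: uv; rewrite /u; lra.
  have q0 : 0 < q by exact: lt_le_trans Pq.
  have v2 : (2 * v)^-1 < 1.
    apply: le_lt_trans u2; rewrite lef_pV2 ?posrE ?mulr_gt0// ler_pM2l//.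
  exists q, (P / q); rewrite qD; split=> //.
  - by rewrite divr_gt0//= ler_pdivrMr// mul1r.
  - by rewrite divfK// gt_eqF.
  - by rewrite mulr_gt0 ?divr_gt0// mulr_gt0// divr_gt0// vE subr_gt0.
  (* The tangent at [v] vanishes at 0, so its value at [P] is [P / q] times the rate at [q]. *)
  - apply: le_trans (envelope_le_tangent D0 v0 env _ (ltW P0)) _; first by rewrite vE.
    rewrite /tangent /log2 vE le_eqVlt; apply/orP; left; apply/eqP; rewrite /q.
    have vh : v - 2^-1 != 0.
      by rewrite gt_eqF//; move: q0; rewrite /q pmulr_rgt0.
    have vh' : 2 * v - 1 != 0 by apply: contra vh => /eqP h; apply/eqP; lra.
    by field; rewrite (mulrC v) vh' !gt_eqF.
apply: closure_shrink => t /andP[t0 t1].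
have t1' : 0 <= 1 - t by rewrite subr_ge0.
apply: (@reliable_time_shared _ N p lam P E1 E2) => //; rewrite ?mulr_ge0//.
(* Strictness comes from the positivity of the time-shared rate, secured above together with [p] and
   [lam]. *)
rewrite -mulrDr; apply: (@le_lt_trans _ _ ((1 - t) * (lam * (2^-1 * log2 (2^-1 + p / D))))).
  by rewrite ler_wpM2l//; exact: le_trans ubound.
by rewrite -[ltRHS]mul1r ltr_pM2r// ltrBlDr ltrDl.
Qed.
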